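(* Let $R$ be a firm ring and $\mathfrak C$ an $A$-coring. Suppose that $F:\mathcal M_R\to\mathcal M^{\mathfrak C}$ and $G:\mathcal M^{\mathfrak C}\to\mathcal M_R$ are functors such that $(F,G)$ is an adjoint pair ($F$ left adjoint to $G$). Put $\Sigma=F(R)$. Then the following statements hold. (a) If $G$ has a right adjoint, then (i) there is a comatrix coring context $(R,A,\Sigma,\Sigma^\dagger,\sigma,\tau)$ with $\Sigma^\dagger=\Sigma^*\otimes_RR$; (ii) $\Sigma$ is $R$-firmly projective (as a right $\mathfrak C$-comodule); (iii) if $R$ is flat as a left $R$-module, then $G\cong-\otimes^{\mathfrak C}(\Sigma^*\otimes_RR)$. (b) If $(F,G)$ is a pair of inverse equivalences of categories, then (i) $\Sigma$ is an $R$-$\mathfrak C$ Galois comodule; in particular $\mathfrak C\cong\Sigma^\dagger\otimes_R\Sigma$ (with $\Sigma^\dagger=\Sigma^*\otimes_RR$) and ${}^*\mathfrak C\cong{}_R\mathrm{End}(\Sigma)$; (ii) $\Sigma$ is an $R$-$\mathfrak C$ comonadic-Galois comodule; in particular $\mathfrak C\cong\Sigma^*\otimes_R\Sigma$ and $\mathfrak C^*\cong\mathrm{End}_R(\Sigma^\dagger)$; (iii) $\Sigma$ is a generator in $\mathcal M^{\mathfrak C}$; (iv) if $R$ is projective as a right $R$-module, then $\Sigma$ is a projective generator in $\mathcal M^{\mathfrak C}$; (v) if $\mathfrak C$ is flat as a left $A$-module, then $\Sigma$ is faithfully flat as a left $R$-module. Conversely, let $R$ be a firm ring, $\mathfrak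 C$ an $A$-coring that is flat as a left $A$-module, and $\Sigma\in{}_R\mathcal M^{\mathfrak C}$. If $\Sigma$ is an $R$-$\mathfrak C$ comonadic-Galois comodule and $\Sigma$ is faithfully flat as a left $R$-module, then $(-\otimes_R\Sigma,\ \mathrm{Hom}^{\mathfrak C}(\Sigma,-)\otimes_RR)$ is a pair of inverse equivalences between $\mathcal M_R$ and $\mathcal M^{\mathfrak C}$.
   Context: $A$ is an associative unital ring; $A$-modules are unital. An $A$-coring is an $A$-bimodule $\mathfrak C$ with coassociative, counital $A$-bilinear maps $\Delta:\mathfrak C\to\mathfrak C\otimes_A\mathfrak C$, $\Delta(c)=c_{(1)}\otimes_Ac_{(2)}$, and $\varepsilon_{\mathfrak C}:\mathfrak C\to A$. $\mathcal M^{\mathfrak C}$ is the category of right $\mathfrak C$-comodules (right $A$-modules $M$ with a coassociative counital right $A$-linear coaction $\rho_M(m)=m_{[0]}\otimes_Am_{[1]}\in M\otimes_A\mathfrak C$) and $\mathfrak C$-colinear maps; $\mathrm{Hom}^{\mathfrak C}$ denotes colinear maps. ${}^*\mathfrak C$ and $\mathfrak C^*$ are the rings of left, respectively right, $A$-linear maps $\mathfrak C\to A$, with products $(f*g)(c)=g(c_{(1)}f(c_{(2)}))$ on ${}^*\mathfrak C$ and $(f*g)(c)=f(g(c_{(1)})c_{(2)})$ on $\mathfrak C^*$. ${}_R\mathrm{End}(\Sigma)$ is the ring of left $R$-linear endomorphisms, written on the right (i.e. with multiplication opposite to the usual composition); $\mathrm{End}_R$ has the usual composition. Firm rings. Rings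 $R$ need not be unital. A right $R$-module $M$ is firm if $M\otimes_RR\to M$, $m\otimes r\mapsto mr$, is an isomorphism; left firm modules are defined symmetrically. $\mathcal M_R$ is the category of firm right $R$-modules. $R$ is a firm ring if it is firm as a right (equivalently left) $R$-module. A firm left module $\Sigma$ is flat if $-\otimes_R\Sigma$ is exact on the category of all (possibly non-firm) right $R$-modules, with values in abelian groups; it is faithfully flat if it is flat and $-\otimes_R\Sigma$ is faithful on $\mathcal M_R$. ''$R$ is projective as a right $R$-module'' refers to projectivity of $R$ as an object of $\mathcal M_R$. ${}_R\mathcal M^{\mathfrak C}$ consists of right $\mathfrak C$-comodules that are firm left $R$-modules (with the $A$-actions commuting with $R$) such that the coaction is left $R$-linear. $\Sigma=F(R)$ carries the left $R$-action $r\cdot u=F(\lambda_r)(u)$, where $\lambda_r:R\to R$ is left multiplication by $r$. Write $\Sigma^*=\mathrm{Hom}_A(\Sigma,A)$ with right $R$-action $(f\cdot r)(u)=f(ru)$. $R$-firm projectivity. $\Sigma\otimes_A\Sigma^*$ is a (possibly non-unital) ring with $(u\otimes_A\varphi)(v\otimes_A\psi)=u\varphi(v)\otimes_A\psi$, acting on $\Sigma$ by $(u\otimes_A\varphi)\cdot v=u\varphi(v)$. $\Sigma$ is $R$-firmly projective as a right $\mathfrak C$-comodule if there is a ring morphism $\iota:R\to\Sigma\otimes_A\Sigma^*$, $\iota(r)=e_r\otimes_Af_r$ (summation understood), such that $\Sigma$ is a firm left $R$-module for the induced action $r\cdot u=e_rf_r(u)$ (which is the given left $R$-action on $\Sigma$),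 and this action is by $\mathfrak C$-colinear maps. Comatrix coring context. For firm rings $R,A$: a tuple $(R,A,\Sigma,\Sigma^\dagger,\eta,\varepsilon)$ where $\Sigma$ is an $R$-$A$-bimodule and $\Sigma^\dagger$ an $A$-$R$-bimodule, both firm on both sides, $\eta:R\to\Sigma\otimes_A\Sigma^\dagger$ is $R$-bilinear, $\varepsilon:\Sigma^\dagger\otimes_R\Sigma\to A$ is $A$-bilinear, and, writing $\eta(r)=e_r\otimes_Af_r$, $e_r\,\varepsilon(f_r\otimes_Ru)=ru$ and $\varepsilon(\varphi\otimes_Re_r)f_r=\varphi r$ for all $r\in R,u\in\Sigma,\varphi\in\Sigma^\dagger$. The associated comatrix coring is $\Sigma^\dagger\otimes_R\Sigma$ with counit $\varepsilon$ and comultiplication $\varphi\otimes_R u\mapsto\varphi\otimes_R\eta(r)\otimes_Ru^r$, where $r\otimes_R u^r\in R\otimes_R\Sigma$ corresponds to $u$ (i.e. $u=ru^r$). If $\Sigma$ is $R$-firmly projective, one takes $\Sigma^\dagger=\Sigma^*\otimes_RR$, and then $\Sigma^\dagger\otimes_R\Sigma\cong\Sigma^*\otimes_R\Sigma$. Galois comodules. $\Sigma$ is an $R$-$\mathfrak C$ Galois comodule if it is $R$-firmly projective as a right $\mathfrak C$-comodule and the coring morphism $\mathsf{can}:\Sigma^*\otimes_R\Sigma\to\mathfrak C$, $\mathsf{can}(f\otimes_Ru)=f(u_{[0]})u_{[1]}$, is an isomorphism. $\Sigma\in{}_R\mathcal M^{\mathfrak C}$ is an $R$-$\mathfrak C$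 comonadic-Galois comodule if for all $M\in\mathcal M_A$ the map $\mathsf{can}_M:\mathrm{Hom}_A(\Sigma,M)\otimes_R\Sigma\to M\otimes_A\mathfrak C$, $f\otimes_Ru\mapsto f(u_{[0]})u_{[1]}$ (i.e. $f(u_{[0]})\otimes_Au_{[1]}$), is an isomorphism. Cotensor product. For a right comodule $N$ and left comodule $L$, $N\otimes^{\mathfrak C}L$ is the kernel of $\rho_N\otimes_AL-N\otimes_A\rho_L:N\otimes_AL\to N\otimes_A\mathfrak C\otimes_AL$. For $\Sigma$ $R$-firmly projective as $\mathfrak C$-comodule, the left $\mathfrak C$-coaction on $\Sigma^*\otimes_RR$ is $\varphi\otimes_Rr\mapsto\mathsf{can}(\varphi\otimes_Re_s)\otimes_A(f_s\otimes_Rr^s)$, where $s\otimes_Rr^s\in R\otimes_RR$ corresponds to $r$. *)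

(* Defs.v *)
From HB Require Import structures.
From mathcomp Require Export all_boot ssralg.
From mathcomp Require Import boolp classical_sets.

Set Implicit Arguments.
Unset Strict Implicit.
Unset Printing Implicit Defensive.

Import GRing.Theory.
Local Open Scope ring_scope.
Local Open Scope quotient_scope.

Record rng := Rng {
  rng_sort :> zmodType;
  rmul : rng_sort -> rng_sort -> rng_sort;
  rmulA : associative rmul;
  rmulDl : left_distributive rmul +%R;
  rmulDr : right_distributive rmul +%R }.
Arguments rmul {r} : rename.

Definition rng_of_ring (A : pzRingType) : rng :=
  @Rng A *%R (@mulrA A) (@mulrDl A) (@mulrDr A).
Coercion rng_of_ring : GRing.PzRing.type >-> rng.

(* Modules need not be firm, nor unital when the ring has a unit: see
   [firm_r], [firm_l], [unital_r], [unital_l] below. *)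
Record rmod (R : rng) := Rmod {
  rm_sort :> zmodType;
  ract : rm_sort -> R -> rm_sort;
  ractDl : forall x y r, ract (x + y) r = ract x r + ract y r;
  ractDr : forall x r s, ract x (r + s) = ract x r + ract x s;
  ractA : forall x r s, ract (ract x r) s = ract x (rmul r s) }.
Arguments ract {R r} : rename.

Record lmod (R : rng) := Lmod {
  lm_sort :> zmodType;
  lmact : R -> lm_sort -> lm_sort;
  lmactDr : forall r x y, lmact r (x + y) = lmact r x + lmact r y;
  lmactDl : forall r s x, lmact (r + s) x = lmact r x + lmact s x;
  lmactA : forall r s x, lmact r (lmact s x) = lmact (rmul r s) x }.
Arguments lmact {R l} : rename.

Record bimod (R S : rng) := Bimod {
  bm_rmod :> rmod S;
  lact : R -> bm_rmod -> bm_rmod;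
  lactDr : forall r x y, lact r (x + y) = lact r x + lact r y;
  lactDl : forall r s x, lact (r + s) x = lact r x + lact s x;
  lactA : forall r s x, lact r (lact s x) = lact (rmul r s) x;
  lactC : forall r x s, ract (lact r x) s = lact r (ract x s) }.
Arguments lact {R S b} : rename.

Definition bm_lmod (R S : rng) (M : bimod R S) : lmod R :=
  Lmod (@lactDr _ _ M) (@lactDl _ _ M) (@lactA _ _ M).
Coercion bm_lmod : bimod >-> lmod.
Canonical bm_lmod.

Definition reg_rmod (R : rng) : rmod R :=
  @Rmod R R rmul (fun x y r => rmulDl x y r) (fun x y r => rmulDr x y r)
    (fun x r s => esym (rmulA x r s)).

Definition reg (R : rng) : bimod R R :=
  @Bimod R R (reg_rmod R) rmul (fun x y r => rmulDr x y r)
    (fun x y r => rmulDl x y r) (fun x r s => rmulA x r s)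
    (fun x r s => esym (rmulA x r s)).

Definition unital_r (A : pzRingType) (M : rmod A) :=
  forall x : M, @ract A M x (1 : A) = x.
Definition unital_l (A : pzRingType) (M : lmod A) :=
  forall x : M, @lmact A M (1 : A) x = x.

Definition rlinear (R : rng) (M N : rmod R) (f : M -> N) :=
  {morph f : x y / x + y} /\ forall x r, f (ract x r) = ract (f x) r.
Definition llinear (R : rng) (M N : lmod R) (f : M -> N) :=
  {morph f : x y / x + y} /\ forall r x, f (lmact r x) = lmact r (f x).
Definition bilinear (R S : rng) (M N : bimod R S) (f : M -> N) :=
  @llinear R M N f /\ @rlinear S M N f.

Record rhom (R : rng) (M N : rmod R) :=
  Rhom { rhom_fun :> M -> N; rhomP : rlinear rhom_fun }.
Record lhom (R : rng) (M N : lmod R) :=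
  Lhom { lhom_fun :> M -> N; lhomP : llinear lhom_fun }.

Lemma rhom_ext (R : rng) (M N : rmod R) (f g : rhom M N) : f =1 g -> f = g.
Proof.
case: f g => f fP [g gP] /= /funext fg; case: _ / fg gP => gP.
by congr Rhom; exact: Prop_irrelevance.
Qed.

Lemma lhom_ext (R : rng) (M N : lmod R) (f g : lhom M N) : f =1 g -> f = g.
Proof.
case: f g => f fP [g gP] /= /funext fg; case: _ / fg gP => gP.
by congr Lhom; exact: Prop_irrelevance.
Qed.

Lemma morphD0 (U V : zmodType) (f : U -> V) : {morph f : x y / x + y} -> f 0 = 0.
Proof. by move=> fD; apply: (addrI (f 0)); rewrite -fD !addr0. Qed.

Lemma morphDN (U V : zmodType) (f : U -> V) :
  {morph f : x y / x + y} -> {morph f : x / - x}.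
Proof.
by move=> fD x; apply: (addrI (f x)); rewrite -fD !subrr morphD0.
Qed.

Lemma ract0 (R : rng) (M : rmod R) (r : R) : ract (0 : M) r = 0.
Proof. by apply: (@morphD0 M M (ract^~ r)) => x y; exact: ractDl. Qed.
Lemma ractN (R : rng) (M : rmod R) (x : M) (r : R) : ract (- x) r = - ract x r.
Proof. by apply: (@morphDN M M (ract^~ r)) => {}x y; exact: ractDl. Qed.
Lemma lmact0 (R : rng) (M : lmod R) (r : R) : lmact r (0 : M) = 0.
Proof. by apply: (@morphD0 M M (lmact r)) => x y; exact: lmactDr. Qed.
Lemma lmactN (R : rng) (M : lmod R) (r : R) (x : M) : lmact r (- x) = - lmact r x.
Proof. by apply: (@morphDN M M (lmact r)) => {}x y; exact: lmactDr. Qed.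

Section HomZmod.
Variables (R : rng) (M N : rmod R).

HB.instance Definition _ := gen_eqMixin (rhom M N).
HB.instance Definition _ := gen_choiceMixin (rhom M N).

Fact rhom_zero_subproof : rlinear (fun _ : M => 0 : N).
Proof. by split=> [x y|x r]; rewrite ?addr0 ?ract0. Qed.
Fact rhom_opp_subproof (f : rhom M N) : rlinear (fun x => - f x).
Proof.
by case: (rhomP f) => fD fZ; split=> [x y|x r]; rewrite ?fD ?fZ ?opprD ?ractN.
Qed.
Fact rhom_add_subproof (f g : rhom M N) : rlinear (fun x => f x + g x).
Proof.
case: (rhomP f) (rhomP g) => fD fZ [gD gZ].
by split=> [x y|x r]; rewrite ?fD ?gD ?fZ ?gZ ?ractDl // addrACA.
Qed.
Definition rhom_zero := Rhom rhom_zero_subproof.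
Definition rhom_opp f := Rhom (rhom_opp_subproof f).
Definition rhom_add f g := Rhom (rhom_add_subproof f g).

Fact rhom_addA : associative rhom_add.
Proof. by move=> f g h; apply: rhom_ext => x /=; rewrite addrA. Qed.
Fact rhom_addC : commutative rhom_add.
Proof. by move=> f g; apply: rhom_ext => x /=; rewrite addrC. Qed.
Fact rhom_add0 : left_id rhom_zero rhom_add.
Proof. by move=> f; apply: rhom_ext => x /=; rewrite add0r. Qed.
Fact rhom_addN : left_inverse rhom_zero rhom_opp rhom_add.
Proof. by move=> f; apply: rhom_ext => x /=; rewrite addNr. Qed.
HB.instance Definition _ :=
  GRing.isZmodule.Build (rhom M N) rhom_addA rhom_addC rhom_add0 rhom_addN.
End HomZmod.

Section LHomZmod.
Variables (R : rng) (M N : lmod R).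

HB.instance Definition _ := gen_eqMixin (lhom M N).
HB.instance Definition _ := gen_choiceMixin (lhom M N).

Fact lhom_zero_subproof : llinear (fun _ : M => 0 : N).
Proof. by split=> [x y|x r]; rewrite ?addr0 ?lmact0. Qed.
Fact lhom_opp_subproof (f : lhom M N) : llinear (fun x => - f x).
Proof.
by case: (lhomP f) => fD fZ; split=> [x y|x r]; rewrite ?fD ?fZ ?opprD ?lmactN.
Qed.
Fact lhom_add_subproof (f g : lhom M N) : llinear (fun x => f x + g x).
Proof.
case: (lhomP f) (lhomP g) => fD fZ [gD gZ].
by split=> [x y|x r]; rewrite ?fD ?gD ?fZ ?gZ ?lmactDr // addrACA.
Qed.
Definition lhom_zero := Lhom lhom_zero_subproof.
Definition lhom_opp f := Lhom (lhom_opp_subproof f).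
Definition lhom_add f g := Lhom (lhom_add_subproof f g).

Fact lhom_addA : associative lhom_add.
Proof. by move=> f g h; apply: lhom_ext => x /=; rewrite addrA. Qed.
Fact lhom_addC : commutative lhom_add.
Proof. by move=> f g; apply: lhom_ext => x /=; rewrite addrC. Qed.
Fact lhom_add0 : left_id lhom_zero lhom_add.
Proof. by move=> f; apply: lhom_ext => x /=; rewrite add0r. Qed.
Fact lhom_addN : left_inverse lhom_zero lhom_opp lhom_add.
Proof. by move=> f; apply: lhom_ext => x /=; rewrite addNr. Qed.
HB.instance Definition _ :=
  GRing.isZmodule.Build (lhom M N) lhom_addA lhom_addC lhom_add0 lhom_addN.
End LHomZmod.

(* Hom_S(M, N) is a T-R-bimodule: (f r)(u) = f(r u) and (t f)(u) = t f(u). *)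
Section HomBimod.
Variables (R S T : rng) (M : bimod R S).

Section RightAction.
Variable N : rmod S.
Fact rhom_ract_subproof (f : rhom M N) (r : R) : rlinear (fun u : M => f (lact r u)).
Proof.
by case: (rhomP f) => fD fZ; split=> [x y|x s]; rewrite ?lactDr ?fD -?lactC ?fZ.
Qed.
Definition rhom_ract f r : rhom M N := Rhom (rhom_ract_subproof f r).
Fact rhom_ractDl f g r : rhom_ract (f + g) r = rhom_ract f r + rhom_ract g r.
Proof. by apply: rhom_ext. Qed.
Fact rhom_ractDr f r s : rhom_ract f (r + s) = rhom_ract f r + rhom_ract f s.
Proof. by apply: rhom_ext => x /=; rewrite lactDl (rhomP f).1. Qed.
Fact rhom_ractA f r s : rhom_ract (rhom_ract f r) s = rhom_ract f (rmul r s).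
Proof. by apply: rhom_ext => x /=; rewrite lactA. Qed.
Definition rhom_rmod : rmod R := Rmod rhom_ractDl rhom_ractDr rhom_ractA.
End RightAction.

Variable N : bimod T S.
Fact rhom_lact_subproof (t : T) (f : rhom M N) : rlinear (fun u : M => lact t (f u)).
Proof.
by case: (rhomP f) => fD fZ; split=> [x y|x s]; rewrite ?fD ?lactDr ?fZ ?lactC.
Qed.
Definition rhom_lact t f : rhom M N := Rhom (rhom_lact_subproof t f).
Fact rhom_lactDr t f g : rhom_lact t (f + g) = rhom_lact t f + rhom_lact t g.
Proof. by apply: rhom_ext => x /=; rewrite lactDr. Qed.
Fact rhom_lactDl s t f : rhom_lact (s + t) f = rhom_lact s f + rhom_lact t f.
Proof. by apply: rhom_ext => x /=; rewrite lactDl. Qed.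
Fact rhom_lactA s t f : rhom_lact s (rhom_lact t f) = rhom_lact (rmul s t) f.
Proof. by apply: rhom_ext => x /=; rewrite lactA. Qed.
Fact rhom_lactC t f r :
  rhom_ract (rhom_lact t f) r = rhom_lact t (rhom_ract f r).
Proof. by apply: rhom_ext. Qed.
Definition rhom_bimod : bimod T R :=
  @Bimod T R (rhom_rmod N) rhom_lact rhom_lactDr rhom_lactDl rhom_lactA rhom_lactC.
End HomBimod.

Record balanced (R : rng) (M : rmod R) (N : lmod R) (P : zmodType)
    (f : M -> N -> P) : Prop := Balanced {
  balDl : forall x x' y, f (x + x') y = f x y + f x' y;
  balDr : forall x y y', f x (y + y') = f x y + f x y';
  balM : forall x r y, f (ract x r) y = f x (lmact r y) }.

(* The tensor product of M and N is the quotient of the set of formal sums of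
   pairs by the coarsest relation through which all balanced maps factor. *)
Section Tensor.
Variables (R : rng) (M : rmod R) (N : lmod R).

Definition tens_eval (P : zmodType) (f : M -> N -> P) (s : seq (M * N)) : P :=
  \sum_(p <- s) f p.1 p.2.

Definition tens_rel (s t : seq (M * N)) : bool :=
  `[< forall (P : zmodType) (f : M -> N -> P),
        balanced f -> tens_eval f s = tens_eval f t >].

Fact tens_rel_refl : reflexive tens_rel.
Proof. by move=> s; apply/asboolP. Qed.
Fact tens_rel_sym : symmetric tens_rel.
Proof. by move=> s t; apply/asboolP/asboolP => st P f fb; rewrite st. Qed.
Fact tens_rel_trans : transitive tens_rel.
Proof.
by move=> t s u /asboolP st /asboolP tu; apply/asboolP => P f fb; rewrite st ?tu.
Qed.
Canonical tens_equiv := EquivRel tens_rel tens_rel_refl tens_rel_sym tens_rel_trans.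

Definition tens := {eq_quot tens_equiv}.
HB.instance Definition _ := Choice.on tens.
HB.instance Definition _ := EqQuotient.on tens.

Definition tpure (m : M) (n : N) : tens := \pi_tens [:: (m, n)].
(* Total by construction; the map induced by f when f is balanced. *)
Definition tlift (P : zmodType) (f : M -> N -> P) (x : tens) : P :=
  tens_eval f (repr x).

Lemma tlift_pi (P : zmodType) (f : M -> N -> P) s :
  balanced f -> tlift f (\pi_tens s) = tens_eval f s.
Proof.
move=> fb; have /eqmodP/asboolP : repr (\pi_tens s) = s %[mod tens] by rewrite reprK.
exact.
Qed.

Lemma tens_eqP (s t : seq (M * N)) :
  (forall (P : zmodType) (f : M -> N -> P),
     balanced f -> tens_eval f s = tens_eval f t) -> \pi_tens s = \pi_tens t.
Proof. by move=> st; apply/eqmodP/asboolP. Qed.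

Lemma tens_eq_repr (x y : tens) :
  (forall (P : zmodType) (f : M -> N -> P), balanced f -> tlift f x = tlift f y) ->
  x = y.
Proof. by move=> xy; rewrite -[x]reprK -[y]reprK; apply: tens_eqP. Qed.

Definition tens_zero : tens := \pi_tens [::].
Definition tens_add (x y : tens) : tens := \pi_tens (repr x ++ repr y).
Definition tens_opp (x : tens) : tens := \pi_tens [seq (- p.1, p.2) | p <- repr x].

Fact tlift_zero (P : zmodType) (f : M -> N -> P) : balanced f -> tlift f tens_zero = 0.
Proof. by move=> fb; rewrite tlift_pi // /tens_eval big_nil. Qed.
Fact tlift_plus (P : zmodType) (f : M -> N -> P) x y :
  balanced f -> tlift f (tens_add x y) = tlift f x + tlift f y.
Proof. by move=> fb; rewrite tlift_pi // /tens_eval big_cat. Qed.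
Fact tlift_opp (P : zmodType) (f : M -> N -> P) x :
  balanced f -> tlift f (tens_opp x) = - tlift f x.
Proof.
move=> fb; rewrite tlift_pi // /tlift /tens_eval big_map -sumrN.
by apply: eq_bigr => p _ /=; apply: (@morphDN M P (f^~ p.2)) => u v; exact: balDl.
Qed.

Fact tens_addA : associative tens_add.
Proof. by move=> x y z; apply: tens_eq_repr => P f fb; rewrite !tlift_plus // addrA. Qed.
Fact tens_addC : commutative tens_add.
Proof. by move=> x y; apply: tens_eq_repr => P f fb; rewrite !tlift_plus // addrC. Qed.
Fact tens_add0 : left_id tens_zero tens_add.
Proof.
by move=> x; apply: tens_eq_repr => P f fb; rewrite tlift_plus // tlift_zero ?add0r.
Qed.
Fact tens_addN : left_inverse tens_zero tens_opp tens_add.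
Proof.
move=> x; apply: tens_eq_repr => P f fb.
by rewrite tlift_plus // tlift_opp // tlift_zero ?addNr.
Qed.
HB.instance Definition _ :=
  GRing.isZmodule.Build tens tens_addA tens_addC tens_add0 tens_addN.

Lemma tliftD (P : zmodType) (f : M -> N -> P) :
  balanced f -> {morph tlift f : x y / x + y}.
Proof. by move=> fb x y; exact: tlift_plus. Qed.

Lemma tliftE (P : zmodType) (f : M -> N -> P) m n :
  balanced f -> tlift f (tpure m n) = f m n.
Proof. by move=> fb; rewrite tlift_pi // /tens_eval big_seq1. Qed.

Lemma tpure_balanced : balanced tpure.
Proof.
split=> *; apply: tens_eq_repr => P f fb; rewrite ?tliftD // !tliftE //.
- exact: balDl.
- exact: balDr.
- exact: balM.
Qed.

Lemma tens_sum (x : tens) : x = \sum_(p <- repr x) tpure p.1 p.2.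
Proof.
apply: tens_eq_repr => P f fb.
have -> : tlift f (\sum_(p <- repr x) tpure p.1 p.2)
          = \sum_(p <- repr x) tlift f (tpure p.1 p.2).
  by apply: (big_morph _ (tliftD fb)); exact: tlift_zero.
by apply: eq_bigr => p _; rewrite tliftE.
Qed.

Lemma tens_ind (Q : tens -> Prop) :
  Q 0 -> (forall x y, Q x -> Q y -> Q (x + y)) -> (forall m n, Q (tpure m n)) ->
  forall x, Q x.
Proof. by move=> Q0 QD Qp x; rewrite (tens_sum x); apply: big_ind. Qed.

Lemma tens_ext (P : zmodType) (f g : tens -> P) :
  {morph f : x y / x + y} -> {morph g : x y / x + y} ->
  (forall m n, f (tpure m n) = g (tpure m n)) -> f =1 g.
Proof.
move=> fD gD fg; elim/tens_ind=> [|x y fgx fgy|//]; first by rewrite !morphD0.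
by rewrite fD gD fgx fgy.
Qed.

Lemma tlift_add (P : zmodType) (f g h : M -> N -> P) x :
  (forall m n, h m n = f m n + g m n) -> tlift h x = tlift f x + tlift g x.
Proof.
by move=> hE; rewrite /tlift /tens_eval -big_split; apply: eq_bigr => p _.
Qed.

Lemma tlift_eq (P : zmodType) (f g : M -> N -> P) x :
  (forall m n, f m n = g m n) -> tlift f x = tlift g x.
Proof. by move=> fg; apply: eq_bigr => p _. Qed.

Lemma tlift_comp (P Q : zmodType) (f : M -> N -> P) (g : P -> Q) x :
  {morph g : x y / x + y} -> g (tlift f x) = tlift (fun m n => g (f m n)) x.
Proof. by move=> gD; apply: (big_morph _ gD); exact: morphD0. Qed.
End Tensor.

Arguments tpure {R M N} & m n.
Arguments tlift {R M N P} & f x.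
Notation "m ⊗ n" := (tpure m n) (at level 40, left associativity) : ring_scope.

Section TensorPure.
Variable R : rng.

Lemma tpureDl (M : rmod R) (N : lmod R) (x x' : M) (y : N) :
  (x + x') ⊗ y = x ⊗ y + x' ⊗ y.
Proof. exact: balDl (tpure_balanced M N) _ _ _. Qed.
Lemma tpureDr (M : rmod R) (N : lmod R) (x : M) (y y' : N) :
  x ⊗ (y + y') = x ⊗ y + x ⊗ y'.
Proof. exact: balDr (tpure_balanced M N) _ _ _. Qed.
Lemma tpureM (M : rmod R) (N : lmod R) (x : M) (r : R) (y : N) :
  ract x r ⊗ y = x ⊗ lmact r y.
Proof. exact: balM (tpure_balanced M N) _ _ _. Qed.
End TensorPure.

(* M (x)_R N is a right S-module for an R-S-bimodule N, and a T-S-bimodule if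
   moreover M is a T-R-bimodule. *)
Section TensorRightModule.
Variables (R S : rng) (M : rmod R) (N : bimod R S).

Fact tens_ract_balanced (s : S) : balanced (fun (m : M) (n : N) => m ⊗ ract n s : tens M N).
Proof.
split=> [x x' y|x y y'|x r y]; first exact: tpureDl.
- by rewrite ractDl tpureDr.
- by rewrite lactC tpureM.
Qed.
Definition tens_ract (x : tens M N) (s : S) : tens M N :=
  tlift (fun m n => m ⊗ ract n s) x.
Fact tens_ractE m n s : tens_ract (m ⊗ n) s = m ⊗ ract n s.
Proof. exact: tliftE (tens_ract_balanced s). Qed.
Fact tens_ractDl x y s : tens_ract (x + y) s = tens_ract x s + tens_ract y s.
Proof. exact: tliftD (tens_ract_balanced s) _ _. Qed.
Fact tens_ractDr x r s : tens_ract x (r + s) = tens_ract x r + tens_ract x s.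
Proof. by apply: tlift_add => m n; rewrite ractDr tpureDr. Qed.
Fact tens_ractA x r s : tens_ract (tens_ract x r) s = tens_ract x (rmul r s).
Proof.
move: x; apply: tens_ext => [x y|x y|m n]; rewrite ?tens_ractDl //.
by rewrite !tens_ractE ractA.
Qed.
Definition tens_r : rmod S := Rmod tens_ractDl tens_ractDr tens_ractA.
End TensorRightModule.

Section TensorBimodule.
Variables (T R S : rng) (M : bimod T R) (N : bimod R S).

Fact tens_lact_balanced (t : T) : balanced (fun (m : M) (n : N) => lact t m ⊗ n : tens M N).
Proof.
split=> [x x' y|x y y'|x r y]; last by rewrite -lactC tpureM.
- by rewrite lactDr tpureDl.
- exact: tpureDr.
Qed.
Definition tens_lact (t : T) (x : tens M N) : tens M N :=
  tlift (fun m n => lact t m ⊗ n) x.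
Fact tens_lactE t m n : tens_lact t (m ⊗ n) = lact t m ⊗ n.
Proof. exact: tliftE (tens_lact_balanced t). Qed.
Fact tens_lactDr t x y : tens_lact t (x + y) = tens_lact t x + tens_lact t y.
Proof. exact: tliftD (tens_lact_balanced t) _ _. Qed.
Fact tens_lactDl s t x : tens_lact (s + t) x = tens_lact s x + tens_lact t x.
Proof. by apply: tlift_add => m n; rewrite lactDl tpureDl. Qed.
Fact tens_lactA s t x : tens_lact s (tens_lact t x) = tens_lact (rmul s t) x.
Proof.
move: x; apply: tens_ext => [x y|x y|m n]; rewrite ?tens_lactDr //.
by rewrite !tens_lactE lactA.
Qed.
Fact tens_lactC t (x : tens_r M N) s :
  @ract S (tens_r M N) (tens_lact t x) s = tens_lact t (ract x s).
Proof.
move: x; apply: (@tens_ext R M N (tens_r M N)) => [x y|x y|m n] /=.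
- by rewrite tens_lactDr tens_ractDl.
- by rewrite tens_ractDl tens_lactDr.
- by rewrite tens_lactE !tens_ractE tens_lactE.
Qed.
Definition tens_b : bimod T S :=
  @Bimod T S (tens_r M N) tens_lact tens_lactDr tens_lactDl tens_lactA tens_lactC.
End TensorBimodule.

(* f (x) g; meaningful for f right linear and g left linear. *)
Definition tmap (R : rng) (M M' : rmod R) (N N' : lmod R)
    (f : M -> M') (g : N -> N') : tens M N -> tens M' N' :=
  tlift (fun m n => f m ⊗ g n).

Section TensorMap.
Variables (R : rng).

Lemma tmap_balanced (M M' : rmod R) (N N' : lmod R) (f : M -> M') (g : N -> N') :
  rlinear f -> llinear g -> balanced (fun m n => f m ⊗ g n : tens M' N').
Proof.
move=> [fD fZ] [gD gZ]; split=> [x x' y|x y y'|x r y].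
- by rewrite fD tpureDl.
- by rewrite gD tpureDr.
- by rewrite fZ gZ tpureM.
Qed.
Lemma tmapE (M M' : rmod R) (N N' : lmod R) (f : M -> M') (g : N -> N') m n :
  rlinear f -> llinear g -> tmap f g (m ⊗ n) = f m ⊗ g n.
Proof. by move=> fP gP; rewrite /tmap tliftE //; exact: tmap_balanced. Qed.
Lemma tmapD (M M' : rmod R) (N N' : lmod R) (f : M -> M') (g : N -> N') :
  rlinear f -> llinear g -> {morph tmap f g : x y / x + y}.
Proof. by move=> fP gP; apply: tliftD; exact: tmap_balanced. Qed.

Lemma rlinear_id (M : rmod R) : rlinear (@idfun M). Proof. by []. Qed.
Lemma llinear_id (M : lmod R) : llinear (@idfun M). Proof. by []. Qed.
Lemma rlinear_comp (M N P : rmod R) (f : N -> P) (g : M -> N) :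
  rlinear f -> rlinear g -> rlinear (f \o g).
Proof. by move=> [fD fZ] [gD gZ]; split=> [x y|x r] /=; rewrite ?gD ?gZ ?fD ?fZ. Qed.
Lemma llinear_comp (M N P : lmod R) (f : N -> P) (g : M -> N) :
  llinear f -> llinear g -> llinear (f \o g).
Proof. by move=> [fD fZ] [gD gZ]; split=> [x y|x r] /=; rewrite ?gD ?gZ ?fD ?fZ. Qed.

Lemma tmap_comp (M M' M'' : rmod R) (N N' N'' : lmod R)
    (f : M -> M') (f' : M' -> M'') (g : N -> N') (g' : N' -> N'') x :
  rlinear f -> rlinear f' -> llinear g -> llinear g' ->
  tmap f' g' (tmap f g x) = tmap (f' \o f) (g' \o g) x.
Proof.
move=> fP fP' gP gP'; move: x; apply: tens_ext => [x y|x y|m n].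
- by rewrite !tmapD.
- by rewrite tmapD //; [exact: rlinear_comp|exact: llinear_comp].
- by rewrite !tmapE //; [exact: rlinear_comp|exact: llinear_comp].
Qed.
Lemma tmap_id (M : rmod R) (N : lmod R) (x : tens M N) : tmap idfun idfun x = x.
Proof.
move: x; apply: tens_ext => [x y|//|m n]; first by rewrite tmapD.
by rewrite tmapE.
Qed.
Lemma tmapDf (M M' : rmod R) (N N' : lmod R) (f g : rhom M M') (h : N -> N') x :
  tmap (f + g) h x = tmap f h x + tmap g h x.
Proof. by apply: tlift_add => m n; rewrite tpureDl. Qed.
End TensorMap.

Lemma tmap_rlinear (R S : rng) (M M' : rmod R) (N N' : bimod R S)
    (f : M -> M') (g : N -> N') :
  rlinear f -> bilinear g -> @rlinear S (tens_r M N) (tens_r M' N') (tmap f g).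
Proof.
move=> fP [gL gR]; split=> [|x s]; first exact: tmapD.
move: x; apply: (@tens_ext R M N (tens_r M' N')) => [x y|x y|m n].
- by rewrite ractDl tmapD.
- by rewrite tmapD // ractDl.
- by rewrite /= tens_ractE !tmapE // tens_ractE gR.2.
Qed.


Section TensorAssociativity.
Variables (R S T : rng) (M : rmod R) (N : bimod R S) (P : bimod S T).

Definition tassoc (x : tens (tens_r M N) P) : tens M (tens_b N P) :=
  tlift (fun (y : tens_r M N) (p : P) =>
           tlift (fun m n => m ⊗ (n ⊗ p : tens_b N P)) y) x.

Fact tassoc_balanced1 (p : P) :
  balanced (fun (m : M) (n : N) => m ⊗ (n ⊗ p : tens_b N P) : tens M (tens_b N P)).
Proof.
split=> [x x' y|x y y'|x r y]; first exact: tpureDl.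
- by rewrite (tpureDl y y' p) tpureDr.
- by rewrite tpureM /= tens_lactE.
Qed.
Fact tassoc_balanced2 :
  balanced (fun (y : tens_r M N) (p : P) =>
    tlift (fun m n => m ⊗ (n ⊗ p : tens_b N P)) y : tens M (tens_b N P)).
Proof.
split=> [x x' p|x p p'|x s p]; first exact: tliftD (tassoc_balanced1 p) _ _.
- by apply: tlift_add => m n; rewrite (tpureDr n p p') tpureDr.
- move: x; apply: (@tens_ext R M N) => [x y|x y|m n].
  + by rewrite (@ractDl _ (tens_r M N)) (tliftD (tassoc_balanced1 _)).
  + by rewrite (tliftD (tassoc_balanced1 _)).
  + rewrite [ract _ _]tens_ractE !(tliftE _ _ (tassoc_balanced1 _)).
    by congr (_ ⊗ _); exact: tpureM.
Qed.
Lemma tassocD : {morph tassoc : x y / x + y}.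
Proof. exact: tliftD tassoc_balanced2. Qed.
Lemma tassocE m n p : tassoc ((m ⊗ n : tens_r M N) ⊗ p) = m ⊗ (n ⊗ p : tens_b N P).
Proof.
by rewrite /tassoc (tliftE _ _ tassoc_balanced2) (tliftE _ _ (tassoc_balanced1 _)).
Qed.
Lemma tens3_ext (Q : zmodType) (f g : tens (tens_r M N) P -> Q) :
  {morph f : x y / x + y} -> {morph g : x y / x + y} ->
  (forall m n p, f ((m ⊗ n : tens_r M N) ⊗ p) = g ((m ⊗ n : tens_r M N) ⊗ p)) -> f =1 g.
Proof.
move=> fD gD fg; apply: tens_ext => // x p; move: x.
apply: (@tens_ext R M N Q (fun x => f ((x : tens_r M N) ⊗ p))
                        (fun x => g ((x : tens_r M N) ⊗ p))) => [x y|x y|m n].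
- by rewrite (@tpureDl S (tens_r M N) P x y p) fD.
- by rewrite (@tpureDl S (tens_r M N) P x y p) gD.
- exact: fg.
Qed.
Lemma tassoc_rlinear :
  @rlinear T (tens_r (tens_r M N) P) (tens_r M (tens_b N P)) tassoc.
Proof.
split=> [|x t]; first exact: tassocD.
move: x; apply: (@tens3_ext (tens_r M (tens_b N P))) => [x y|x y|m n p].
- by rewrite ractDl tassocD.
- by rewrite tassocD ractDl.
- by rewrite /= tens_ractE tassocE tassocE tens_ractE /= tens_ractE.
Qed.
End TensorAssociativity.

Definition acc_r (R : rng) (M : rmod R) : tens M (reg R) -> M :=
  tlift (fun m r => ract m r).
Definition acc_l (R : rng) (N : lmod R) : tens (reg R) N -> N :=
  tlift (fun r n => lmact r n).
Arguments acc_r {R} M x.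
Arguments acc_l {R} N x.

Definition firm_r (R : rng) (M : rmod R) : Prop := bijective (acc_r M).
Definition firm_l (R : rng) (N : lmod R) : Prop := bijective (acc_l N).

(* The element of M (x)_R R, resp. R (x)_R N, corresponding to an element of a
   firm module. *)
Definition unacc_r (R : rng) (M : rmod R) (m : M) : tens M (reg R) :=
  xget 0 [set x | acc_r M x = m].
Definition unacc_l (R : rng) (N : lmod R) (n : N) : tens (reg R) N :=
  xget 0 [set x | acc_l N x = n].

Arguments unacc_r {R} M m.
Arguments unacc_l {R} N n.

Definition firm_rng_axiom (R : rng) : Prop := firm_r (reg R).

Record firm_rng := FirmRng { fr_rng :> rng; fr_firm : firm_rng_axiom fr_rng }.

Lemma acc_r_balanced (R : rng) (M : rmod R) :
  balanced (fun (m : M) (r : reg R) => ract m r).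
Proof.
split=> [x x' y|x y y'|x r y]; [exact: ractDl|exact: ractDr|exact: ractA].
Qed.
Lemma acc_rE (R : rng) (M : rmod R) (m : M) (r : reg R) :
  acc_r M (m ⊗ r) = ract m r.
Proof. exact: tliftE (acc_r_balanced M). Qed.
Lemma acc_rD (R : rng) (M : rmod R) : {morph acc_r M : x y / x + y}.
Proof. exact: tliftD (acc_r_balanced M). Qed.
Lemma acc_r_rlinear (R : rng) (M : rmod R) :
  @rlinear R (tens_r M (reg R)) M (acc_r M).
Proof.
split=> [|x r]; first exact: acc_rD.
move: x; apply: tens_ext => [x y|x y|m n].
- by rewrite (@ractDl _ (tens_r M (reg R))) acc_rD.
- by rewrite acc_rD ractDl.
- by rewrite /= tens_ractE !acc_rE ractA.
Qed.

Definition exact_at (U V W : zmodType) (f : U -> V) (g : V -> W) : Prop :=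
  forall v, g v = 0 <-> exists u, f u = v.

(* - (x)_R N preserves exactness of the complexes of right R-modules lying in
   the class K. *)
Definition flat_on (R : rng) (K : rmod R -> Prop) (N : lmod R) : Prop :=
  forall (M' M M'' : rmod R) (f : rhom M' M) (g : rhom M M''),
    K M' -> K M -> K M'' -> exact_at f g ->
    exact_at (tmap f (@idfun N)) (tmap g (@idfun N)).

Definition flat_l (R : rng) (N : lmod R) : Prop := flat_on (fun _ => True) N.

Definition unital_flat_l (A : pzRingType) (N : lmod A) : Prop :=
  flat_on (fun M : rmod A => unital_r M) N.

Definition faithfully_flat_l (R : rng) (N : lmod R) : Prop :=
  flat_l N /\
  forall (M M' : rmod R) (f g : rhom M M'), firm_r M -> firm_r M' ->
    tmap f (@idfun N) =1 tmap g (@idfun N) -> f = g.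

Record category := Category {
  obj :> Type;
  hom : obj -> obj -> Type;
  idm : forall X, hom X X;
  comp : forall X Y Z, hom Y Z -> hom X Y -> hom X Z;
  comp1m : forall X Y (f : hom X Y), comp (idm Y) f = f;
  compm1 : forall X Y (f : hom X Y), comp f (idm X) = f;
  compA : forall X Y Z W (f : hom Z W) (g : hom Y Z) (h : hom X Y),
    comp f (comp g h) = comp (comp f g) h }.
Arguments hom {c} X Y : rename.
Arguments idm {c} X : rename.
Arguments comp {c X Y Z} f g : rename.

Record functor (C D : category) := Functor {
  fobj :> C -> D;
  fmap : forall X Y, hom X Y -> hom (fobj X) (fobj Y);
  fmap1 : forall X, fmap (idm X) = idm (fobj X);
  fmapM : forall X Y Z (f : hom Y Z) (g : hom X Y),
    fmap (comp f g) = comp (fmap f) (fmap g) }.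
Arguments fmap {C D} f [X Y] : rename.

Definition id_functor (C : category) : functor C C :=
  @Functor C C id (fun _ _ => id) (fun _ => erefl) (fun _ _ _ _ _ => erefl).

Definition comp_functor (C D E : category) (G : functor D E) (F : functor C D) :
  functor C E.
Proof.
refine (@Functor C E (fun X => G (F X)) (fun _ _ f => fmap G (fmap F f)) _ _).
- by move=> X; rewrite !fmap1.
- by move=> X Y Z f g; rewrite !fmapM.
Defined.

Definition is_iso (C : category) (X Y : C) (f : hom X Y) : Prop :=
  exists g : hom Y X, comp g f = idm X /\ comp f g = idm Y.

Definition nat_iso (C D : category) (F G : functor C D) : Prop :=
  exists a : forall X, hom (F X) (G X),
    (forall X Y (f : hom X Y), comp (a Y) (fmap F f) = comp (fmap G f) (a X)) /\
    (forall X, is_iso (a X)).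

Record adjunction (C D : category) (F : functor C D) (G : functor D C) := Adjunction {
  transpose : forall X Y, hom (F X) Y -> hom X (G Y);
  transpose_bij : forall X Y, bijective (@transpose X Y);
  transpose_natl : forall X X' Y (h : hom X' X) (f : hom (F X) Y),
    transpose (comp f (fmap F h)) = comp (transpose f) h;
  transpose_natr : forall X Y Y' (k : hom Y Y') (f : hom (F X) Y),
    transpose (comp k f) = comp (fmap G k) (transpose f) }.

Definition inverse_equivalences (C D : category) (F : functor C D) (G : functor D C) :=
  nat_iso (comp_functor G F) (id_functor C) /\
  nat_iso (comp_functor F G) (id_functor D).

Definition has_right_adjoint (C D : category) (F : functor C D) : Prop :=
  exists G : functor D C, inhabited (adjunction F G).

Definition epi (C : category) (X Y : C) (f : hom X Y) : Prop :=
  forall Z (g h : hom Y Z), comp g f = comp h f -> g = h.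

Definition projective (C : category) (P : C) : Prop :=
  forall X Y (f : hom X Y) (g : hom P Y), epi f -> exists h : hom P X, comp f h = g.

(* Hom(S, -) is faithful *)
Definition generator (C : category) (S : C) : Prop :=
  forall X Y (f g : hom X Y), (forall h : hom S X, comp f h = comp g h) -> f = g.

Definition rhom_id (R : rng) (M : rmod R) : rhom M M := Rhom (rlinear_id M).
Definition rhom_comp (R : rng) (M N P : rmod R) (f : rhom N P) (g : rhom M N) :
  rhom M P := Rhom (rlinear_comp (rhomP f) (rhomP g)).

Definition rmod_cat (R : rng) : category.
Proof.
refine (@Category (rmod R) (@rhom R) (@rhom_id R) (@rhom_comp R) _ _ _).
- by move=> *; apply: rhom_ext.
- by move=> *; apply: rhom_ext.
- by move=> *; apply: rhom_ext.
Defined.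

Record firm_rmod (R : rng) := FirmRmod { fm_rmod :> rmod R; fm_firm : firm_r fm_rmod }.

Definition firm_cat (R : rng) : category.
Proof.
refine (@Category (firm_rmod R) (@rhom R) (@rhom_id R) (@rhom_comp R) _ _ _).
- by move=> *; apply: rhom_ext.
- by move=> *; apply: rhom_ext.
- by move=> *; apply: rhom_ext.
Defined.

Definition firm_incl (R : rng) : functor (firm_cat R) (rmod_cat R) :=
  @Functor (firm_cat R) (rmod_cat R) (@fm_rmod R) (fun _ _ => id)
    (fun _ => erefl) (fun _ _ _ _ _ => erefl).

Definition reg_firm (R : firm_rng) : firm_rmod R := FirmRmod (@fr_firm R).

Record coring_data (A : pzRingType) := CoringData {
  cd_bimod :> bimod A A;
  cdelta : cd_bimod -> tens_b cd_bimod cd_bimod;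
  ceps : cd_bimod -> rng_of_ring A }.
Arguments cdelta {A c} x : rename.
Arguments ceps {A c} x : rename.

Record coring_axioms (A : pzRingType) (C : coring_data A) : Prop := CoringAxioms {
  coring_unital_r : unital_r C;
  coring_unital_l : unital_l C;
  cdelta_bilinear : @bilinear A A C (tens_b C C) cdelta;
  ceps_bilinear : @bilinear A A C (reg A) ceps;
  cdelta_coassoc : forall c : C,
    tassoc (tmap cdelta idfun (cdelta c))
    = tmap idfun cdelta (cdelta c);
  cdelta_counitl : forall c : C, tlift (fun c1 c2 : C => lact (ceps c1) c2) (cdelta c) = c;
  cdelta_counitr : forall c : C, tlift (fun c1 c2 : C => ract c1 (ceps c2)) (cdelta c) = c }.

Record coring (A : pzRingType) :=
  Coring { coring_dat :> coring_data A; coringP : coring_axioms coring_dat }.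

Record coring_iso (A : pzRingType) (C D : coring_data A) (f : C -> D) : Prop :=
  CoringIso {
    coring_iso_bij : bijective f;
    coring_iso_bilinear : @bilinear A A C D f;
    coring_iso_delta : forall c, cdelta (f c) = tmap f f (cdelta c);
    coring_iso_eps : forall c, ceps (f c) = ceps c }.

Definition coring_isomorphic (A : pzRingType) (C D : coring_data A) : Prop :=
  exists f : C -> D, coring_iso f.

Record comodule (A : pzRingType) (C : coring A) := Comodule {
  cm_rmod :> rmod A;
  cm_unital : unital_r cm_rmod;
  coact : cm_rmod -> tens_r cm_rmod C;
  coact_rlinear : @rlinear A cm_rmod (tens_r cm_rmod C) coact;
  coact_coassoc : forall m,
    tassoc (tmap coact idfun (coact m))
    = tmap idfun cdelta (coact m);
  coact_counit : forall m, tlift (fun (m0 : cm_rmod) (c : C) => ract m0 (ceps c)) (coact m) = m }.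
Arguments coact {A C c} m : rename.
Arguments cm_unital {A C} c x : rename.
Arguments coact_rlinear {A C} c : rename.
Arguments coact_coassoc {A C c} m : rename.
Arguments coact_counit {A C c} m : rename.

Definition colinear (A : pzRingType) (C : coring A) (M N : comodule C) (f : M -> N) :=
  forall m, coact (f m) = tmap f idfun (coact m).

Record chom (A : pzRingType) (C : coring A) (M N : comodule C) :=
  Chom { chom_rhom :> rhom M N; chom_colinear : colinear chom_rhom }.

Section Comodules.
Variables (A : pzRingType) (C : coring A).
Implicit Types M N P : comodule C.

Lemma chom_ext M N (f g : chom M N) : f =1 g -> f = g.
Proof.
case: f g => f fP [g gP] /= fg; have E : f = g by exact: rhom_ext.
by case: _ / E gP => gP; congr Chom; exact: Prop_irrelevance.
Qed.

Fact chom_id_subproof M : colinear (rhom_id M).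
Proof. by move=> m; rewrite [RHS](tmap_id (coact m)). Qed.
Definition chom_id M := Chom (@chom_id_subproof M).

Fact chom_comp_subproof M N P (f : chom N P) (g : chom M N) :
  colinear (rhom_comp f g).
Proof.
move=> m /=; rewrite !chom_colinear tmap_comp //; exact: rhomP.
Qed.
Definition chom_comp M N P (f : chom N P) (g : chom M N) : chom M P :=
  Chom (@chom_comp_subproof _ _ _ f g).

Definition comod_cat : category.
Proof.
refine (@Category (comodule C) (@chom A C) chom_id chom_comp _ _ _).
- by move=> *; apply: chom_ext.
- by move=> *; apply: chom_ext.
- by move=> *; apply: chom_ext.
Defined.

Section ChomZmod.
Variables M N : comodule C.
HB.instance Definition _ := gen_eqMixin (chom M N).
HB.instance Definition _ := gen_choiceMixin (chom M N).

Fact chom_zero_subproof : colinear (0 : rhom M N).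
Proof.
move=> m /=; rewrite morphD0; last exact: (coact_rlinear N).1.
symmetry; move: (coact m); apply: tens_ext => [x y|x y|x c].
- by rewrite tmapD //; exact: (rhomP (0 : rhom M N)).
- by rewrite addr0.
- rewrite tmapE //; last exact: (rhomP (0 : rhom M N)).
  by apply: (@morphD0 M _ (fun _ => 0 ⊗ c)) => _ _; rewrite -tpureDl addr0.
Qed.
Fact chom_opp_subproof (f : chom M N) : colinear (- (f : rhom M N)).
Proof.
move=> m; apply: (addrI (coact (f m))); rewrite -(coact_rlinear N).1 subrr.
rewrite morphD0; last exact: (coact_rlinear N).1.
rewrite (chom_colinear f) -[RHS](tmapDf f (- (f : rhom M N)) idfun) subrr.
by rewrite -(chom_zero_subproof m) /= morphD0 //; exact: (coact_rlinear N).1.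
Qed.
Fact chom_add_subproof (f g : chom M N) : colinear ((f : rhom M N) + g).
Proof.
by move=> m; rewrite /= (coact_rlinear N).1 !chom_colinear -tmapDf.
Qed.
Definition chom_zero := Chom chom_zero_subproof.
Definition chom_opp f := Chom (chom_opp_subproof f).
Definition chom_add f g := Chom (chom_add_subproof f g).

Fact chom_addA : associative chom_add.
Proof. by move=> f g h; apply: chom_ext => x /=; rewrite addrA. Qed.
Fact chom_addC : commutative chom_add.
Proof. by move=> f g; apply: chom_ext => x /=; rewrite addrC. Qed.
Fact chom_add0 : left_id chom_zero chom_add.
Proof. by move=> f; apply: chom_ext => x /=; rewrite add0r. Qed.
Fact chom_addN : left_inverse chom_zero chom_opp chom_add.
Proof. by move=> f; apply: chom_ext => x /=; rewrite addNr. Qed.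
HB.instance Definition _ :=
  GRing.isZmodule.Build (chom M N) chom_addA chom_addC chom_add0 chom_addN.
End ChomZmod.

(* A right C-comodule with a left action of R by C-colinear maps, that is, an
   R-A-bimodule with a left R-linear coaction.  It is an object of
   _R M^C when it is moreover firm as a left R-module. *)
Record bicomodule (R : rng) := Bicomodule {
  bc_comod :> comodule C;
  bc_act : R -> chom bc_comod bc_comod;
  bc_actD : forall r s u, bc_act (r + s) u = bc_act r u + bc_act s u;
  bc_actM : forall r s u, bc_act r (bc_act s u) = bc_act (rmul r s) u }.

Section BicomoduleBimod.
Variables (R : rng) (X : bicomodule R).
Fact bc_actDr (r : R) (x y : X) : bc_act X r (x + y) = bc_act X r x + bc_act X r y.
Proof. exact: (rhomP (bc_act X r)).1. Qed.
Fact bc_actC (r : R) (x : X) (a : A) : @ract A X (bc_act X r x) a = bc_act X r (ract x a).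
Proof. by rewrite (rhomP (bc_act X r)).2. Qed.
Definition bc_bimod : bimod R A :=
  @Bimod R A X (fun r => bc_act X r) bc_actDr (@bc_actD _ X) (@bc_actM _ X) bc_actC.
End BicomoduleBimod.
Coercion bc_bimod : bicomodule >-> bimod.
Canonical bc_bimod.

(* Hom^C(X, N) as a right R-module: (f r)(u) = f(r u). *)
Section ChomRmod.
Variables (R : rng) (X : bicomodule R) (N : comodule C).
Definition chom_ract (f : chom X N) (r : R) : chom X N := chom_comp f (bc_act X r).
Fact chom_ractDl f g r : chom_ract (f + g) r = chom_ract f r + chom_ract g r.
Proof. by apply: chom_ext. Qed.
Fact chom_ractDr f r s : chom_ract f (r + s) = chom_ract f r + chom_ract f s.
Proof. by apply: chom_ext => x /=; rewrite bc_actD (rhomP f).1. Qed.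
Fact chom_ractA f r s : chom_ract (chom_ract f r) s = chom_ract f (rmul r s).
Proof. by apply: chom_ext => x /=; rewrite bc_actM. Qed.
Definition chom_rmod : rmod R := Rmod chom_ractDl chom_ractDr chom_ractA.
End ChomRmod.
End Comodules.
Arguments bc_act {A C R b} r : rename.

Section TensorFunctor.
Variables (A : pzRingType) (C : coring A) (R : rng) (X : bicomodule C R).

Lemma bicomod_coactE (r : R) (u : X) :
  coact (lact r u : X) = tmap (lact r : X -> X) idfun (coact u).
Proof. exact: (chom_colinear (bc_act r)). Qed.

Section Objects.
Variable M : rmod R.
Let MX : rmod A := tens_r M X.

Definition tens_coact_pure (m : M) : tens_r X C -> tens_r MX C :=
  tmap (fun u : X => m ⊗ u : MX) idfun.
Definition tens_coact : MX -> tens_r MX C :=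
  tlift (fun (m : M) (u : X) => tens_coact_pure m (coact u)).

Fact tens_unital : unital_r MX.
Proof.
apply: (@tens_ext R M X MX) => [x y|//|m u]; first exact: ractDl.
by rewrite /= tens_ractE (cm_unital X).
Qed.

Fact tpure_rlinear (m : M) : @rlinear A X MX (fun u : X => m ⊗ u : MX).
Proof.
by split=> [u v|u a]; [exact: tpureDr|rewrite /= tens_ractE].
Qed.
Let pureP := tpure_rlinear.
Let coactP : @rlinear A X (tens_r X C) coact := coact_rlinear X.

Fact tens_coact_balanced :
  balanced (fun (m : M) (u : X) => tens_coact_pure m (coact u)).
Proof.
split=> [m m' u|m u u'|m r u].
- by apply: tlift_add => v c; rewrite tpureDl [LHS]tpureDl.
- by rewrite /tens_coact_pure coactP.1 tmapD.
- rewrite [in RHS](bicomod_coactE r u) /tens_coact_pure.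
  rewrite tmap_comp //; last exact: (rhomP (bc_act r)).
  by apply: tlift_eq => v c /=; rewrite tpureM.
Qed.
Fact tens_coactD : {morph tens_coact : x y / x + y}.
Proof. exact: tliftD tens_coact_balanced. Qed.
Fact tens_coactE m u : tens_coact (m ⊗ u) = tens_coact_pure m (coact u).
Proof. exact: tliftE tens_coact_balanced. Qed.

Fact tens_coact_rlinear : rlinear tens_coact.
Proof.
split=> [|x a]; first exact: tens_coactD.
move: x; apply: (@tens_ext R M X (tens_r MX C)) => [x y|x y|m u].
- by rewrite (@ractDl _ MX) tens_coactD.
- by rewrite tens_coactD ractDl.
- have -> : @ract A MX (m ⊗ u) a = m ⊗ ract u a by exact: tens_ractE.
  rewrite !tens_coactE coactP.2.
  have [_ ->] // : rlinear (tens_coact_pure m).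
  by apply: tmap_rlinear => //; exact: pureP.
Qed.

Fact tens_coact_coassoc (x : MX) :
  tassoc (tmap tens_coact idfun (tens_coact x)) = tmap idfun cdelta (tens_coact x).
Proof.
have dP : llinear (@cdelta A C) by exact: (cdelta_bilinear (coringP C)).1.
have pP m : rlinear (tens_coact_pure m).
  by apply: tmap_rlinear => //; exact: pureP.
move: x; apply: (@tens_ext R M X (tens MX (tens_b C C))) => [x y|x y|m u].
- rewrite tens_coactD tmapD //; last exact: tens_coact_rlinear.
  by rewrite tassocD.
- by rewrite tens_coactD tmapD.
rewrite tens_coactE /tens_coact_pure !tmap_comp //; last exact: tens_coact_rlinear.
have -> : tmap (tens_coact \o (fun v : X => m ⊗ v : MX)) (idfun \o idfun) (coact u)
        = tmap (tens_coact_pure m \o coact) (idfun : C -> C) (coact u).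
  by apply: tlift_eq => v c /=; rewrite tens_coactE.
have -> : tmap (tens_coact_pure m \o coact) (idfun : C -> C) (coact u)
  = tmap (tens_coact_pure m) (idfun : C -> C) (tmap coact (idfun : C -> C) (coact u)).
  by rewrite tmap_comp.
have -> : tmap (idfun \o (fun v : X => m ⊗ v : MX)) (cdelta \o idfun) (coact u)
  = tmap (fun v : X => m ⊗ v : MX) (idfun : tens_b C C -> tens_b C C)
      (tmap (idfun : X -> X) cdelta (coact u)).
  by rewrite tmap_comp.
rewrite -coact_coassoc; move: (tmap coact _ (coact u)) => {u}.
apply: tens3_ext => [x y|x y|v c d].
- by rewrite tmapD // tassocD.
- by rewrite tassocD tmapD.
rewrite tmapE // {1}/tens_coact_pure tmapE // !tassocE tmapE //.
Qed.

Fact tens_coact_counit (x : MX) :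
  tlift (fun (y : MX) (c : C) => ract y (ceps c)) (tens_coact x) = x.
Proof.
have eP := ceps_bilinear (coringP C).
have bal (Y : rmod A) : balanced (fun (y : Y) (c : C) => ract y (ceps c)).
  split=> [y y' c|y c c'|y a c]; first exact: ractDl.
  - by rewrite eP.1.1 ractDr.
  - by rewrite eP.1.2 ractA.
move: x; apply: (@tens_ext R M X MX) => [x y|//|m u].
  by rewrite tens_coactD (tliftD (bal MX)).
rewrite tens_coactE -[in RHS](coact_counit u); move: (coact u).
apply: tens_ext => [x y|x y|v c].
- by rewrite [tens_coact_pure m _]tmapD // (tliftD (bal MX)).
- by rewrite (tliftD (bal X)) tpureDr.
- rewrite [tens_coact_pure m _]tmapE // (tliftE _ _ (bal MX)) (tliftE _ _ (bal X)).
  exact: tens_ractE.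
Qed.

Definition tens_comod : comodule C :=
  Comodule tens_unital tens_coact_rlinear tens_coact_coassoc tens_coact_counit.
End Objects.

Section Morphisms.
Variables (M N : rmod R) (f : rhom M N).
Fact tens_map_rlinear : @rlinear A (tens_r M X) (tens_r N X) (tmap f idfun).
Proof. by apply: tmap_rlinear => //; exact: rhomP. Qed.
Fact tens_map_colinear : @colinear A C (tens_comod M) (tens_comod N) (Rhom tens_map_rlinear).
Proof.
have mP := tens_map_rlinear; have fP := rhomP f.
apply: (@tens_ext R M X) => [x y|x y|m u].
- by rewrite (rhomP _).1 (coact_rlinear (tens_comod N)).1.
- by rewrite (coact_rlinear (tens_comod M)).1 tmapD.
rewrite /= tmapE // !tens_coactE /tens_coact_pure.
rewrite tmap_comp //; last exact: tpure_rlinear.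
by apply: tlift_eq => v c /=; rewrite tmapE.
Qed.
Definition tens_chom : chom (tens_comod M) (tens_comod N) := Chom tens_map_colinear.
End Morphisms.

Definition tens_functor : functor (firm_cat R) (comod_cat C).
Proof.
refine (@Functor (firm_cat R) (comod_cat C) (fun M : firm_rmod R => tens_comod M)
  (fun M N f => tens_chom f) _ _).
- by move=> M; apply: chom_ext => x /=; exact: tmap_id.
- move=> M N P f g; apply: chom_ext => x /=.
  by rewrite tmap_comp //; exact: rhomP.
Defined.
End TensorFunctor.

Section HomFunctor.
Variables (A : pzRingType) (C : coring A) (R : firm_rng) (X : bicomodule C R).

Fact tens_reg_firm (M : rmod R) : firm_r (tens_r M (reg R)).
Proof.
have [g gK Kg] := fr_firm R.
have inj := can_inj gK.
have accD := @acc_rD R (reg R).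
have mulP (t : R) : @rlinear R (reg R) (reg R) (rmul t).
  by split=> [x y|x r]; [exact: rmulDr|rewrite /= rmulA].
have pureP (m : M) : @rlinear R (reg R) (tens_r M (reg R)) (fun r : reg R => m ⊗ r).
  by split=> [x y|x r]; [exact: tpureDr|rewrite /= tens_ractE].
have gD : {morph g : x y / x + y} by move=> x y; apply: inj; rewrite accD !Kg.
have gM (t r : R) : g (rmul t r) = tmap (rmul t : reg R -> reg R) idfun (g r).
  apply: inj; rewrite Kg -{1}[r]Kg; move: (g r).
  apply: tens_ext => [x y|x y|x y].
  - by rewrite accD rmulDr.
  - by rewrite tmapD // accD.
  - by rewrite tmapE // !acc_rE /= rmulA.
pose h0 (m : M) : reg R -> tens (tens_r M (reg R)) (reg R) :=
  fun r => tmap (fun s : reg R => m ⊗ s : tens_r M (reg R)) idfun (g r).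
have h0P : balanced (fun (m : M) (r : reg R) => h0 m r).
  split=> [m m' r|m r r'|m t r].
  - by apply: tlift_add => s t; rewrite tpureDl [LHS]tpureDl.
  - by rewrite /h0 gD tmapD.
  - rewrite /h0 [lmact t r]/(rmul t r) gM tmap_comp //.
    by apply: tlift_eq => s t' /=; rewrite tpureM.
exists (tlift h0).
- apply: tens3_ext => [x y|//|m s t].
  + by rewrite (@acc_rD _ (tens_r M (reg R))) (tliftD h0P).
  rewrite acc_rE /= tens_ractE (tliftE _ _ h0P) /h0.
  by rewrite -(acc_rE s t) gK tmapE.
- apply: tens_ext => [x y|//|m r].
  + by rewrite (tliftD h0P) (@acc_rD _ (tens_r M (reg R))).
  rewrite (tliftE _ _ h0P) /h0 -[in RHS](Kg r); move: (g r).
  apply: tens_ext => [x y|x y|s t].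
  + by rewrite tmapD // (@acc_rD _ (tens_r M (reg R))).
  + by rewrite accD tpureDr.
  + by rewrite tmapE // !acc_rE /= tens_ractE.
Qed.

Definition hom_firm (N : comodule C) : firm_rmod R :=
  FirmRmod (tens_reg_firm (chom_rmod X N)).

Section Morphisms.
Variables (N P : comodule C) (f : chom N P).
Fact hom_map_rlinear0 :
  @rlinear R (chom_rmod X N) (chom_rmod X P) (fun g : chom X N => chom_comp f g).
Proof.
split=> [g h|g r]; apply: chom_ext => u //=; exact: (rhomP f).1.
Qed.
Fact hom_map_rlinear :
  @rlinear R (hom_firm N) (hom_firm P)
    (tmap (fun g : chom_rmod X N => chom_comp f g : chom_rmod X P) idfun).
Proof. by apply: tmap_rlinear => //; exact: hom_map_rlinear0. Qed.
End Morphisms.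

Definition hom_functor : functor (comod_cat C) (firm_cat R).
Proof.
refine (@Functor (comod_cat C) (firm_cat R) hom_firm
  (fun N P f => Rhom (hom_map_rlinear f)) _ _).
- move=> N; apply: rhom_ext => x /=; rewrite -[RHS]tmap_id.
  by apply: tlift_eq => g r; congr (_ ⊗ _); apply: chom_ext.
- move=> N P Q f g; apply: rhom_ext => x /=.
  rewrite tmap_comp //; try exact: hom_map_rlinear0.
  by apply: tlift_eq => h r; congr (_ ⊗ _); apply: chom_ext.
Defined.
End HomFunctor.

Section DualRings.
Variables (A : pzRingType) (C : coring A).
Let CP := coringP C.
Let dL := (cdelta_bilinear CP).1.
Let dR := (cdelta_bilinear CP).2.
Let eL := (ceps_bilinear CP).1.
Let eR := (ceps_bilinear CP).2.

Definition ldual : Type := lhom C (reg A).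
Definition rdual : Type := rhom C (reg A).
HB.instance Definition _ := GRing.Zmodule.on ldual.
HB.instance Definition _ := GRing.Zmodule.on rdual.

Definition ldual_hit (f : lhom C (reg A)) (c : C) : C :=
  tlift (fun c1 c2 : C => ract c1 (f c2)) (cdelta c).
Definition rdual_hit (f : rhom C (reg A)) (c : C) : C :=
  tlift (fun c1 c2 : C => lact (f c1) c2) (cdelta c).

Fact ldual_bal (f : lhom C (reg A)) (M : rmod A) :
  balanced (fun (c1 : M) (c2 : C) => ract c1 (f c2)).
Proof.
case: (lhomP f) => fD fZ; split=> [x x' y|x y y'|x a y]; first exact: ractDl.
- by rewrite fD ractDr.
- by rewrite fZ ractA.
Qed.
Fact rdual_bal (f : rhom C (reg A)) (N : lmod A) :
  balanced (fun (c1 : C) (c2 : N) => lmact (f c1) c2).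
Proof.
case: (rhomP f) => fD fZ; split=> [x x' y|x y y'|x a y].
- by rewrite fD lmactDl.
- exact: lmactDr.
- by rewrite fZ lmactA.
Qed.

Fact ldual_hit_llinear f : @llinear A C C (ldual_hit f).
Proof.
split=> [x y|a x]; first by rewrite /ldual_hit dL.1 (tliftD (ldual_bal f C)).
rewrite /ldual_hit dL.2; move: (cdelta x).
apply: (@tens_ext A C C C) => [y z|y z|c d].
- by rewrite lmactDr (tliftD (ldual_bal f C)).
- by rewrite (tliftD (ldual_bal f C)) lmactDr.
- by rewrite /= tens_lactE !(tliftE _ _ (ldual_bal f C)) lactC.
Qed.
Fact rdual_hit_rlinear f : @rlinear A C C (rdual_hit f).
Proof.
split=> [x y|x a]; first by rewrite /rdual_hit dR.1 (tliftD (rdual_bal f C)).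
rewrite /rdual_hit dR.2; move: (cdelta x).
apply: (@tens_ext A C C C) => [y z|y z|c d].
- by rewrite ractDl (tliftD (rdual_bal f C)).
- by rewrite (tliftD (rdual_bal f C)) ractDl.
- by rewrite /= tens_ractE !(tliftE _ _ (rdual_bal f C)) lactC.
Qed.

(* (f * g)(c) = g(c_1 f(c_2)) on *C, (f * g)(c) = f(g(c_1) c_2) on C^*. *)
Definition ldual_mul (f g : ldual) : ldual :=
  Lhom (llinear_comp (lhomP g) (ldual_hit_llinear f)).
Definition rdual_mul (f g : rdual) : rdual :=
  Rhom (rlinear_comp (rhomP f) (rdual_hit_rlinear g)).
Definition ldual_one : ldual := Lhom eL.
Definition rdual_one : rdual := Rhom eR.

Lemma ldual_hitM (f g : ldual) c :
  ldual_hit (ldual_mul f g) c = ldual_hit g (ldual_hit f c).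
Proof.
pose T (x : tens (tens_r C C) C) : tens C C :=
  tlift (fun (y : tens_r C C) (d : C) => ract y (f d)) x.
have TD : {morph T : x y / x + y} := tliftD (ldual_bal f (tens_r C C)).
have -> : ldual_hit g (ldual_hit f c)
    = tlift (fun c1 c2 : C => ract c1 (g c2)) (T (tmap cdelta idfun (cdelta c))).
  rewrite /ldual_hit; congr tlift; move: (cdelta c).
  apply: (@tens_ext A C C (tens_b C C)) => [x y|x y|x y].
  - by rewrite (tliftD (ldual_bal f C)) dL.1.
  - by rewrite tmapD // TD.
  - by rewrite (tliftE _ _ (ldual_bal f C)) dR.2 tmapE // /T
               (tliftE _ _ (ldual_bal f (tens_r C C))).
pose U (x : tens C (tens_b C C)) : C :=
  tlift (fun (d : C) (y : tens_b C C) =>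
    ract d (g (tlift (fun c1 c2 : C => ract c1 (f c2)) y))) x.
have UB : balanced (fun (d : C) (y : tens_b C C) =>
    ract d (g (tlift (fun c1 c2 : C => ract c1 (f c2)) y))).
  case: (lhomP g) => gD gZ.
  split=> [x x' y|x y y'|x a y]; first exact: ractDl.
  - by rewrite (tliftD (ldual_bal f C)) gD ractDr.
  - rewrite ractA; congr ract; rewrite -[LHS](gZ a); congr (g _).
    move: y; apply: (@tens_ext A C C C) => [y z|y z|y z].
    + by rewrite (tliftD (ldual_bal f C)) lmactDr.
    + by rewrite lmactDr (tliftD (ldual_bal f C)).
    + by rewrite /= tens_lactE !(tliftE _ _ (ldual_bal f C)) lactC.
have UD : {morph U : x y / x + y} := tliftD UB.
transitivity (U (tmap idfun cdelta (cdelta c))).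
  rewrite {1}/ldual_hit; move: (cdelta c).
  apply: (@tens_ext A C C C) => [x y|x y|x y].
  - by rewrite (tliftD (ldual_bal (ldual_mul f g) C)).
  - by rewrite tmapD // UD.
  - by rewrite tmapE // /U (tliftE _ _ UB) (tliftE _ _ (ldual_bal (ldual_mul f g) C)).
rewrite -(cdelta_coassoc CP); move: (tmap _ _ (cdelta c)) => {c}.
apply: tens3_ext => [x y|x y|x y z].
- by rewrite tassocD UD.
- by rewrite TD (tliftD (ldual_bal g C)).
rewrite tassocE /U (tliftE _ _ UB) (tliftE _ _ (ldual_bal f C)).
by rewrite /T (tliftE _ _ (ldual_bal f (tens_r C C))) /= tens_ractE
           (tliftE _ _ (ldual_bal g C)).
Qed.

Lemma rdual_hitM (f g : rdual) c :
  rdual_hit (rdual_mul f g) c = rdual_hit f (rdual_hit g c).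
Proof.
pose T (x : tens C (tens_b C C)) : tens C C :=
  tlift (fun (d : C) (y : tens_b C C) => lmact (g d) y) x.
have TD : {morph T : x y / x + y} := tliftD (rdual_bal g (tens_b C C)).
have -> : rdual_hit f (rdual_hit g c)
    = tlift (fun c1 c2 : C => lact (f c1) c2) (T (tmap idfun cdelta (cdelta c))).
  rewrite /rdual_hit; congr tlift; move: (cdelta c).
  apply: (@tens_ext A C C (tens_b C C)) => [x y|x y|x y].
  - by rewrite (tliftD (rdual_bal g C)) dR.1.
  - by rewrite tmapD // TD.
  - by rewrite (tliftE _ _ (rdual_bal g C)) dL.2 tmapE // /T
               (tliftE _ _ (rdual_bal g (tens_b C C))).
pose U (x : tens (tens_r C C) C) : C :=
  tlift (fun (y : tens_r C C) (d : C) =>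
    lact (f (tlift (fun c1 c2 : C => lact (g c1) c2) y)) d) x.
have UB : balanced (fun (y : tens_r C C) (d : C) =>
    lact (f (tlift (fun c1 c2 : C => lact (g c1) c2) y)) d).
  case: (rhomP f) => fD fZ.
  split=> [x x' y|x y y'|x a y]; [|exact: lactDr|].
  - by rewrite (tliftD (rdual_bal g C)) fD lactDl.
  - rewrite [RHS]lactA; congr lact; rewrite -[RHS](fZ _ a); congr (f _).
    move: x; apply: (@tens_ext A C C C) => [x z|x z|x z].
    + by rewrite ractDl (tliftD (rdual_bal g C)).
    + by rewrite (tliftD (rdual_bal g C)) ractDl.
    + by rewrite /= tens_ractE !(tliftE _ _ (rdual_bal g C)) [RHS]lactC.
have UD : {morph U : x y / x + y} := tliftD UB.
transitivity (U (tmap cdelta idfun (cdelta c))).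
  rewrite {1}/rdual_hit; move: (cdelta c).
  apply: (@tens_ext A C C C) => [x y|x y|x y].
  - by rewrite (tliftD (rdual_bal (rdual_mul f g) C)).
  - by rewrite tmapD // UD.
  - by rewrite tmapE // /U (tliftE _ _ UB) (tliftE _ _ (rdual_bal (rdual_mul f g) C)).
rewrite -(cdelta_coassoc CP); move: (tmap cdelta idfun (cdelta c)) => {c}.
apply: tens3_ext => [x y|x y|x y z].
- by rewrite UD.
- by rewrite tassocD TD (tliftD (rdual_bal f C)).
rewrite tassocE /U (tliftE _ _ UB) (tliftE _ _ (rdual_bal g C)).
by rewrite /T (tliftE _ _ (rdual_bal g (tens_b C C))) /= tens_lactE
           (tliftE _ _ (rdual_bal f C)).
Qed.

Fact ldual_mulA : associative ldual_mul.
Proof. by move=> f g h; apply: lhom_ext => c /=; rewrite ldual_hitM. Qed.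
Fact ldual_mul1l : left_id ldual_one ldual_mul.
Proof. by move=> f; apply: lhom_ext => c /=; rewrite /ldual_hit (cdelta_counitr CP). Qed.
Fact ldual_mul1r : right_id ldual_one ldual_mul.
Proof.
move=> f; apply: lhom_ext => c /=; rewrite -[in RHS](cdelta_counitl CP c) /ldual_hit.
move: (cdelta c); apply: (@tens_ext A C C (reg A)) => [x y|x y|x y].
- by rewrite (tliftD (ldual_bal f C)) eL.1.
- by rewrite (tliftD (rdual_bal rdual_one C)) (lhomP f).1.
- rewrite (tliftE _ _ (ldual_bal f C)) (tliftE _ _ (rdual_bal rdual_one C)).
  by rewrite (lhomP f).2 eR.2.
Qed.
Fact ldual_mulDl : left_distributive ldual_mul +%R.
Proof.
move=> f g h; apply: lhom_ext => c /=; rewrite -(lhomP h).1; congr (h _).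
by apply: tlift_add => x y; rewrite ractDr.
Qed.
Fact ldual_mulDr : right_distributive ldual_mul +%R.
Proof. by move=> f g h; apply: lhom_ext. Qed.
HB.instance Definition _ := GRing.Zmodule_isPzRing.Build ldual
  ldual_mulA ldual_mul1l ldual_mul1r ldual_mulDl ldual_mulDr.

Fact rdual_mulA : associative rdual_mul.
Proof. by move=> f g h; apply: rhom_ext => c /=; rewrite rdual_hitM. Qed.
Fact rdual_mul1r : right_id rdual_one rdual_mul.
Proof. by move=> f; apply: rhom_ext => c /=; rewrite /rdual_hit (cdelta_counitl CP). Qed.
Fact rdual_mul1l : left_id rdual_one rdual_mul.
Proof.
move=> f; apply: rhom_ext => c /=; rewrite -[in RHS](cdelta_counitr CP c) /rdual_hit.
move: (cdelta c); apply: (@tens_ext A C C (reg A)) => [x y|x y|x y].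
- by rewrite (tliftD (rdual_bal f C)) eR.1.
- by rewrite (tliftD (ldual_bal ldual_one C)) (rhomP f).1.
- rewrite (tliftE _ _ (rdual_bal f C)) (tliftE _ _ (ldual_bal ldual_one C)).
  by rewrite (rhomP f).2 eL.2.
Qed.
Fact rdual_mulDl : left_distributive rdual_mul +%R.
Proof. by move=> f g h; apply: rhom_ext. Qed.
Fact rdual_mulDr : right_distributive rdual_mul +%R.
Proof.
move=> f g h; apply: rhom_ext => c /=; rewrite -(rhomP f).1; congr (f _).
by apply: tlift_add => x y; rewrite lactDl.
Qed.
HB.instance Definition _ := GRing.Zmodule_isPzRing.Build rdual
  rdual_mulA rdual_mul1l rdual_mul1r rdual_mulDl rdual_mulDr.
End DualRings.

(* Left linear endomorphisms are written on the right. *)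
Section LeftEndomorphisms.
Variables (R : rng) (N : lmod R).
Definition lend : Type := lhom N N.
HB.instance Definition _ := GRing.Zmodule.on lend.
Definition lend_one : lend := Lhom (llinear_id N).
Definition lend_mul (f g : lend) : lend := Lhom (llinear_comp (lhomP g) (lhomP f)).
Fact lend_mulA : associative lend_mul.
Proof. by move=> f g h; apply: lhom_ext. Qed.
Fact lend_mul1l : left_id lend_one lend_mul.
Proof. by move=> f; apply: lhom_ext. Qed.
Fact lend_mul1r : right_id lend_one lend_mul.
Proof. by move=> f; apply: lhom_ext. Qed.
Fact lend_mulDl : left_distributive lend_mul +%R.
Proof. by move=> f g h; apply: lhom_ext => x /=; rewrite (lhomP h).1. Qed.
Fact lend_mulDr : right_distributive lend_mul +%R.
Proof. by move=> f g h; apply: lhom_ext. Qed.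
HB.instance Definition _ := GRing.Zmodule_isPzRing.Build lend
  lend_mulA lend_mul1l lend_mul1r lend_mulDl lend_mulDr.
End LeftEndomorphisms.

Section RightEndomorphisms.
Variables (R : rng) (M : rmod R).
Definition rend : Type := rhom M M.
HB.instance Definition _ := GRing.Zmodule.on rend.
Definition rend_one : rend := rhom_id M.
Definition rend_mul (f g : rend) : rend := rhom_comp f g.
Fact rend_mulA : associative rend_mul.
Proof. by move=> f g h; apply: rhom_ext. Qed.
Fact rend_mul1l : left_id rend_one rend_mul.
Proof. by move=> f; apply: rhom_ext. Qed.
Fact rend_mul1r : right_id rend_one rend_mul.
Proof. by move=> f; apply: rhom_ext. Qed.
Fact rend_mulDl : left_distributive rend_mul +%R.
Proof. by move=> f g h; apply: rhom_ext. Qed.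
Fact rend_mulDr : right_distributive rend_mul +%R.
Proof. by move=> f g h; apply: rhom_ext => x /=; rewrite (rhomP f).1. Qed.
HB.instance Definition _ := GRing.Zmodule_isPzRing.Build rend
  rend_mulA rend_mul1l rend_mul1r rend_mulDl rend_mulDr.
End RightEndomorphisms.

Definition ldual_ring (A : pzRingType) (C : coring A) : pzRingType := ldual C.
Definition rdual_ring (A : pzRingType) (C : coring A) : pzRingType := rdual C.
Definition lend_ring (R : rng) (N : lmod R) : pzRingType := lend N.
Definition rend_ring (R : rng) (M : rmod R) : pzRingType := rend M.

Definition ring_isomorphic (S T : pzRingType) : Prop :=
  exists f : {rmorphism S -> T}, bijective f.

Record rng_hom (R S : rng) := RngHom {
  rng_hom_fun :> R -> S;
  rng_homD : {morph rng_hom_fun : x y / x + y};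
  rng_homM : forall x y, rng_hom_fun (rmul x y) = rmul (rng_hom_fun x) (rng_hom_fun y) }.

(* X^* = Hom_A(X, A) *)
Definition dual (R : rng) (A : pzRingType) (X : bimod R A) : bimod A R :=
  rhom_bimod X (reg A).

Definition ev (R : rng) (A : pzRingType) (X : bimod R A) (phi : dual X) (u : X) :
  rng_of_ring A := rhom_fun phi u.

(* X^* (x)_R R *)
Definition firm_dual (R : rng) (A : pzRingType) (X : bimod R A) : bimod A R :=
  tens_b (dual X) (reg R).

Section ElementaryRing.
Variables (R : rng) (A : pzRingType) (X : bimod R A).
Notation XX := (tens X (dual X)).

(* (u (x) phi) . v = u phi(v) and (u (x) phi)(v (x) psi) = u phi(v) (x) psi *)
Definition elt_act (x : XX) (v : X) : X :=
  tlift (fun (u : X) (phi : dual X) => ract u (ev phi v)) x.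
Definition elt_mul (x y : XX) : XX :=
  tlift (fun (u : X) (phi : dual X) =>
    tlift (fun (v : X) (psi : dual X) => ract u (ev phi v) ⊗ psi) y) x.

Fact elt_act_balanced (v : X) :
  balanced (fun (u : X) (phi : dual X) => ract u (ev phi v)).
Proof.
by split=> [x x' y|x y y'|x a y]; rewrite ?ractDl ?ractDr ?ractA.
Qed.
Fact elt_mul_balanced1 (u : X) (phi : dual X) :
  balanced (fun (v : X) (psi : dual X) => ract u (ev phi v) ⊗ psi).
Proof.
case: (rhomP (phi : rhom X (reg A))) => fD fZ.
rewrite /ev; split=> [x x' y|x y y'|x a y].
- by rewrite fD ractDr tpureDl.
- exact: tpureDr.
- by rewrite fZ -ractA tpureM.
Qed.
Fact elt_mul_balanced2 (y : XX) :
  balanced (fun (u : X) (phi : dual X) =>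
    tlift (fun (v : X) (psi : dual X) => ract u (ev phi v) ⊗ psi) y).
Proof.
split=> [u u' phi|u phi phi'|u a phi].
- by apply: tlift_add => v psi; rewrite ractDl tpureDl.
- by apply: tlift_add => v psi; rewrite ractDr tpureDl.
- by apply: tlift_eq => v psi; rewrite ractA.
Qed.
Fact elt_mulE u phi v psi :
  elt_mul (u ⊗ phi) (v ⊗ psi) = ract u (ev phi v) ⊗ psi.
Proof.
by rewrite /elt_mul (tliftE _ _ (elt_mul_balanced2 _))
           (tliftE _ _ (elt_mul_balanced1 _ _)).
Qed.
Fact elt_mulDl : left_distributive elt_mul +%R.
Proof. by move=> x y z; rewrite /elt_mul (tliftD (elt_mul_balanced2 z)). Qed.
Fact elt_mulDr : right_distributive elt_mul +%R.
Proof.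
by move=> x y z; apply: tlift_add => u phi; rewrite (tliftD (elt_mul_balanced1 u phi)).
Qed.
Fact elt_mulA : associative elt_mul.
Proof.
move=> x y z; move: x.
apply: (@tens_ext A X (dual X)) => [x x'|x x'|u phi]; rewrite ?elt_mulDl //.
move: y; apply: (@tens_ext A X (dual X)) => [y y'|y y'|v psi].
- by rewrite elt_mulDl elt_mulDr.
- by rewrite elt_mulDr elt_mulDl.
move: z; apply: (@tens_ext A X (dual X)) => [z z'|z z'|w chi].
- by rewrite !elt_mulDr.
- by rewrite elt_mulDr.
by rewrite !elt_mulE /ev (rhomP (phi : rhom X (reg A))).2 ractA.
Qed.
Definition elt_rng : rng := @Rng XX elt_mul elt_mulA elt_mulDl elt_mulDr.
End ElementaryRing.

Record comatrix_context (R S : rng) (X : bimod R S) (Y : bimod S R)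
    (eta : R -> tens_b X Y) (eps : tens_b Y X -> S) : Prop := ComatrixContext {
  cmc_firm_left_rng : firm_rng_axiom R;
  cmc_firm_right_rng : firm_rng_axiom S;
  cmc_firm_l : firm_l X;
  cmc_firm_r : firm_r X;
  cmc_dual_firm_l : firm_l Y;
  cmc_dual_firm_r : firm_r Y;
  cmc_eta : @bilinear R R (reg R) (tens_b X Y) eta;
  cmc_eps : @bilinear S S (tens_b Y X) (reg S) eps;
  cmc_triangle : forall (r : R) (u : X),
    tlift (fun (e : X) (f : Y) => ract e (eps (f ⊗ u))) (eta r) = lact r u;
  cmc_dual_triangle : forall (r : R) (phi : Y),
    tlift (fun (e : X) (f : Y) => lact (eps (phi ⊗ e)) f) (eta r) = ract phi r }.

(* Y (x)_R X with Delta(phi (x) u) = (phi (x) e_r) (x) (f_r (x) u^r), where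
   eta(r) = e_r (x) f_r and r (x) u^r in R (x)_R X corresponds to u. *)
Definition comatrix_delta (R S : rng) (X : bimod R S) (Y : bimod S R)
    (eta : R -> tens_b X Y) : tens_b Y X -> tens_b (tens_b Y X) (tens_b Y X) :=
  tlift (fun (phi : Y) (u : X) =>
    tlift (fun (r : reg R) (v : X) =>
      tlift (fun (e : X) (f : Y) =>
        (phi ⊗ e : tens_b Y X) ⊗ (f ⊗ v : tens_b Y X)) (eta r))
      (unacc_l X u)).

Definition comatrix_coring (R : rng) (A : pzRingType) (X : bimod R A) (Y : bimod A R)
    (eta : R -> tens_b X Y) (eps : tens_b Y X -> rng_of_ring A) : coring_data A :=
  CoringData (comatrix_delta eta) eps.

Section FirmDualContext.
Variables (R : rng) (A : pzRingType) (X : bimod R A) (iota : rng_hom R (elt_rng X)).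

Definition dual_eps : tens_b (dual X) X -> rng_of_ring A :=
  tlift (fun (phi : dual X) (u : X) => ev phi u).
Definition dual_eta : R -> tens_b X (dual X) := iota.

(* r |-> e_s (x) (f_s (x) r^s), where s (x) r^s in R (x)_R R corresponds to r. *)
Definition firm_dual_eta (r : R) : tens_b X (firm_dual X) :=
  tlift (fun s t : reg R =>
    tlift (fun (e : X) (f : dual X) => e ⊗ (f ⊗ t : firm_dual X)) (iota s))
    (unacc_r (reg R) r).
Definition firm_dual_eps : tens_b (firm_dual X) X -> rng_of_ring A :=
  tlift (fun (y : firm_dual X) (u : X) =>
    tlift (fun (phi : dual X) (r : reg R) => ev phi (lact r u)) y).

(* The coring structure of X^* (x)_R X, and that of X^dag (x)_R X. *)
Definition dual_comatrix : coring_data A := comatrix_coring dual_eta dual_eps.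
Definition firm_dual_comatrix : coring_data A :=
  comatrix_coring firm_dual_eta firm_dual_eps.
End FirmDualContext.

Section Galois.
Variables (A : pzRingType) (C : coring A) (R : rng) (X : bicomodule C R).

Definition firmly_projective_via (iota : rng_hom R (elt_rng X)) : Prop :=
  (forall (r : R) (u : X), elt_act (iota r) u = lact r u) /\ firm_l X.

Definition firmly_projective : Prop := exists iota, firmly_projective_via iota.

Definition can : tens_b (dual X) X -> C :=
  tlift (fun (f : dual X) (u : X) =>
    tlift (fun (v : X) (c : C) => lact (ev f v) c) (coact u)).

Definition can_at (M : rmod A) : tens_r (rhom_rmod X M) X -> tens_r M C :=
  tlift (fun (f : rhom_rmod X M) (u : X) => tmap (f : rhom X M) (@idfun C) (coact u)).

Definition galois_comodule : Prop :=
  exists2 iota, firmly_projective_via iota & @coring_iso A (dual_comatrix iota) C can.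

Definition comonadic_galois : Prop :=
  firm_l X /\ forall M : rmod A, unital_r M -> bijective (@can_at M).
End Galois.

(* A left C-comodule with a right action of R for which the coaction is right
   R-linear; only the bilinearity of the coaction is needed to form cotensor
   products. *)
Record left_coaction (A : pzRingType) (C : coring A) (R : rng) := LeftCoaction {
  lc_bimod :> bimod A R;
  lcoact : lc_bimod -> tens_b C lc_bimod;
  lcoact_bilinear : @bilinear A R lc_bimod (tens_b C lc_bimod) lcoact }.
Arguments lcoact {A C R l} x : rename.

Section Kernel.
Variables (R : rng) (M N : rmod R) (f : rhom M N).
Record rker := Rker { rker_val : M; rker_valP : f rker_val == 0 }.
HB.instance Definition _ := [isSub for rker_val].
HB.instance Definition _ := [Choice of rker by <:].
Fact rker_zmod_closed : zmod_closed (fun x : M => f x == 0).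
Proof.
have fD := (rhomP f).1; split=> [|x y]; first by apply/eqP; exact: morphD0.
by move=> /eqP x0 /eqP y0; apply/eqP; rewrite fD morphDN // x0 y0 subrr.
Qed.
HB.instance Definition _ :=
  GRing.SubChoice_isSubZmodule.Build M (fun x : M => f x == 0) rker rker_zmod_closed.

Fact rker_ract_subproof (x : rker) (r : R) : f (ract (rker_val x) r) == 0.
Proof. by rewrite (rhomP f).2 (eqP (rker_valP x)) ract0. Qed.
Definition rker_ract x r : rker := Rker (rker_ract_subproof x r).
Fact rker_ractDl x y r : rker_ract (x + y) r = rker_ract x r + rker_ract y r.
Proof. by apply: val_inj; rewrite /= ractDl. Qed.
Fact rker_ractDr x r s : rker_ract x (r + s) = rker_ract x r + rker_ract x s.
Proof. by apply: val_inj; rewrite /= ractDr. Qed.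
Fact rker_ractA x r s : rker_ract (rker_ract x r) s = rker_ract x (rmul r s).
Proof. by apply: val_inj; rewrite /= ractA. Qed.
Definition rker_rmod : rmod R := Rmod rker_ractDl rker_ractDr rker_ractA.
End Kernel.

Section Cotensor.
Variables (A : pzRingType) (C : coring A) (R : rng) (L : left_coaction C R).

Section Objects.
Variable N : comodule C.
Fact cotens_left_rlinear :
  @rlinear R (tens_r N L) (tens_r N (tens_b C L))
    (fun x => tassoc (tmap coact (@idfun L) x)).
Proof.
have cP := coact_rlinear N.
apply: (rlinear_comp (@tassoc_rlinear _ _ _ N C L)).
by apply: (@tmap_rlinear A R N (tens_r N C) L L).
Qed.
Fact cotens_right_rlinear :
  @rlinear R (tens_r N L) (tens_r N (tens_b C L)) (tmap (@idfun N) lcoact).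
Proof. by apply: tmap_rlinear => //; exact: lcoact_bilinear. Qed.
Definition cotens : rmod R :=
  rker_rmod (Rhom cotens_left_rlinear - Rhom cotens_right_rlinear).
End Objects.

Section Morphisms.
Variables (N P : comodule C) (f : chom N P).
Fact cotens_map_subproof (x : cotens N) :
  (Rhom (cotens_left_rlinear P) - Rhom (cotens_right_rlinear P))
    (tmap f (@idfun L) (val x)) == 0.
Proof.
have fP := rhomP f; have cN := coact_rlinear N; have cP := coact_rlinear P.
have [lL lR] := lcoact_bilinear L.
have fCP : @rlinear A (tens_r N C) (tens_r P C) (tmap f (@idfun C)).
  by apply: tmap_rlinear.
case: x => x /=; rewrite !subr_eq0 => /eqP xE; apply/eqP.
have -> : tmap coact (@idfun L) (tmap f (@idfun L) x)
    = tmap (tmap f (@idfun C) : tens_r N C -> tens_r P C) (@idfun L)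
        (tmap coact (@idfun L) x).
  by rewrite !tmap_comp //; apply: tlift_eq => n l /=; rewrite chom_colinear.
have -> : tmap (@idfun P) lcoact (tmap f (@idfun L) x)
    = tmap f (@idfun (tens_b C L)) (tmap (@idfun N) lcoact x).
  by rewrite !tmap_comp.
rewrite -xE; move: (tmap coact _ x) => {xE}x; move: x.
apply: tens3_ext => [x y|x y|n c l].
- by rewrite tmapD // tassocD.
- by rewrite tassocD tmapD.
- by rewrite tmapE // tmapE // !tassocE tmapE.
Qed.
Definition cotens_map (x : cotens N) : cotens P := Rker (cotens_map_subproof x).
Fact cotens_map_rlinear : @rlinear R (cotens N) (cotens P) cotens_map.
Proof.
have [mD mZ] : @rlinear R (tens_r N L) (tens_r P L) (tmap f (@idfun L)).
  by apply: tmap_rlinear => //; exact: rhomP.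
by split=> [x y|x r]; apply: val_inj; rewrite /= ?mD ?mZ.
Qed.
End Morphisms.

Definition cotens_functor : functor (comod_cat C) (rmod_cat R).
Proof.
refine (@Functor (comod_cat C) (rmod_cat R) cotens
  (fun N P f => Rhom (cotens_map_rlinear f)) _ _).
- by move=> N; apply: rhom_ext => x; apply: val_inj => /=; exact: tmap_id.
- move=> N P Q f g; apply: rhom_ext => x; apply: val_inj => /=.
  by rewrite tmap_comp //; exact: rhomP.
Defined.
End Cotensor.

Section FirmDualCoaction.
Variables (A : pzRingType) (C : coring A) (R : firm_rng) (X : bicomodule C R).

Fact unacc_rK : cancel (acc_r (reg R)) (unacc_r (reg R)).
Proof.
have [g gK Kg] := fr_firm R.
move=> x; apply: (can_inj gK).
by apply: (@xgetPex _ 0 [set y | acc_r (reg R) y = acc_r (reg R) x]); exists x.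
Qed.
Fact acc_rK : cancel (unacc_r (reg R)) (acc_r (reg R)).
Proof. by have [g gK Kg] := fr_firm R; move=> x; rewrite -[x]Kg unacc_rK. Qed.
Fact unacc_rD : {morph unacc_r (reg R) : x y / x + y}.
Proof.
by move=> x y; apply: (can_inj unacc_rK); rewrite acc_rD !acc_rK.
Qed.
Fact unacc_r_ind (Q : reg R -> tens (reg R) (reg R) -> Prop) :
  Q 0 0 -> (forall r s x y, Q r x -> Q s y -> Q (r + s) (x + y)) ->
  (forall s t, Q (rmul s t) (s ⊗ t)) -> forall r, Q r (unacc_r (reg R) r).
Proof.
move=> Q0 QD Qp r; rewrite -{1}[r]acc_rK.
elim/tens_ind: (unacc_r _ r) => [|x y Qx Qy|s t].
- by rewrite (morphD0 (@acc_rD _ _)).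
- by rewrite acc_rD; exact: QD.
- by rewrite acc_rE; exact: Qp.
Qed.

Fact can_inner_balanced (f : dual X) (N : lmod A) :
  balanced (fun (v : X) (c : N) => lmact (ev f v) c).
Proof.
case: (rhomP (f : rhom X (reg A))) => fD fZ.
rewrite /ev; split=> [x x' y|x y y'|x a y].
- by rewrite fD lmactDl.
- exact: lmactDr.
- by rewrite fZ lmactA.
Qed.
Fact can_balanced :
  balanced (fun (f : dual X) (u : X) =>
    tlift (fun (v : X) (c : C) => lact (ev f v) c) (coact u)).
Proof.
split=> [f g u|f u v|f r u].
- by apply: tlift_add => v c; rewrite lactDl.
- by rewrite (coact_rlinear X).1 (tliftD (can_inner_balanced f C)).
- rewrite (bicomod_coactE r u); move: (coact u).
  have rP : rlinear (lact r : X -> X) := rhomP (bc_act r).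
  apply: (@tens_ext A X C C) => [x y|x y|v c].
  + by rewrite (tliftD (can_inner_balanced (ract f r) C)).
  + by rewrite tmapD // (tliftD (can_inner_balanced f C)).
  + by rewrite tmapE // (tliftE _ _ (can_inner_balanced f C))
               (tliftE _ _ (can_inner_balanced (ract f r) C)).
Qed.
Fact canE (f : dual X) (u : X) :
  can (f ⊗ u) = tlift (fun (v : X) (c : C) => lact (ev f v) c) (coact u).
Proof. exact: tliftE can_balanced. Qed.
Fact canD : {morph @can A C R X : x y / x + y}.
Proof. exact: tliftD can_balanced. Qed.
Fact can_bilinear : @bilinear A A (tens_b (dual X) X) C (@can A C R X).
Proof.
split; split; try exact: canD.
- move=> a; apply: (@tens_ext R (dual X) X C) => [x y|x y|f u].
  + by rewrite (@lmactDr A (tens_b (dual X) X) a x y) canD.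
  + by rewrite canD lmactDr.
  rewrite /= tens_lactE !canE; move: (coact u).
  apply: (@tens_ext A X C C) => [x y|x y|v c].
  + by rewrite (tliftD (can_inner_balanced (lact a f) C)).
  + by rewrite (tliftD (can_inner_balanced f C)) lactDr.
  + by rewrite (tliftE _ _ (can_inner_balanced f C))
       (tliftE _ _ (can_inner_balanced (lact a f) C)) [RHS]lactA.
- move=> x a; move: x; apply: (@tens_ext R (dual X) X C) => [x y|x y|f u].
  + by rewrite ractDl canD.
  + by rewrite canD ractDl.
  rewrite /= tens_ractE !canE (coact_rlinear X).2; move: (coact u).
  apply: (@tens_ext A X C C) => [x y|x y|v c].
  + by rewrite ractDl (tliftD (can_inner_balanced f C)).
  + by rewrite (tliftD (can_inner_balanced f C)) ractDl.
  + by rewrite /= tens_ractE !(tliftE _ _ (can_inner_balanced f C)) lactC.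
Qed.

Variable iota : rng_hom R (elt_rng X).
Hypothesis iotaP : firmly_projective_via iota.
Notation eta := (firm_dual_eta iota).

Fact iota_left (r s : R) : iota (rmul r s) = @lact R R (tens_b X (dual X)) r (iota s).
Proof.
rewrite rng_homM.
suff : elt_mul (iota r) =1 @tens_lact R A R X (dual X) r by exact.
have bal := tens_lact_balanced X (dual X) r.
apply: (@tens_ext A X (dual X)) => [x y|x y|v psi].
- by rewrite elt_mulDr.
- exact: tliftD bal _ _.
rewrite tens_lactE -(iotaP.1 r v); move: (iota r : tens X (dual X)).
apply: (@tens_ext A X (dual X)) => [x y|x y|u phi].
- by rewrite elt_mulDl.
- by rewrite /elt_act (tliftD (elt_act_balanced v)) tpureDl.
- by rewrite elt_mulE /elt_act (tliftE _ _ (elt_act_balanced v)).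
Qed.
Fact iota_right (r s : R) : iota (rmul r s) = @ract R (tens_b X (dual X)) (iota r) s.
Proof.
rewrite rng_homM.
suff : (fun x : tens X (dual X) => elt_mul x (iota s))
    =1 (fun x => @ract R (tens_b X (dual X)) x s) by exact.
apply: (@tens_ext A X (dual X)) => [x y|x y|u phi].
- by rewrite elt_mulDl.
- by rewrite (@ractDl R (tens_b X (dual X))).
rewrite [RHS]tens_ractE.
have -> : ract phi s = tlift (fun (e : X) (f : dual X) => lact (ev phi e) f) (iota s).
  have phiP := rhomP (phi : rhom X (reg A)).
  apply: rhom_ext => v; transitivity (ev phi (lact s v)) => //.
  rewrite -(iotaP.1 s v).
  suff : (fun y : tens X (dual X) => ev phi (elt_act y v) : reg A)
      =1 (fun y => ev (tlift (fun (e : X) (f : dual X) => lact (ev phi e) f) y) v) by exact.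
  apply: (@tens_ext A X (dual X) (reg A)) => [x y|x y|e f]; rewrite /ev.
  - by rewrite /elt_act (tliftD (elt_act_balanced v)) phiP.1.
  - by rewrite (tliftD (can_inner_balanced phi (dual X))).
  - rewrite /elt_act (tliftE _ _ (elt_act_balanced v)) phiP.2.
    by rewrite (tliftE _ _ (can_inner_balanced phi (dual X))).
move: (iota s : tens X (dual X)); apply: (@tens_ext A X (dual X)) => [x y|x y|v psi].
- by rewrite elt_mulDr.
- by rewrite (tliftD (can_inner_balanced phi (dual X))) tpureDr.
- by rewrite elt_mulE (tliftE _ _ (can_inner_balanced phi (dual X))) tpureM.
Qed.

Let K (t : reg R) (y : tens X (dual X)) : tens_b X (firm_dual X) :=
  tlift (fun (e : X) (f : dual X) => e ⊗ (f ⊗ t : firm_dual X)) y.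
Fact eta_balanced1 (t : reg R) :
  balanced (fun (e : X) (f : dual X) => e ⊗ (f ⊗ t : firm_dual X)).
Proof.
split=> [x x' y|x y y'|x a y]; first exact: tpureDl.
- by rewrite (tpureDl y y' t) tpureDr.
- by rewrite tpureM /= tens_lactE.
Qed.
Let KD t : {morph K t : x y / x + y} := tliftD (eta_balanced1 t).
Let KE t e f : K t (e ⊗ f) = e ⊗ (f ⊗ t : firm_dual X) := tliftE _ _ (eta_balanced1 t).
Fact eta_balanced2 : balanced (fun s t : reg R => K t (iota s)).
Proof.
split=> [s s' t|s t t'|s r t].
- by rewrite rng_homD KD.
- by apply: tlift_add => e f; rewrite (tpureDr f t t') tpureDr.
- rewrite [ract s r]/(rmul s r) iota_right; move: (iota s : tens X (dual X)).
  apply: (@tens_ext A X (dual X) (tens_b X (firm_dual X))) => [x y|x y|e f].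
  + by rewrite (@ractDl R (tens_b X (dual X))) KD.
  + by rewrite KD.
  + have -> : @ract R (tens_b X (dual X)) (e ⊗ f) r = e ⊗ ract f r by exact: tens_ractE.
    by rewrite !KE; congr (_ ⊗ _); exact: tpureM.
Qed.
Fact etaE (s t : R) : eta (rmul s t) = K t (iota s).
Proof.
by rewrite /firm_dual_eta -[rmul s t](acc_rE (s : reg R) t) unacc_rK (tliftE _ _ eta_balanced2).
Qed.
Fact etaD : {morph eta : x y / x + y}.
Proof.
by move=> x y; rewrite /firm_dual_eta unacc_rD (tliftD eta_balanced2).
Qed.
Fact mul_ind (Q : R -> Prop) :
  Q 0 -> (forall r s, Q r -> Q s -> Q (r + s)) -> (forall s t, Q (rmul s t)) ->
  forall r, Q r.
Proof.
move=> Q0 QD Qp r; apply: (@unacc_r_ind (fun r _ => Q r)) => // s t _ _.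
exact: QD.
Qed.
Fact eta_bilinear : @bilinear R R (reg R) (tens_b X (firm_dual X)) eta.
Proof.
split; split=> //; try exact: etaD.
- move=> t r; move: r; apply: (@mul_ind (fun r =>
    eta (@rmul R t r) = @lmact R (tens_b X (firm_dual X)) t (eta r))) => [|r s Er Es|r s].
  + rewrite -[LHS]/(eta (@lmact R (reg R) t 0)) lmact0.
    by rewrite (morphD0 etaD) lmact0.
  + by rewrite rmulDr etaD Er Es -lmactDr etaD.
  rewrite rmulA !etaE iota_left; move: (iota r : tens X (dual X)).
  apply: (@tens_ext A X (dual X) (tens_b X (firm_dual X))) => [x y|x y|e f].
  + by rewrite (@lactDr _ _ (tens_b X (dual X))) KD.
  + by rewrite KD lmactDr.
  + have -> : @lact R R (tens_b X (dual X)) t (e ⊗ f) = lact t e ⊗ f by exact: tens_lactE.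
    by rewrite !KE [RHS]tens_lactE.
- move=> r t; move: r; apply: (@mul_ind (fun r =>
    eta (@rmul R r t) = @ract R (tens_b X (firm_dual X)) (eta r) t)) => [|r s Er Es|r s].
  + rewrite -[LHS]/(eta (@ract R (reg R) 0 t)) ract0.
    by rewrite (morphD0 etaD) ract0.
  + by rewrite rmulDl etaD Er Es -ractDl etaD.
  rewrite -rmulA !etaE; move: (iota r : tens X (dual X)).
  apply: (@tens_ext A X (dual X) (tens_b X (firm_dual X))) => [x y|x y|e f].
  + by rewrite KD.
  + by rewrite KD ractDl.
  + rewrite !KE [RHS]tens_ractE; congr (_ ⊗ _).
    by symmetry; exact: tens_ractE.
Qed.

(* phi (x) r |-> can(phi (x) e_s) (x) (f_s (x) r^s); note that
   eta(r) = e_s (x) (f_s (x) r^s). *)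
Definition firm_dual_coact : firm_dual X -> tens_b C (firm_dual X) :=
  tlift (fun (phi : dual X) (r : reg R) =>
    tlift (fun (e : X) (y : firm_dual X) => can (phi ⊗ e : tens_b (dual X) X) ⊗ y) (eta r)).

Fact firm_dual_coact_balanced1 (phi : dual X) :
  balanced (fun (e : X) (y : firm_dual X) =>
    can (phi ⊗ e : tens_b (dual X) X) ⊗ y : tens_b C (firm_dual X)).
Proof.
split=> [x x' y|x y y'|x a y].
- by rewrite (tpureDr phi x x') canD tpureDl.
- exact: tpureDr.
- rewrite -tpureM -can_bilinear.2.2; congr (can _ ⊗ _).
  by symmetry; exact: tens_ractE.
Qed.
Let B1 := firm_dual_coact_balanced1.
Fact firm_dual_coact_balanced2 :
  balanced (fun (phi : dual X) (r : reg R) =>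
    tlift (fun (e : X) (y : firm_dual X) => can (phi ⊗ e : tens_b (dual X) X) ⊗ y) (eta r)
    : tens_b C (firm_dual X)).
Proof.
split=> [phi psi r|phi r s|phi t r].
- by apply: tlift_add => e y; rewrite (tpureDl phi psi e) canD tpureDl.
- by rewrite etaD (tliftD (B1 phi)).
- rewrite eta_bilinear.1.2; move: (eta r).
  apply: (@tens_ext A X (firm_dual X) (tens_b C (firm_dual X))) => [x y|x y|e y].
  + by rewrite (tliftD (B1 _)).
  + by rewrite lmactDr (tliftD (B1 _)).
  have -> : @lmact R (tens_b X (firm_dual X)) t (e ⊗ y) = lact t e ⊗ y by exact: tens_lactE.
  by rewrite !(tliftE _ _ (B1 _)); congr (can _ ⊗ _); exact: tpureM.
Qed.
Let B2 := firm_dual_coact_balanced2.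
Fact firm_dual_coact_bilinear :
  @bilinear A R (firm_dual X) (tens_b C (firm_dual X)) firm_dual_coact.
Proof.
have cD : {morph firm_dual_coact : x y / x + y} := tliftD B2.
split; split=> //.
- move=> a; apply: (@tens_ext R (dual X) (reg R) (tens_b C (firm_dual X))) => [x y|x y|phi r].
  + by rewrite (@lmactDr A (firm_dual X) a x y) cD.
  + by rewrite cD lmactDr.
  have -> : @lmact A (firm_dual X) a (phi ⊗ r) = lact a phi ⊗ r by exact: tens_lactE.
  rewrite /firm_dual_coact !(tliftE _ _ B2); move: (eta r).
  apply: (@tens_ext A X (firm_dual X) (tens_b C (firm_dual X))) => [x y|x y|e y].
  + by rewrite (tliftD (B1 _)).
  + by rewrite (tliftD (B1 _)) lmactDr.
  rewrite !(tliftE _ _ (B1 _)) [RHS]tens_lactE -can_bilinear.1.2.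
  by congr (can _ ⊗ _); symmetry; exact: tens_lactE.
- move=> x t; move: x.
  apply: (@tens_ext R (dual X) (reg R) (tens_b C (firm_dual X))) => [x y|x y|phi r].
  + by rewrite ractDl cD.
  + by rewrite cD ractDl.
  have -> : @ract R (firm_dual X) (phi ⊗ r) t = phi ⊗ ract r t by exact: tens_ractE.
  rewrite /firm_dual_coact !(tliftE _ _ B2) eta_bilinear.2.2; move: (eta r).
  apply: (@tens_ext A X (firm_dual X) (tens_b C (firm_dual X))) => [x y|x y|e y].
  + by rewrite ractDl (tliftD (B1 _)).
  + by rewrite (tliftD (B1 _)) ractDl.
  have -> : @ract R (tens_b X (firm_dual X)) (e ⊗ y) t = e ⊗ ract y t by exact: tens_ractE.
  by rewrite !(tliftE _ _ (B1 _)) [RHS]tens_ractE.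
Qed.

Definition firm_dual_left_coaction : left_coaction C R :=
  LeftCoaction firm_dual_coact_bilinear.
End FirmDualCoaction.

Section LeftAdjoint.
Variables (R : firm_rng) (A : pzRingType) (C : coring A).
Variables (F : functor (firm_cat R) (comod_cat C)) (G : functor (comod_cat C) (firm_cat R)).
Variable adj : adjunction F G.

Section DirectSum.
Variable M : firm_rmod R.
Definition dsum_ract (x : (M * M)%type) (r : R) : (M * M)%type :=
  (ract x.1 r, ract x.2 r).
Fact dsum_ractDl x y r : dsum_ract (x + y) r = dsum_ract x r + dsum_ract y r.
Proof. by rewrite /dsum_ract !ractDl. Qed.
Fact dsum_ractDr x r s : dsum_ract x (r + s) = dsum_ract x r + dsum_ract x s.
Proof. by rewrite /dsum_ract !ractDr. Qed.
Fact dsum_ractA x r s : dsum_ract (dsum_ract x r) s = dsum_ract x (rmul r s).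
Proof. by rewrite /dsum_ract /= !ractA. Qed.
Definition dsum_rmod : rmod R := Rmod dsum_ractDl dsum_ractDr dsum_ractA.

Fact dsum_in1_subproof : @rlinear R M dsum_rmod (fun x => (x, 0)).
Proof.
split=> [x y|x r]; first by congr (_, _); rewrite addr0.
by congr (_, _); rewrite ract0.
Qed.
Fact dsum_in2_subproof : @rlinear R M dsum_rmod (fun x => (0, x)).
Proof.
split=> [x y|x r]; first by congr (_, _); rewrite addr0.
by congr (_, _); rewrite ract0.
Qed.
Fact dsum_pr1_subproof : @rlinear R dsum_rmod M (fun x => x.1). Proof. by []. Qed.
Fact dsum_pr2_subproof : @rlinear R dsum_rmod M (fun x => x.2). Proof. by []. Qed.
Definition dsum_in1 := Rhom dsum_in1_subproof.
Definition dsum_in2 := Rhom dsum_in2_subproof.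
Definition dsum_pr1 := Rhom dsum_pr1_subproof.
Definition dsum_pr2 := Rhom dsum_pr2_subproof.

Fact dsum_inE (x : dsum_rmod) : x = dsum_in1 x.1 + dsum_in2 x.2.
Proof. by case: x => x y; congr (_, _); rewrite /= ?addr0 ?add0r. Qed.

Fact acc_r_nat (N N' : rmod R) (f : rhom N N') x :
  acc_r N' (tmap f idfun x) = f (acc_r N x).
Proof.
have fP := rhomP f; move: x; apply: tens_ext => [x y|x y|n r].
- by rewrite tmapD // acc_rD.
- by rewrite acc_rD fP.1.
- by rewrite tmapE // !acc_rE fP.2.
Qed.

Fact dsum_firm : firm_r dsum_rmod.
Proof.
have [g gK Kg] := fm_firm M.
have gD : {morph g : x y / x + y}.
  by move=> x y; apply: (can_inj gK); rewrite acc_rD !Kg.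
have i1D := tmapD (rhomP dsum_in1) (llinear_id (reg R)).
have i2D := tmapD (rhomP dsum_in2) (llinear_id (reg R)).
pose h (x : dsum_rmod) : tens dsum_rmod (reg R) :=
  tmap dsum_in1 idfun (g x.1) + tmap dsum_in2 idfun (g x.2).
have hD : {morph h : x y / x + y}.
  move=> x y; rewrite /h [in LHS](gD x.1 y.1) [in LHS](gD x.2 y.2) i1D i2D.
  exact: addrACA.
exists h.
- apply: tens_ext => [x y|//|x r]; first by rewrite acc_rD hD.
  rewrite acc_rE /h /= -!acc_rE !gK.
  rewrite (tmapE _ _ (rhomP dsum_in1) (llinear_id _)).
  rewrite (tmapE _ _ (rhomP dsum_in2) (llinear_id _)).
  by rewrite -tpureDl -dsum_inE.
- by move=> x; rewrite acc_rD !acc_r_nat !Kg -dsum_inE.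
Qed.
Definition dsum : firm_rmod R := FirmRmod dsum_firm.
End DirectSum.

Definition fmapc (M N : firm_rmod R) (f : rhom M N) : chom (F M) (F N) :=
  @fmap _ _ F M N f.
Definition transposec (M : firm_rmod R) (Y : comodule C) (f : chom (F M) Y) :
  rhom M (G Y) := @transpose _ _ F G adj M Y f.

Fact fmapc1 (M : firm_rmod R) : fmapc (rhom_id M) = chom_id (F M).
Proof. exact: (@fmap1 _ _ F M). Qed.
Fact fmapcM (M N P : firm_rmod R) (f : rhom N P) (g : rhom M N) u :
  fmapc f (fmapc g u) = fmapc (rhom_comp f g) u.
Proof.
have E : fmapc (rhom_comp f g) = chom_comp (fmapc f) (fmapc g).
  exact: (@fmapM _ _ F M N P f g).
by rewrite E.
Qed.
Fact transposec_inj (M : firm_rmod R) (Y : comodule C) : injective (@transposec M Y).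
Proof. exact: bij_inj (@transpose_bij _ _ F G adj M Y). Qed.
Fact transposec_nat (M N : firm_rmod R) (Y : comodule C) (h : rhom M N)
    (f : chom (F N) Y) :
  transposec (chom_comp f (fmapc h)) = rhom_comp (transposec f) h.
Proof. exact: (@transpose_natl _ _ F G adj N M Y h f). Qed.

Fact left_adjoint_zero (M : firm_rmod R) : fmapc (0 : rhom M M) = 0.
Proof.
have z (f : chom (F M) (F M)) : transposec (chom_comp f (fmapc (0 : rhom M M))) = 0.
  rewrite transposec_nat; apply: rhom_ext => x /=.
  by rewrite morphD0 //; exact: (rhomP (transposec f)).1.
apply: transposec_inj.
have -> : fmapc (0 : rhom M M) = chom_comp (chom_id (F M)) (fmapc (0 : rhom M M)).
  by apply: chom_ext.
rewrite z -(z (0 : chom (F M) (F M))).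
by congr transposec; apply: chom_ext.
Qed.

Lemma left_adjointD (M N : firm_rmod R) (f g : rhom M N) (u : F M) :
  fmapc (f + g) u = fmapc f u + fmapc g u.
Proof.
pose B := dsum M.
pose i1 : rhom M B := dsum_in1 M; pose i2 : rhom M B := dsum_in2 M.
pose p1 : rhom B M := dsum_pr1 M; pose p2 : rhom B M := dsum_pr2 M.
have B_ext (Y : comodule C) (a b : chom (F B) Y) :
    chom_comp a (fmapc i1) = chom_comp b (fmapc i1) ->
    chom_comp a (fmapc i2) = chom_comp b (fmapc i2) -> a = b.
  move=> /(congr1 (@transposec _ _)) E1 /(congr1 (@transposec _ _)) E2.
  rewrite !transposec_nat in E1 E2.
  apply: transposec_inj; apply: rhom_ext => x; rewrite (dsum_inE x).
  rewrite (rhomP (transposec a)).1 (rhomP (transposec b)).1; congr (_ + _).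
  - exact: (congr1 (fun h : rhom M (G Y) => h x.1) E1).
  - exact: (congr1 (fun h : rhom M (G Y) => h x.2) E2).
pose e : chom (F B) (F B) :=
  chom_comp (fmapc i1) (fmapc p1) + chom_comp (fmapc i2) (fmapc p2).
have p1i1 : rhom_comp p1 i1 = rhom_id M by apply: rhom_ext.
have p2i2 : rhom_comp p2 i2 = rhom_id M by apply: rhom_ext.
have p1i2 : rhom_comp p1 i2 = 0 by apply: rhom_ext.
have p2i1 : rhom_comp p2 i1 = 0 by apply: rhom_ext.
have eE : e = chom_id (F B).
  apply: B_ext; apply: chom_ext => x.
  - transitivity (fmapc i1 (fmapc p1 (fmapc i1 x)) + fmapc i2 (fmapc p2 (fmapc i1 x))) => //.
    rewrite (fmapcM p1) (fmapcM p2) p1i1 p2i1 left_adjoint_zero fmapc1.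
    by rewrite (morphD0 (rhomP (fmapc i2)).1) addr0.
  - transitivity (fmapc i1 (fmapc p1 (fmapc i2 x)) + fmapc i2 (fmapc p2 (fmapc i2 x))) => //.
    rewrite (fmapcM p1) (fmapcM p2) p2i2 p1i2 left_adjoint_zero fmapc1.
    by rewrite (morphD0 (rhomP (fmapc i1)).1) add0r.
pose d : rhom M B := dsum_in1 M + dsum_in2 M.
pose h : rhom B N := rhom_comp f p1 + rhom_comp g p2.
have fD := (rhomP f).1; have gD := (rhomP g).1.
have hi1 : rhom_comp h i1 = f.
  by apply: rhom_ext => x /=; rewrite (morphD0 gD) addr0.
have hi2 : rhom_comp h i2 = g.
  by apply: rhom_ext => x /=; rewrite (morphD0 fD) add0r.
have p1d : rhom_comp p1 d = rhom_id M by apply: rhom_ext => x /=; rewrite addr0.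
have p2d : rhom_comp p2 d = rhom_id M by apply: rhom_ext => x /=; rewrite add0r.
have hd : rhom_comp h d = f + g.
  by apply: rhom_ext => x /=; rewrite addr0 add0r.
rewrite -hd -fmapcM.
have <- : e (fmapc d u) = fmapc d u by rewrite eE.
transitivity (fmapc h (fmapc i1 (fmapc p1 (fmapc d u)) + fmapc i2 (fmapc p2 (fmapc d u)))) => //.
rewrite (rhomP (fmapc h)).1 (fmapcM p1) (fmapcM p2) p1d p2d fmapc1 !fmapcM.
by rewrite hi1 hi2.
Qed.

Fact lmul_rlinear (r : R) : @rlinear R (reg R) (reg R) (rmul r).
Proof. by split=> [x y|x s]; [exact: rmulDr|rewrite /= rmulA]. Qed.
Definition lmul (r : R) : rhom (reg_firm R) (reg_firm R) := Rhom (lmul_rlinear r).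

Definition FR_act (r : R) : chom (F (reg_firm R)) (F (reg_firm R)) := fmapc (lmul r).
Fact FR_actD r s u : FR_act (r + s) u = FR_act r u + FR_act s u.
Proof.
rewrite -left_adjointD; congr (rhom_fun (chom_rhom (fmapc _)) u).
by apply: rhom_ext => x /=; rewrite rmulDl.
Qed.
Fact FR_actM r s u : FR_act r (FR_act s u) = FR_act (rmul r s) u.
Proof.
rewrite /FR_act fmapcM; congr (rhom_fun (chom_rhom (fmapc _)) u).
by apply: rhom_ext => x /=; rewrite rmulA.
Qed.
(* F(R) with r u = F(lambda_r)(u); additivity in r holds because F, being a left
   adjoint, is additive. *)
Definition FR : bicomodule C R := Bicomodule FR_actD FR_actM.
End LeftAdjoint.

(* Main.v *)
(** A left adjoint on firm modules is determined by its value X at R: the transposes of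
    the maps X -> Y induce Hom^C(X, Y) (x)_R R ~ G Y, and both F and - (x)_R X are left
    adjoint to this functor. One may thus replace (F, G) by
    (- (x)_R X, Hom^C(X, -) (x)_R R).

    If the latter Hom functor has a right adjoint, it commutes with the colimits that
    present a module M over A, and evaluating on cofree comodules gives
    M (x)_A X^dag ~ Hom_A(X, M) (x)_R R. For M = X the left multiplications by
    elements of R yield the dual bases e_r (x) f_r. The isomorphism also identifies
    Hom^C(X, N) (x)_R R, a kernel since R is flat, with the cotensor product.

    For an equivalence the counit Hom^C(X, Y) (x)_R X -> Y is bijective; on cofree
    comodules it is the canonical map. If C is flat then kernels of colinear maps are
    comodules, hence generated by X, and a colinear map X -> M (x)_R X comes from an
    R-linear map R -> M; this gives flatness. Conversely, flatness of X reduces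
    bijectivity of the counit to that of the canonical maps, and faithfulness then
    gives bijectivity of the unit. *)

From HB Require Import structures.
From mathcomp Require Import ring_quotient.
Require Import Defs.
From mathcomp Require Import boolp classical_sets.

Set Implicit Arguments.
Unset Strict Implicit.
Unset Printing Implicit Defensive.

Import GRing.Theory.
Local Open Scope ring_scope.

(** * Natural isomorphisms, adjunctions and equivalences *)

(** The main obstacle is that R has no unit and that kernels and Hom modules of firm modules need
    not be firm. Such modules are kept as arbitrary right R-modules and made firm by - (x)_R R, the
    right adjoint of the inclusion of firm modules. This is invisible after tensoring with X: since
    R (x)_R X ~ X, one has M (x)_R R (x)_R X ~ M (x)_R X for every M, firm or not. Identities that
    would be checked on a unit are checked on products m r, which span a firm module. The natural
    isomorphisms of an equivalence are arbitrary; they are not assumed to be the unit and counit of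
    the given adjunction, so the invertibility of the counit has to be proved. The comonadic-Galois
    condition only concerns cofree comodules. It reaches an arbitrary comodule Y because Hom^C(X, Y)
    is the equalizer of two maps from Hom_A(X, Y) to Hom_A(X, Y (x)_A C); the same equalizer,
    tensored with R instead of X, becomes the cotensor product. *)

Lemma inj_surj_bij (T U : Type) (f : T -> U) :
  injective f -> (forall y, exists x, f x = y) -> bijective f.
Proof.
move=> fI fS; exists (fun y => sval (cid (fS y))) => x; last exact: svalP (cid (fS x)).
by apply: fI; exact: svalP (cid (fS (f x))).
Qed.

Section Isomorphisms.
Variable C : category.

Lemma iso_comp (X Y Z : C) (f : hom Y Z) (g : hom X Y) :
  is_iso f -> is_iso g -> is_iso (comp f g).
Proof.
move=> [f' [f'f ff']] [g' [g'g gg']]; exists (comp g' f'); split.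
- by rewrite -compA (compA f') f'f comp1m.
- by rewrite -compA (compA g) gg' comp1m.
Qed.

Lemma iso_mono (X Y Z : C) (f : hom Y Z) (g h : hom X Y) :
  is_iso f -> comp f g = comp f h -> g = h.
Proof.
by move=> [f' [f'f _]] /(congr1 (comp f')); rewrite !compA f'f !comp1m.
Qed.

Lemma iso_epi (X Y Z : C) (f : hom X Y) (g h : hom Y Z) :
  is_iso f -> comp g f = comp h f -> g = h.
Proof.
by move=> [f' [_ ff']] /(congr1 (fun k => comp k f')); rewrite -!compA ff' !compm1.
Qed.

End Isomorphisms.

Section NaturalIso.
Variables C D : category.
Implicit Types F G H : functor C D.

Lemma fmap_iso F (X Y : C) (f : hom X Y) : is_iso f -> is_iso (fmap F f).
Proof.
by move=> [g [gf fg]]; exists (fmap F g); rewrite -!fmapM gf fg !fmap1.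
Qed.

Lemma nat_iso_sym F G : nat_iso F G -> nat_iso G F.
Proof.
move=> [a [aN aI]]; pose b X := sval (cid (aI X)).
have bP X : comp (b X) (a X) = idm (F X) /\ comp (a X) (b X) = idm (G X).
  exact: svalP (cid (aI X)).
exists b; split=> [X Y f|X]; last by exists (a X); rewrite (bP X).1 (bP X).2.
apply: (iso_mono (aI Y)).
by rewrite !compA (bP Y).2 comp1m aN -compA (bP X).2 compm1.
Qed.

Lemma nat_iso_trans F G H : nat_iso F G -> nat_iso G H -> nat_iso F H.
Proof.
move=> [a [aN aI]] [b [bN bI]]; exists (fun X => comp (b X) (a X)); split=> [X Y f|X].
- by rewrite -compA aN !compA bN.
- exact: iso_comp.
Qed.
End NaturalIso.

Lemma nat_iso_comp (C D E : category) (F F' : functor C D) (G G' : functor D E) :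
  nat_iso F F' -> nat_iso G G' -> nat_iso (comp_functor G F) (comp_functor G' F').
Proof.
move=> [a [aN aI]] [b [bN bI]]; exists (fun X => comp (b (F' X)) (fmap G (a X))).
split=> [X Y f|X] /=.
- by rewrite -compA -fmapM aN fmapM !compA bN.
- by apply: iso_comp => //; exact: fmap_iso.
Qed.

Lemma inverse_equivalences_iso (C D : category) (F F' : functor C D)
    (G G' : functor D C) :
  nat_iso F F' -> nat_iso G G' -> inverse_equivalences F G -> inverse_equivalences F' G'.
Proof.
move=> FF' GG' [GF FG]; split.
- by apply: nat_iso_trans GF; apply: nat_iso_comp; exact: nat_iso_sym.
- by apply: nat_iso_trans FG; apply: nat_iso_comp; exact: nat_iso_sym.
Qed.

Section Adjunctions.
Variables C D : category.

Lemma adjunction_iso_l (F F' : functor C D) (G : functor D C) :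
  nat_iso F' F -> adjunction F G -> inhabited (adjunction F' G).
Proof.
move=> /nat_iso_sym[a [aN aI]] adj; constructor.
apply: (@Adjunction _ _ F' G (fun X Y f => transpose adj (comp f (a X)))).
- move=> X Y; apply: (bij_comp (f := transpose adj (Y := Y))); first exact: transpose_bij.
  have [b [ba ab]] := aI X; exists (fun f => comp f b) => f.
  + by rewrite -compA ab compm1.
  + by rewrite -compA ba compm1.
- by move=> X X' Y h f; rewrite -compA -aN compA transpose_natl.
- by move=> X Y Y' k f; rewrite -compA transpose_natr.
Qed.

Lemma adjunction_iso_r (F : functor C D) (G G' : functor D C) :
  nat_iso G G' -> adjunction F G -> inhabited (adjunction F G').
Proof.
move=> [a [aN aI]] adj; constructor.
apply: (@Adjunction _ _ F G' (fun X Y f => comp (a Y) (transpose adj f))).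
- move=> X Y; apply: (bij_comp (h := transpose adj (Y := Y))); last exact: transpose_bij.
  have [b [ba ab]] := aI Y; exists (fun f => comp b f) => f.
  + by rewrite compA ba comp1m.
  + by rewrite compA ab comp1m.
- by move=> X X' Y h f; rewrite transpose_natl compA.
- by move=> X Y Y' k f; rewrite transpose_natr compA aN compA.
Qed.

Lemma has_right_adjoint_iso (F F' : functor C D) :
  nat_iso F F' -> has_right_adjoint F -> has_right_adjoint F'.
Proof.
move=> /nat_iso_sym FF' [G [adj]]; exists G; exact: adjunction_iso_l adj.
Qed.

Lemma left_adjoint_unique (F F' : functor C D) (G : functor D C) :
  adjunction F G -> adjunction F' G -> nat_iso F F'.
Proof.
move=> adj adj'.
(* [a X] corresponds under [e] to the unit of [e'] at X; exchanging [e] and [e'] gives its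
   inverse. *)
have tr (E E' : functor C D) (e : adjunction E G) (e' : adjunction E' G) :
    exists a : forall X, hom (E X) (E' X),
      forall X, transpose e (a X) = transpose e' (idm (E' X)).
  have inv X : exists a : hom (E X) (E' X), transpose e a = transpose e' (idm (E' X)).
    have [h _ Kh] := transpose_bij e X (E' X).
    by exists (h (transpose e' (idm (E' X)))).
  by exists (fun X => sval (cid (inv X))) => X; exact: svalP (cid (inv X)).
have [a aE] := tr _ _ adj adj'; have [b bE] := tr _ _ adj' adj.
have inj (E : functor C D) (e : adjunction E G) X Y :
  injective (@transpose _ _ _ _ e X Y) by exact: bij_inj (transpose_bij e X Y).
exists a; split=> [X Y f|X].
- apply: (inj _ adj).
  by rewrite transpose_natl aE transpose_natr aE -transpose_natl -transpose_natr
             comp1m compm1.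
- exists (b X); split.
  + by apply: (inj _ adj); rewrite transpose_natr aE -transpose_natr compm1 bE.
  + by apply: (inj _ adj'); rewrite transpose_natr bE -transpose_natr compm1 aE.
Qed.

Lemma left_adjoint_epi (F : functor C D) (G : functor D C) (adj : adjunction F G)
    (X Y : C) (f : hom X Y) : epi f -> epi (fmap F f).
Proof.
move=> fE Z g h /(congr1 (@transpose _ _ _ _ adj _ _)); rewrite !transpose_natl => /fE.
by move/(bij_inj (transpose_bij adj Y Z)).
Qed.

(** A lifting problem for F P against f is transposed to one for P against [fmap G f], which is
    still an epimorphism. *)
Lemma left_adjoint_projective (F : functor C D) (G : functor D C)
    (adj : adjunction F G) (P : C) :
  (forall X Y (f : hom X Y), epi f -> epi (fmap G f)) ->
  projective P -> projective (F P).
Proof.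
move=> GE PP X Y f g fE.
have [h hE] := PP _ _ (fmap G f) (transpose adj g) (GE _ _ _ fE).
have [t _ Kt] := transpose_bij adj P X; exists (t h).
by apply: (bij_inj (transpose_bij adj P Y)); rewrite transpose_natr Kt.
Qed.
End Adjunctions.

Lemma equivalence_faithful (C D : category) (F : functor C D) (G : functor D C) :
  nat_iso (comp_functor G F) (id_functor C) ->
  forall X Y (f g : hom X Y), fmap F f = fmap F g -> f = g.
Proof.
move=> [a [aN aI]] X Y f g fg.
by apply: (iso_epi (aI X)); rewrite -[f]/(fmap (id_functor C) f)
  -[g]/(fmap (id_functor C) g) -!aN /= fg.
Qed.

(** The preimage is G h conjugated by the isomorphism G F ~ id. That F sends it to h is checked
    after applying G, which is faithful because F G ~ id. *)
Lemma equivalence_full (C D : category) (F : functor C D) (G : functor D C) :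
  inverse_equivalences F G ->
  forall X Y (h : hom (F X) (F Y)), exists f : hom X Y, fmap F f = h.
Proof.
move=> [GF FG] X Y h; have [a [aN aI]] := GF; have [b [ba ab]] := aI X.
exists (comp (a Y) (comp (fmap G h) b)).
apply: (equivalence_faithful FG); apply: (iso_mono (aI Y)).
have := aN _ _ (comp (a Y) (comp (fmap G h) b)) => /= ->.
by rewrite -!compA ba compm1.
Qed.

(** F is full and faithful, so composing F f with the isomorphism Y ~ F G Y is already a bijection
    between Hom sets, even when the two given isomorphisms do not satisfy the triangle
    identities. *)
Lemma inverse_equivalences_adjoint (C D : category) (F : functor C D) (G : functor D C) :
  inverse_equivalences F G -> has_right_adjoint G.
Proof.
move=> FG; exists F; constructor.
have /nat_iso_sym/cid[b [bN bI]] := FG.2.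
apply: (@Adjunction _ _ G F (fun Y X f => comp (fmap F f) (b Y))).
- move=> Y X; apply: inj_surj_bij => [f g /(iso_epi (bI Y))|h].
    exact: equivalence_faithful FG.1 _ _ _ _.
  have [c [cb bc]] := bI Y; have [f fE] := equivalence_full FG (comp h c).
  by exists f; rewrite fE -compA cb compm1.
- by move=> Y Y' X h f; rewrite fmapM -!compA bN.
- by move=> Y X X' k f; rewrite fmapM compA.
Qed.

(** G is itself a left adjoint, of F, and left adjoints preserve epimorphisms. *)
Lemma equivalence_epi (C D : category) (F : functor C D) (G : functor D C) :
  inverse_equivalences F G ->
  forall (X Y : D) (f : hom X Y), epi f -> epi (fmap G f).
Proof.
move=> /inverse_equivalences_adjoint[H [adj]] X Y f; exact: left_adjoint_epi adj _ _ f.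
Qed.

(** The given isomorphism [a] : F G ~ id is unrelated to the counit e, but [a Y] factors through e,
    which yields a right inverse k. By fullness, e can be cancelled on the left from maps F X -> F
    (G Y), so k is also a left inverse. *)
Lemma counit_iso (C D : category) (F : functor C D) (G : functor D C)
    (adj : adjunction F G) :
  inverse_equivalences F G ->
  forall (Y : D) (e : hom (F (G Y)) Y), transpose adj e = idm (G Y) -> is_iso e.
Proof.
move=> FG Y e eE; have [a [_ aI]] := FG.2.
have inj X Z := bij_inj (transpose_bij adj X Z).
have tE X (f : hom X (G Y)) : transpose adj (comp e (fmap F f)) = f.
  by rewrite transpose_natl eE comp1m.
have [c [ca ac]] := aI Y.
have eI X (g h : hom (F X) (F (G Y))) : comp e g = comp e h -> g = h.
  have [f <-] := equivalence_full FG g; have [f' <-] := equivalence_full FG h.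
  by move=> /(congr1 (@transpose _ _ _ _ adj _ _)); rewrite !tE => ->.
pose k : hom Y (F (G Y)) := comp (fmap F (transpose adj (a Y))) c.
have ek : comp e k = idm Y.
  rewrite /k compA.
  have -> : comp e (fmap F (transpose adj (a Y))) = a Y by apply: inj; exact: tE.
  by rewrite ac.
exists k; split=> //; apply: eI.
by rewrite compA ek comp1m compm1.
Qed.

(** * Tensor products and firm modules *)

Lemma morph_inj (U V : zmodType) (f : U -> V) :
  {morph f : x y / x + y} -> (forall x, f x = 0 -> x = 0) -> injective f.
Proof.
move=> fD f0 x y fxy; apply/eqP; rewrite -subr_eq0; apply/eqP/f0.
by rewrite fD (morphDN fD) fxy subrr.
Qed.

Lemma morphD_can (U V : zmodType) (f : U -> V) (g : V -> U) :
  cancel f g -> cancel g f -> {morph f : x y / x + y} -> {morph g : x y / x + y}.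
Proof. by move=> fK gK fD x y; apply: (can_inj fK); rewrite fD !gK. Qed.

Lemma rlinear_can (R : rng) (M N : rmod R) (f : M -> N) (g : N -> M) :
  cancel f g -> cancel g f -> rlinear f -> rlinear g.
Proof.
move=> fK gK [fD fZ]; split=> [|x r]; first exact: morphD_can fD.
by apply: (can_inj fK); rewrite fZ !gK.
Qed.

Lemma llinear_can (R : rng) (M N : lmod R) (f : M -> N) (g : N -> M) :
  cancel f g -> cancel g f -> llinear f -> llinear g.
Proof.
move=> fK gK [fD fZ]; split=> [|r x]; first exact: morphD_can fD.
by apply: (can_inj fK); rewrite fZ !gK.
Qed.

Lemma rmod_is_iso (R : rng) (M N : rmod_cat R) (f : rhom M N) :
  bijective f -> is_iso (f : hom M N).
Proof.
move=> [g fK gK]; exists (Rhom (rlinear_can fK gK (rhomP f))).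
by split; apply: rhom_ext.
Qed.

Lemma firm_is_iso (R : rng) (M N : firm_cat R) (f : rhom M N) :
  bijective f -> is_iso (f : hom M N).
Proof.
move=> [g fK gK]; exists (Rhom (rlinear_can fK gK (rhomP f))).
by split; apply: rhom_ext.
Qed.

Section ComoduleIso.
Variables (A : pzRingType) (C : coring A).

Lemma comod_is_iso (M N : comod_cat C) (f : chom M N) :
  bijective f -> is_iso (f : hom M N).
Proof.
move=> [g fK gK]; have gP := rlinear_can fK gK (rhomP f).
have gC : colinear (Rhom gP).
  move=> n; have E : coact n = tmap f idfun (coact (g n)).
    by rewrite -{1}[n]gK; exact: chom_colinear.
  rewrite E tmap_comp //=; last exact: rhomP.
  by rewrite -[LHS]tmap_id; apply: tlift_eq => m c /=; rewrite fK.
by exists (Chom gC); split; apply: chom_ext.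
Qed.

Lemma comod_iso_bij (M N : comod_cat C) (f : chom M N) :
  is_iso (f : hom M N) -> bijective f.
Proof.
move=> [g [gf fg]]; exists (g : chom N M) => x.
- exact: (congr1 (fun h : chom M M => h x) gf).
- exact: (congr1 (fun h : chom N N => h x) fg).
Qed.
End ComoduleIso.

Lemma tlift_tmap (R : rng) (M M' : rmod R) (N N' : lmod R) (P : zmodType)
    (h : M' -> N' -> P) (f : M -> M') (g : N -> N') (x : tens M N) :
  balanced h -> tlift h (tmap f g x) = tlift (fun m n => h (f m) (g n)) x.
Proof.
move=> hB; rewrite /tmap (tlift_comp _ _ (tliftD hB)).
by apply: tlift_eq => m n; exact: tliftE.
Qed.

Lemma tpure_llinear_bimod (R S T : rng) (M : bimod R S) (N : bimod S T) (n : N) :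
  @llinear R M (tens_b M N) (fun m : M => m ⊗ n).
Proof. by split=> [u v|a u]; [exact: tpureDl|rewrite /= tens_lactE]. Qed.

Section Reassociation.
Variables (R S T : rng) (M : rmod R) (N : bimod R S) (P : bimod S T).

Lemma tpure_rlinear_bimod (m : M) : @rlinear S N (tens_r M N) (fun n : N => m ⊗ n).
Proof. by split=> [u v|u a]; [exact: tpureDr|rewrite /= tens_ractE]. Qed.

Definition tassocV (x : tens M (tens_b N P)) : tens (tens_r M N) P :=
  tlift (fun (m : M) (y : tens_b N P) => tmap (fun n : N => m ⊗ n : tens_r M N) idfun y) x.

Fact tassocV_balanced : balanced (fun (m : M) (y : tens_b N P) =>
  tmap (fun n : N => m ⊗ n : tens_r M N) (@idfun P) y).
Proof.
split=> [m m' y|m y y'|m r y].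
- by apply: tlift_add => n p; rewrite tpureDl [LHS]tpureDl.
- by rewrite tmapD //; exact: tpure_rlinear_bimod.
- move: y; apply: (@tens_ext S N P) => [x y|x y|n p].
  + by rewrite tmapD //; exact: tpure_rlinear_bimod.
  + by rewrite lmactDr tmapD //; exact: tpure_rlinear_bimod.
  + rewrite /= tens_lactE !tmapE //; try exact: tpure_rlinear_bimod.
    by rewrite tpureM.
Qed.
Lemma tassocVD : {morph tassocV : x y / x + y}.
Proof. exact: tliftD tassocV_balanced. Qed.
Lemma tassocVE m (y : tens_b N P) :
  tassocV (m ⊗ y) = tmap (fun n : N => m ⊗ n : tens_r M N) idfun y.
Proof. exact: (tliftE _ _ tassocV_balanced). Qed.
Lemma tassocVE3 m n p :
  tassocV (m ⊗ (n ⊗ p : tens_b N P)) = (m ⊗ n : tens_r M N) ⊗ p.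
Proof. by rewrite tassocVE tmapE //; exact: tpure_rlinear_bimod. Qed.
Lemma tens3r_ext (Q : zmodType) (f g : tens M (tens_b N P) -> Q) :
  {morph f : x y / x + y} -> {morph g : x y / x + y} ->
  (forall m n p, f (m ⊗ (n ⊗ p : tens_b N P)) = g (m ⊗ (n ⊗ p : tens_b N P))) -> f =1 g.
Proof.
move=> fD gD fg; apply: tens_ext => // m y; move: y.
by apply: (@tens_ext S N P Q (fun y => f (m ⊗ (y : tens_b N P)))
   (fun y => g (m ⊗ (y : tens_b N P)))) => [x y|x y|n p] //; rewrite tpureDr ?fD ?gD.
Qed.
Lemma tassocK : cancel (@tassoc R S T M N P) tassocV.
Proof.
apply: tens3_ext => [x y|//|m n p]; first by rewrite tassocD tassocVD.
by rewrite tassocE tassocVE3.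
Qed.
Lemma tassocVK : cancel tassocV (@tassoc R S T M N P).
Proof.
apply: tens3r_ext => [x y|//|m n p]; first by rewrite tassocVD tassocD.
by rewrite tassocVE3 tassocE.
Qed.
Lemma tassocV_rlinear :
  @rlinear T (tens_r M (tens_b N P)) (tens_r (tens_r M N) P) tassocV.
Proof.
exact: (@rlinear_can T (tens_r (tens_r M N) P) (tens_r M (tens_b N P)) _ _
  tassocK tassocVK (@tassoc_rlinear _ _ _ M N P)).
Qed.
End Reassociation.

Section TensorBijections.
Variable R : rng.

Lemma tmap_can (M M' : rmod R) (N N' : lmod R) (f : M -> M') (f' : M' -> M)
    (g : N -> N') (g' : N' -> N) :
  rlinear f -> rlinear f' -> llinear g -> llinear g' ->
  cancel f f' -> cancel g g' -> cancel (tmap f g) (tmap f' g').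
Proof.
move=> fP fP' gP gP' fK gK x; rewrite tmap_comp // -[RHS]tmap_id.
by apply: tlift_eq => m n /=; rewrite fK gK.
Qed.

Lemma tmap_bij (M M' : rmod R) (N N' : lmod R) (f : M -> M') (g : N -> N') :
  rlinear f -> llinear g -> bijective f -> bijective g -> bijective (tmap f g).
Proof.
move=> fP gP [f' fK Kf] [g' gK Kg].
have fP' := rlinear_can fK Kf fP; have gP' := llinear_can gK Kg gP.
by exists (tmap f' g'); exact: tmap_can.
Qed.

Lemma flat_l_inj (K : rmod R -> Prop) (N : lmod R) (M M' : rmod R) (f : rhom M M') :
  flat_on K N -> K M -> K M' -> injective f -> injective (tmap f (@idfun N)).
Proof.
move=> NF KM KM' fI; have fD := (rhomP f).1.
have tD : {morph tmap f (@idfun N) : x y / x + y} by exact: tmapD (rhomP f) (llinear_id N).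
apply: morph_inj => // x fx.
(* Injectivity is exactness at M when the incoming map is zero; taking M itself as the source keeps
   that source in the class K. *)
have ex : exact_at (0 : rhom M M) f.
  move=> y; split=> [fy|[z /= <-]]; last exact: morphD0.
  by exists 0; apply: fI; rewrite fy; exact: morphD0.
have [xE _] := NF _ _ _ _ _ KM KM KM' ex x.
have [y <-] := xE fx; elim/tens_ind: y => [|y z Ey Ez|m n].
- by rewrite morphD0 //; exact: tmapD (rhomP (0 : rhom M M)) (llinear_id N).
- by rewrite (tmapD (rhomP (0 : rhom M M)) (llinear_id N)) Ey Ez addr0.
rewrite (tmapE _ _ (rhomP (0 : rhom M M)) (llinear_id N)).
by apply: (@morphD0 M _ (fun _ => 0 ⊗ n)) => _ _; rewrite -tpureDl addr0.
Qed.
End TensorBijections.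

Lemma acc_l_balanced (R : rng) (N : lmod R) :
  balanced (fun (r : reg R) (n : N) => lmact r n).
Proof.
by split=> [x x' y|x y y'|x r y]; [exact: lmactDl|exact: lmactDr|rewrite lmactA].
Qed.
Lemma acc_lE (R : rng) (N : lmod R) (r : reg R) (n : N) : acc_l N (r ⊗ n) = lmact r n.
Proof. exact: tliftE (acc_l_balanced N). Qed.
Lemma acc_lD (R : rng) (N : lmod R) : {morph acc_l N : x y / x + y}.
Proof. exact: tliftD (acc_l_balanced N). Qed.

Lemma acc_r_bilinear (R S : rng) (N : bimod R S) :
  bilinear (acc_r N : tens_b N (reg S) -> N).
Proof.
split; last exact: acc_r_rlinear.
split=> [|r]; first exact: acc_rD.
apply: (@tens_ext S N (reg S)) => [x y|x y|n s].
- by rewrite (@lmactDr _ (tens_b N (reg S)) r x y) acc_rD.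
- by rewrite acc_rD lmactDr.
- by rewrite /= tens_lactE !acc_rE lactC.
Qed.

Lemma acc_l_bilinear (R S : rng) (M : bimod S R) :
  bilinear (acc_l M : tens_b (reg S) M -> M).
Proof.
split; split; try exact: acc_lD.
- move=> s; apply: (@tens_ext S (reg S) M) => [x y|x y|t m].
  + by rewrite (@lmactDr _ (tens_b (reg S) M) s x y) acc_lD.
  + by rewrite acc_lD lmactDr.
  + by rewrite /= tens_lactE !acc_lE lactA.
- move=> x r; move: x; apply: (@tens_ext S (reg S) M) => [x y|x y|s m].
  + by rewrite (@ractDl _ (tens_b (reg S) M) x y r) acc_lD.
  + by rewrite acc_lD ractDl.
  + by rewrite /= tens_ractE !acc_lE lactC.
Qed.

Section FirmTensor.
Variables R S : rng.

(** Up to associativity, the action map of M (x)_R N is M tensored with the action map of N. *)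
Lemma firm_tens_r (M : rmod R) (N : bimod R S) : firm_r N -> firm_r (tens_r M N).
Proof.
move=> NF.
have accP := acc_r_bilinear N.
have [g gK Kg] := tmap_bij (rlinear_id M) accP.1 (inv_bij (fun=> erefl)) NF.
have E : acc_r (tens_r M N) =1 tmap idfun (acc_r N : tens_b N (reg S) -> N) \o
   @tassoc _ _ _ M N (reg S).
  apply: tens3_ext => [x y|x y|m n s].
  - exact: acc_rD.
  - by rewrite /= tassocD (tmapD (rlinear_id M) accP.1).
  rewrite acc_rE /= tassocE (tmapE _ _ (rlinear_id M) accP.1) acc_rE.
  exact: tens_ractE.
exists (@tassocV _ _ _ M N (reg S) \o g) => x.
- by rewrite E /= gK tassocK.
- by rewrite E /= tassocVK Kg.
Qed.

Lemma firm_tens_l (T : rng) (M : bimod S R) (N : bimod R T) : firm_l M -> firm_l (tens_b M N).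
Proof.
move=> MF.
have accP := (acc_l_bilinear M).2.
have [g gK Kg] := tmap_bij accP (llinear_id N) MF (inv_bij (fun=> erefl)).
have E : acc_l (tens_b M N) =1 tmap (acc_l M : tens_b (reg S) M -> M) idfun \o
   @tassocV _ _ _ (reg S) M N.
  apply: tens3r_ext => [x y|x y|s m n].
  - exact: acc_lD.
  - by rewrite /= tassocVD (tmapD accP (llinear_id N)).
  rewrite acc_lE /= tassocVE3 (tmapE _ _ accP (llinear_id N)) acc_lE.
  exact: tens_lactE.
exists (@tassoc _ _ _ (reg S) M N \o g) => x.
- by rewrite E /= gK tassocVK.
- by rewrite E /= tassocK Kg.
Qed.
End FirmTensor.

Lemma firm_l_iso (R : rng) (M N : lmod R) (f : M -> N) :
  llinear f -> bijective f -> firm_l M -> firm_l N.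
Proof.
move=> fP [f' fK Kf] [g gK Kg].
have E : acc_l N =1 f \o acc_l M \o tmap idfun f'.
  have fP' := llinear_can fK Kf fP.
  apply: tens_ext => [x y|x y|r n]; first exact: acc_lD.
  - by rewrite /= tmapD // acc_lD fP.1.
  - by rewrite /= tmapE // !acc_lE fP.2 Kf.
apply: (eq_bij (f := f \o acc_l M \o tmap idfun f')) => [|x]; last by rewrite E.
apply: bij_comp; first by apply: bij_comp; [exists f'|exists g].
apply: tmap_bij => //; [exact: llinear_can fP|exact: inv_bij|by exists f].
Qed.

Lemma unital_firm_r (A : pzRingType) (M : rmod A) : unital_r M -> firm_r M.
Proof.
move=> MU; exists (fun m : M => @tpure A M (reg A) m (1 : A)); last by move=> m; rewrite acc_rE MU.
apply: tens_ext => [x y|//|m a]; first by rewrite acc_rD tpureDl.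
by rewrite acc_rE tpureM; congr (_ ⊗ _); exact: mulr1.
Qed.

Lemma unital_firm_l (A : pzRingType) (M : lmod A) : unital_l M -> firm_l M.
Proof.
move=> MU; exists (fun m : M => @tpure A (reg A) M (1 : A) m); last by move=> m; rewrite acc_lE MU.
apply: tens_ext => [x y|//|a m]; first by rewrite acc_lD tpureDr.
by rewrite acc_lE -tpureM; congr (_ ⊗ _); exact: mul1r.
Qed.

Lemma unital_tens_r (A : pzRingType) (R : rng) (M : rmod R) (N : bimod R A) :
  unital_r N -> unital_r (tens_r M N).
Proof.
move=> NU; apply: (@tens_ext R M N (tens_r M N)) => [x y|//|m n]; first exact: ractDl.
by rewrite /= tens_ractE NU.
Qed.

Lemma unital_tens_l (A : pzRingType) (R S : rng) (M : bimod A R) (N : bimod R S) :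
  unital_l M -> unital_l (tens_b M N).
Proof.
move=> MU; apply: (@tens_ext R M N (tens_b M N)) => [x y|//|m n].
  exact: (@lmactDr _ (tens_b M N)).
by rewrite /= tens_lactE; congr (_ ⊗ _); exact: MU.
Qed.

Fact ract_rlinear (R : rng) (M : rmod R) (m : M) : @rlinear R (reg R) M (fun r => ract m r).
Proof. by split=> [r s|r s]; [exact: ractDr|rewrite ractA]. Qed.
Definition ract_rhom (R : rng) (M : rmod R) (m : M) : rhom (reg R) M :=
  Rhom (ract_rlinear m).

Lemma rhom_comp_rlinear (R S : rng) (X : bimod R S) (M N : rmod S) (f : rhom M N) :
  @rlinear R (rhom_rmod X M) (rhom_rmod X N) (fun g : rhom X M => rhom_comp f g).
Proof. by split=> [g h|g r]; apply: rhom_ext => u //=; exact: (rhomP f).1. Qed.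

Lemma lhom_balanced (R : rng) (N : lmod R) (f : N -> reg R) (M : rmod R) :
  llinear f -> balanced (fun (u : M) (n : N) => ract u (f n)).
Proof.
move=> [fD fZ]; split=> [x y n|x m n|x r n]; first exact: ractDl.
- by rewrite fD ractDr.
- by rewrite fZ ractA.
Qed.

Lemma tmap_llinear (S R T T' : rng) (M M' : bimod S R) (N : bimod R T) (N' : bimod R T')
    (f : M -> M') (g : N -> N') :
  bilinear f -> @llinear R N N' g -> @llinear S (tens_b M N) (tens_b M' N') (tmap f g).
Proof.
move=> [fL fR] gP; split=> [|s]; first exact: tmapD.
apply: (@tens_ext R M N (tens_b M' N')) => [x y|x y|m n].
- by rewrite (@lmactDr _ (tens_b M N) s x y) tmapD.
- by rewrite tmapD // (@lmactDr _ (tens_b M' N')).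
- by rewrite /= tens_lactE !tmapE // tens_lactE fL.2.
Qed.

(** * Functors between firm modules and comodules *)

Section Coreflection.
Variable R : rng.
Implicit Types M P : rmod R.

Lemma firm_unaccK M : firm_r M -> cancel (acc_r M) (unacc_r M).
Proof.
move=> [g gK Kg] x; apply: (can_inj gK).
by apply: (@xgetPex _ 0 [set y | acc_r M y = acc_r M x]); exists x.
Qed.
Lemma firm_accK M : firm_r M -> cancel (unacc_r M) (acc_r M).
Proof. by move=> MF; have [g _ Kg] := MF; move=> x; rewrite -[x]Kg firm_unaccK. Qed.
Lemma unacc_rlinear M : firm_r M -> @rlinear R M (tens_r M (reg R)) (unacc_r M).
Proof.
move=> MF.
exact: (@rlinear_can R (tens_r M (reg R)) M _ _ (firm_unaccK MF) (firm_accK MF)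
  (acc_r_rlinear M)).
Qed.
Lemma unacc_ract M (m : M) (r : R) : firm_r M -> unacc_r M (ract m r) = m ⊗ (r : reg R).
Proof. by move=> MF; rewrite -acc_rE firm_unaccK. Qed.

(** Substitute for writing m = m 1: the action map M (x)_R R -> M is onto, so products span M. *)
Lemma firm_ract_ind M (Q : M -> Prop) : firm_r M ->
  Q 0 -> (forall x y, Q x -> Q y -> Q (x + y)) -> (forall m r, Q (ract m r)) ->
  forall m, Q m.
Proof.
move=> MF Q0 QD Qr m; rewrite -(firm_accK MF m).
elim/tens_ind: (unacc_r M m) => [|x y Qx Qy|n r]; last by rewrite acc_rE.
- by rewrite (morphD0 (@acc_rD _ _)).
- by rewrite acc_rD; exact: QD.
Qed.

Lemma firm_ext M (U : zmodType) (f g : M -> U) : firm_r M ->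
  {morph f : x y / x + y} -> {morph g : x y / x + y} ->
  (forall m r, f (ract m r) = g (ract m r)) -> f =1 g.
Proof.
move=> MF fD gD fg; apply: firm_ract_ind => // [|x y fx fy]; first by rewrite !morphD0.
by rewrite fD gD fx fy.
Qed.

Lemma acc_r_natural (M P : rmod R) (f : M -> P) x : rlinear f ->
  acc_r P (tmap f idfun x) = f (acc_r M x).
Proof.
move=> fP; move: x; apply: tens_ext => [x y|x y|n r].
- by rewrite tmapD // acc_rD.
- by rewrite acc_rD fP.1.
- by rewrite tmapE // !acc_rE fP.2.
Qed.

(* - (x)_R R is right adjoint to the inclusion of firm modules. *)
Definition corefl (M P : rmod R) (g : M -> P) (m : M) : tens P (reg R) :=
  tmap g idfun (unacc_r M m).

Lemma corefl_rlinear M P (g : M -> P) : firm_r M -> rlinear g ->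
  @rlinear R M (tens_r P (reg R)) (corefl g).
Proof.
move=> MF gP; apply: (rlinear_comp (M := M) (N := tens_r M (reg R)) _ (unacc_rlinear MF)).
exact: tmap_rlinear.
Qed.
Lemma corefl_ract M P (g : M -> P) m r : firm_r M -> rlinear g ->
  corefl g (ract m r) = g m ⊗ (r : reg R).
Proof. by move=> MF gP; rewrite /corefl unacc_ract // tmapE. Qed.
Lemma acc_corefl M P (g : M -> P) m : firm_r M -> rlinear g ->
  acc_r P (corefl g m) = g m.
Proof. by move=> MF gP; rewrite /corefl acc_r_natural // firm_accK. Qed.
Lemma corefl_acc M P (k : M -> tens_r P (reg R)) m : firm_r M -> rlinear k ->
  corefl (acc_r P \o k) m = k m.
Proof.
move=> MF kP; have aP := acc_r_rlinear P; have akP := rlinear_comp aP kP.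
move: m; apply: firm_ext => // [||m r].
- exact: (corefl_rlinear MF akP).1.
- exact: kP.1.
rewrite (corefl_ract _ _ MF akP) kP.2 -[LHS]/(acc_r P (k m) ⊗ _).
(* For x in P (x)_R R, the tensor of the image of x in P with r is x r, because (p s) (x) r = p (x)
   (s r). *)
elim/tens_ind: (k m : tens P (reg R)) => [|x y Ex Ey|p s].
- rewrite (morphD0 aP.1); transitivity (0 : tens P (reg R)); last first.
    by symmetry; exact: (@ract0 _ (tens_r P (reg R))).
  by apply: (@morphD0 P _ (fun x => x ⊗ (r : reg R))) => x y; rewrite tpureDl.
- by rewrite (acc_rD x y) tpureDl Ex Ey (@ractDl _ (tens_r P (reg R))).
- by rewrite acc_rE tpureM /= tens_ractE.
Qed.
End Coreflection.

Lemma firm_lmact_ext (R : rng) (N : lmod R) (U : zmodType) (f g : N -> U) : firm_l N ->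
  {morph f : x y / x + y} -> {morph g : x y / x + y} ->
  (forall r n, f (lmact r n) = g (lmact r n)) -> f =1 g.
Proof.
move=> [h hK Kh] fD gD fg n; rewrite -(Kh n); move: (h n).
apply: (@tens_ext _ _ _ _ (f \o acc_l N) (g \o acc_l N)) => [x y|x y|r m] /=.
- by rewrite acc_lD fD.
- by rewrite acc_lD gD.
- by rewrite acc_lE.
Qed.

(** * Tensor-Hom adjunction for a comodule with a left action *)

Section TensHom.
Variables (A : pzRingType) (C : coring A) (R : rng) (X : bicomodule C R).

Fact tpure_colinear (M : rmod R) (m : M) :
  @colinear A C X (tens_comod X M) (Rhom (tpure_rlinear X m)).
Proof. by move=> u; rewrite /= tens_coactE. Qed.
Definition tpure_chom (M : rmod R) (m : M) : chom X (tens_comod X M) :=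
  Chom (tpure_colinear m).

Fact tens_chom_cur_rlinear (M : rmod R) (Y : comodule C) (f : chom (tens_comod X M) Y) :
  @rlinear R M (chom_rmod X Y) (fun m => chom_comp f (tpure_chom m)).
Proof.
split=> [x y|x r]; apply: chom_ext => u /=.
- by rewrite tpureDl (rhomP f).1.
- by rewrite tpureM.
Qed.
Definition tens_chom_cur (M : rmod R) (Y : comodule C) (f : chom (tens_comod X M) Y) :
  rhom M (chom_rmod X Y) := Rhom (tens_chom_cur_rlinear f).

Section Lift.
Variables (M : rmod R) (Y : comodule C) (g : rhom M (chom_rmod X Y)).
Let gE (m : M) : chom X Y := g m.
Fact tens_chom_lift_balanced : balanced (fun (m : M) (u : X) => gE m u).
Proof.
rewrite /gE; have [gD gZ] := rhomP g; split=> [m m' u|m u u'|m r u].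
- by rewrite gD.
- exact: (rhomP (g m : chom X Y)).1.
- by rewrite gZ.
Qed.
Let bal := tens_chom_lift_balanced.
Fact tens_chom_lift_rlinear :
  @rlinear A (tens_comod X M) Y (tlift (fun (m : M) (u : X) => gE m u)).
Proof.
split=> [|x a]; first exact: tliftD.
move: x; apply: (@tens_ext R M X Y) => [x y|x y|m u].
- by rewrite (@ractDl _ (tens_r M X)) (tliftD bal).
- by rewrite (tliftD bal) ractDl.
- by rewrite /= tens_ractE !(tliftE _ _ bal) (rhomP (gE m)).2.
Qed.
Fact tens_chom_lift_colinear : colinear (Rhom tens_chom_lift_rlinear).
Proof.
have lP := tens_chom_lift_rlinear.
apply: (@tens_ext R M X) => [x y|x y|m u].
- by rewrite (rhomP _).1 (coact_rlinear Y).1.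
- by rewrite (coact_rlinear (tens_comod X M)).1 tmapD.
rewrite /= (tliftE _ _ bal) tens_coactE /tens_coact_pure.
rewrite tmap_comp //; last exact: tpure_rlinear.
rewrite chom_colinear; apply: tlift_eq => v c /=.
by rewrite (tliftE _ _ bal).
Qed.
Definition tens_chom_lift : chom (tens_comod X M) Y := Chom tens_chom_lift_colinear.
Lemma tens_chom_liftE (m : M) (u : X) : tens_chom_lift (m ⊗ u) = (g m : chom X Y) u.
Proof. exact: (tliftE _ _ bal). Qed.
End Lift.

Lemma tens_chom_ext (M : rmod R) (Y : comodule C) (f g : chom (tens_comod X M) Y) :
  (forall (m : M) (u : X), f (m ⊗ u) = g (m ⊗ u)) -> f = g.
Proof.
move=> fg; apply: chom_ext; apply: (@tens_ext R M X Y) => //.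
- exact: (rhomP f).1.
- exact: (rhomP g).1.
Qed.
End TensHom.

Section TensHomAdjunction.
Variables (A : pzRingType) (C : coring A) (R : firm_rng) (X : bicomodule C R).

Definition tens_hom_transpose (M : firm_rmod R) (Y : comodule C)
    (f : chom (tens_comod X M) Y) : rhom M (hom_firm X Y) :=
  Rhom (corefl_rlinear (fm_firm M) (rhomP (tens_chom_cur f))).

(** Composite of two adjunctions: currying into Hom^C(X, Y), which need not be firm, and then the
    coreflection onto Hom^C(X, Y) (x)_R R. *)
Definition tens_hom_adj : adjunction (tens_functor X) (hom_functor X).
Proof.
refine (@Adjunction _ _ (tens_functor X) (hom_functor X) tens_hom_transpose _ _ _).
- move=> M Y; have MF := fm_firm M.
  have aP := acc_r_rlinear (chom_rmod X Y).
  pose back (h : rhom M (hom_firm X Y)) : chom (tens_comod X M) Y :=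
    tens_chom_lift (Rhom (rlinear_comp aP (rhomP h))).
  exists back => [f|h].
  + apply: tens_chom_ext => m u; rewrite tens_chom_liftE /=.
    by rewrite (acc_corefl _ MF (rhomP (tens_chom_cur f))).
  + apply: rhom_ext => m /=.
    rewrite -[RHS](corefl_acc _ MF (rhomP h)); apply: tlift_eq => n r.
    by congr (_ ⊗ _); apply: chom_ext => u; exact: tens_chom_liftE.
- move=> M M' Y h f; have MF := fm_firm M; have MF' := fm_firm M'.
  have cP := rhomP (tens_chom_cur f).
  have cP' := rhomP (tens_chom_cur (chom_comp f (tens_chom X h))).
  apply: rhom_ext; apply: firm_ext => // [||m r].
  + exact: (corefl_rlinear MF' cP').1.
  + exact: (rlinear_comp (corefl_rlinear MF cP) (rhomP h)).1.
  rewrite /= corefl_ract // (rhomP h).2 corefl_ract //; congr (_ ⊗ _).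
  by apply: chom_ext => u /=; rewrite tmapE //; exact: rhomP.
- move=> M Y Y' k f; have MF := fm_firm M.
  have cP := rhomP (tens_chom_cur f).
  have cP' := rhomP (tens_chom_cur (chom_comp k f)).
  apply: rhom_ext; apply: firm_ext => // [||m r].
  + exact: (corefl_rlinear MF cP').1.
  + exact: (rlinear_comp (hom_map_rlinear X k) (corefl_rlinear MF cP)).1.
  rewrite /= !corefl_ract // tmapE //; last exact: hom_map_rlinear0.
  by congr (_ ⊗ _); apply: chom_ext.
Defined.
End TensHomAdjunction.

(** * Reconstruction of an adjoint pair from F(R) *)

Section FunctorsOfAnAdjunction.
Variables (R : firm_rng) (A : pzRingType) (C : coring A).
Variables (F : functor (firm_cat R) (comod_cat C)) (G : functor (comod_cat C) (firm_cat R)).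
Variable adj : adjunction F G.
Notation X := (FR adj).
Notation T := (@transposec R A C F G adj _ _).

(** Every h : M -> G Y is the transpose of E o F(h), where E is the counit, and E o F(h) is additive
    in h because the left adjoint F is additive. *)
Fact transposecD (M : firm_rmod R) (Y : comodule C) (f g : chom (F M) Y) :
  T (f + g) = T f + T g.
Proof.
have [e _ Ke] := @transpose_bij _ _ F G adj (G Y) Y.
pose E : chom (F (G Y)) Y := e (rhom_id (G Y)).
have EK (h : rhom M (G Y)) : T (chom_comp E (fmapc F h)) = h.
  by rewrite transposec_nat [transposec adj E](Ke _); apply: rhom_ext.
apply: esym; rewrite -[LHS]EK; congr transposec; apply: chom_ext => u /=.
rewrite (left_adjointD adj) (rhomP E).1.
by congr (_ + _); rewrite -[_ (fmapc F _ u)]/(chom_comp E (fmapc F _) u);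
  congr (rhom_fun (chom_rhom _) _); apply: transposec_inj; exact: EK.
Qed.

Definition act_rhom (P : rmod R) (p : P) : rhom (reg_firm R) P := ract_rhom p.

Section Object.
Variable Y : comodule C.

Fact hom_to_G_balanced :
  balanced (fun (f : chom_rmod X Y) (r : reg R) => T (f : chom (F (reg_firm R)) Y) r : G Y).
Proof.
split=> [f g r|f r s|f s r].
- by rewrite transposecD.
- exact: (rhomP (T _)).1.
- by rewrite [LHS](congr1 (fun h : rhom (reg_firm R) (G Y) => h r)
    (transposec_nat adj (lmul s) (f : chom (F (reg_firm R)) Y))).
Qed.
Fact hom_to_G_rlinear : @rlinear R (hom_firm X Y) (G Y)
  (tlift (fun (f : chom_rmod X Y) (r : reg R) => T (f : chom (F (reg_firm R)) Y) r : G Y)).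
Proof.
have bal := hom_to_G_balanced.
split=> [|x s]; first exact: tliftD.
move: x; apply: (@tens_ext R (chom_rmod X Y) (reg R) (G Y)) => [x y|x y|f r].
- by rewrite (@ractDl _ (hom_firm X Y)) (tliftD bal).
- by rewrite (tliftD bal) ractDl.
- by rewrite /= tens_ractE !(tliftE _ _ bal) (rhomP (T _)).2.
Qed.
Definition hom_to_G : rhom (hom_firm X Y) (G Y) := Rhom hom_to_G_rlinear.
Lemma hom_to_GE (f : chom_rmod X Y) (r : reg R) :
  hom_to_G (f ⊗ r : tens (chom_rmod X Y) (reg R)) = T (f : chom (F (reg_firm R)) Y) r.
Proof. exact: (tliftE _ _ hom_to_G_balanced). Qed.

(** Transposition identifies Hom^C(X, Y) with Hom_R(R, G Y). The inverse starts from the map [b]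
    that sends y to the colinear map with transpose r |-> y r; as G Y is firm, [b] lifts to a map G
    Y -> Hom^C(X, Y) (x)_R R. *)
Lemma hom_to_G_bij : bijective hom_to_G.
Proof.
have [e eK Ke] := @transpose_bij _ _ F G adj (reg_firm R) Y.
have inj := @transposec_inj R A C F G adj (reg_firm R) Y.
pose b (y : G Y) : chom_rmod X Y := e (act_rhom y).
have bE y : T (b y : chom (F (reg_firm R)) Y) = act_rhom y by exact: Ke.
have bP : rlinear b.
  split=> [x y|x r]; apply: inj.
  - by rewrite transposecD !bE; apply: rhom_ext => r /=; rewrite ractDl.
  - rewrite bE [RHS](transposec_nat adj (lmul r) (b x : chom (F (reg_firm R)) Y)) bE.
    by apply: rhom_ext => s /=; rewrite ractA.
have GF := fm_firm (G Y).
have cP := corefl_rlinear GF bP.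
have cgD := (rlinear_comp cP (rhomP hom_to_G)).1.
exists (corefl b).
- apply: (@tens_ext R (chom_rmod X Y) (reg R) (tens (chom_rmod X Y) (reg R))) => [||f r] //.
  move: r; apply: (firm_ext (M := reg R)) => [||r s|r s].
  + exact: fr_firm.
  + move=> r s; rewrite (@tpureDr R (chom_rmod X Y) (reg R) f r s).
    exact: cgD.
  + by rewrite (@tpureDr R (chom_rmod X Y) (reg R) f r s).
  rewrite hom_to_GE (rhomP (T _)).2 (corefl_ract _ _ GF bP).
  (* Both maps X -> Y have the transpose t |-> T(f)(r t). *)
  have -> : b (T (f : chom (F (reg_firm R)) Y) r) = ract (f : chom_rmod X Y) r.
    apply: inj; rewrite bE.
    rewrite [RHS](transposec_nat adj (lmul r) (f : chom (F (reg_firm R)) Y)).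
    by apply: rhom_ext => t; exact: esym ((rhomP (T _)).2 _ _).
  exact: tpureM.
- apply: (firm_ext GF) => [x y|//|y r].
    by rewrite cP.1 (rhomP hom_to_G).1.
  by rewrite (corefl_ract _ _ GF bP) hom_to_GE bE.
Qed.
End Object.

Lemma right_adjoint_iso_hom : nat_iso (hom_functor X) G.
Proof.
exists (fun Y => hom_to_G Y : @hom (firm_cat R) (hom_firm X Y) (G Y)).
split=> [Y Z k|Y]; last by apply: firm_is_iso; exact: hom_to_G_bij.
apply: rhom_ext; apply: (@tens_ext R (chom_rmod X Y) (reg R)) => [||f r].
- exact: (rlinear_comp (rhomP (hom_to_G Z)) (hom_map_rlinear X k)).1.
- exact: (rlinear_comp (rhomP (fmap G k : rhom (G Y) (G Z))) (rhomP (hom_to_G Y))).1.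
transitivity (hom_to_G Z ((chom_comp k f : chom_rmod X Z) ⊗ r)).
  congr (hom_to_G Z _); apply: tmapE => //; exact: hom_map_rlinear0.
transitivity ((fmap G k : rhom (G Y) (G Z)) (hom_to_G Y (f ⊗ r))) => //.
rewrite !hom_to_GE.
exact: (congr1 (fun h : rhom (reg_firm R) (G Z) => h r)
  (@transpose_natr _ _ F G adj (reg_firm R) Y Z k (f : chom (F (reg_firm R)) Y))).
Qed.

Lemma left_adjoint_iso_tens : nat_iso (tens_functor X) F.
Proof.
have [adj'] := adjunction_iso_r right_adjoint_iso_hom (tens_hom_adj X).
exact: left_adjoint_unique adj' adj.
Qed.

(** X = F(R) is isomorphic to R (x)_R X, left R-linearly by naturality with respect to the left
    multiplications R -> R, and R (x)_R X is firm because R is. *)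
Lemma FR_firm : firm_l X.
Proof.
have [a [aN aI]] := left_adjoint_iso_tens.
pose f : chom (tens_comod X (reg R)) (F (reg_firm R)) := a (reg_firm R).
(* The left and right action maps of the regular bimodule coincide, so [fr_firm] also serves as left
   firmness of R. *)
apply: (@firm_l_iso R (tens_b (reg R) X) X f); last by apply: firm_tens_l; exact: fr_firm.
- split; first exact: (rhomP f).1.
  move=> r x.
  have := congr1 (fun h : chom (tens_comod X (reg R)) (F (reg_firm R)) => h x)
    (aN _ _ (lmul r : @hom (firm_cat R) (reg_firm R) (reg_firm R))).
  rewrite /=; congr (f _ = _); apply: tlift_eq => s u; exact: tens_lactE.
- exact: comod_iso_bij (aI (reg_firm R)).
Qed.
End FunctorsOfAnAdjunction.

(** * Cofree comodules *)

Section Cofree.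
Variables (A : pzRingType) (C : coring A).
Let CP := coringP C.
Let dB := cdelta_bilinear CP.
Let eB := ceps_bilinear CP.

Lemma counit_balanced (M : rmod A) : balanced (fun (m : M) (c : C) => ract m (ceps c)).
Proof.
split=> [y y' c|y c c'|y a c]; first exact: ractDl.
- by rewrite eB.1.1 ractDr.
- by rewrite eB.1.2 ractA.
Qed.
Definition counit_at (M : rmod A) : tens_r M C -> M :=
  tlift (fun (m : M) (c : C) => ract m (ceps c)).
Lemma counit_atE (M : rmod A) (m : M) (c : C) :
  counit_at (m ⊗ c : tens_r M C) = ract m (ceps c).
Proof. exact: (tliftE _ _ (counit_balanced M)). Qed.
Lemma counit_atD (M : rmod A) : {morph @counit_at M : x y / x + y}.
Proof. exact: tliftD (counit_balanced M). Qed.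
Lemma counit_at_rlinear (M : rmod A) : rlinear (@counit_at M).
Proof.
split=> [|x a]; first exact: counit_atD.
move: x; apply: (@tens_ext A M C M) => [x y|x y|m c].
- by rewrite (@ractDl _ (tens_r M C)) counit_atD.
- by rewrite counit_atD ractDl.
- by rewrite /= tens_ractE !counit_atE eB.2.2 ractA.
Qed.
Lemma counit_at_natural (M N : rmod A) (f : M -> N) (x : tens_r M C) : rlinear f ->
  counit_at (tmap f (@idfun C) x) = f (counit_at x).
Proof.
move=> fP; move: x; apply: (@tens_ext A M C N) => [x y|x y|m c].
- by rewrite tmapD // (counit_at_rlinear N).1.
- by rewrite (counit_at_rlinear M).1 fP.1.
- by rewrite tmapE // !counit_atE fP.2.
Qed.

Section Object.
Variables (M : rmod A).

Definition cofree_coact (x : tens_r M C) : tens_r (tens_r M C) C :=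
  tassocV (tmap (@idfun M) (cdelta : C -> tens_b C C) x : tens M (tens_b C C)).

Lemma cofree_unital : unital_r (tens_r M C).
Proof. by apply: unital_tens_r; exact: (coring_unital_r CP). Qed.

Lemma cofree_coact_rlinear : @rlinear A (tens_r M C) (tens_r (tens_r M C) C) cofree_coact.
Proof.
apply: (rlinear_comp (M := tens_r M C) (N := tens_r M (tens_b C C)) (tassocV_rlinear M C C)).
exact: tmap_rlinear (rlinear_id M) dB.
Qed.
Lemma cofree_coactE m (c : C) :
  cofree_coact (m ⊗ c) = tmap (fun d : C => m ⊗ d : tens_r M C) (@idfun C) (cdelta c).
Proof. by rewrite /cofree_coact (tmapE _ _ (rlinear_id M) dB.1) tassocVE. Qed.

Lemma cofree_coassoc x :
  tassoc (tmap cofree_coact idfun (cofree_coact x)) = tmap idfun cdelta (cofree_coact x).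
Proof.
have cP := cofree_coact_rlinear; have [dL dR] := dB.
move: x; apply: (@tens_ext A M C) => [x y|x y|m c].
- by rewrite cP.1 (tmapD cP) // tassocD.
- by rewrite cP.1 tmapD.
have pP := tpure_rlinear_bimod C m.
rewrite cofree_coactE !tmap_comp //=.
have -> : tmap (idfun \o (fun d : C => m ⊗ d : tens_r M C)) (cdelta \o idfun) (cdelta c)
  = tmap (fun d : C => m ⊗ d : tens_r M C) (idfun : tens_b C C -> tens_b C C)
      (tmap (idfun : C -> C) cdelta (cdelta c)).
  by rewrite tmap_comp.
rewrite -(cdelta_coassoc CP).
have -> : tmap (cofree_coact \o (fun d : C => m ⊗ d : tens_r M C)) (idfun \o idfun) (cdelta c)
  = tmap (tmap (fun d : C => m ⊗ d : tens_r M C) (@idfun C) : tens_r C C -> tens_r (tens_r M C) C) (@idfun C)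
      (tmap cdelta (@idfun C) (cdelta c)).
  rewrite tmap_comp //; last exact: tmap_rlinear.
  by apply: tlift_eq => d e /=; rewrite cofree_coactE.
move: (tmap cdelta idfun (cdelta c)) => {c}.
have pP' : @rlinear A (tens_r C C) (tens_r (tens_r M C) C)
    (tmap (fun d : C => m ⊗ d : tens_r M C) (@idfun C)) by exact: tmap_rlinear.
apply: tens3_ext => [x y|x y|c d e].
- by rewrite tmapD // tassocD.
- by rewrite tassocD tmapD.
by rewrite (tmapE _ _ pP') // tmapE // !tassocE tmapE.
Qed.

Lemma cofree_counit x :
  tlift (fun (y : tens_r M C) (c : C) => ract y (ceps c)) (cofree_coact x) = x.
Proof.
move: x; apply: (@tens_ext A M C) => [x y|//|m c].
- exact: (rlinear_comp (counit_at_rlinear (tens_r M C)) cofree_coact_rlinear).1.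
rewrite cofree_coactE [LHS](counit_at_natural (cdelta c) (tpure_rlinear_bimod C m)).
by congr (_ ⊗ _); exact: (cdelta_counitr CP).
Qed.
Definition cofree : comodule C :=
  @Comodule A C (tens_r M C) cofree_unital cofree_coact cofree_coact_rlinear
    cofree_coassoc cofree_counit.
End Object.

(** This rests on the left counit law of C, whereas [cofree_counit] rests on the right one. It makes
    a colinear map into a cofree comodule recoverable from its composite with the counit. *)
Lemma counit_cofree (M : rmod A) (x : cofree M) :
  tmap (@counit_at M) (@idfun C) (coact x) = x.
Proof.
have kP := counit_at_rlinear M.
move: x; apply: (@tens_ext A M C) => [x y|//|m c].
- by rewrite (coact_rlinear (cofree M)).1 tmapD.
rewrite /= cofree_coactE tmap_comp //; last exact: tpure_rlinear_bimod.
have kb : balanced (fun c1 c2 : C => lact (ceps c1) c2).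
  split=> [x x' y|x y y'|x a y]; rewrite ?eB.1.1 ?lactDl ?lactDr //.
  by rewrite eB.2.2 [RHS]lactA.
rewrite -[in RHS](cdelta_counitl CP c).
move: (cdelta c); apply: (@tens_ext A C C) => [x y|x y|d e].
- by rewrite tmapD //; apply: rlinear_comp => //; exact: tpure_rlinear_bimod.
- by rewrite (tliftD kb) tpureDr.
rewrite tmapE //; last by apply: rlinear_comp => //; exact: tpure_rlinear_bimod.
by rewrite (tliftE _ _ kb) /= counit_atE tpureM.
Qed.

Section Adjunction.
Variables (Y : comodule C) (M : rmod A).

Fact cofree_lift_rlinear (f : rhom Y M) :
  @rlinear A Y (cofree M) (fun y => tmap f idfun (coact y)).
Proof.
apply: (rlinear_comp (M := Y) (N := tens_r Y C)); last exact: coact_rlinear.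
by apply: tmap_rlinear => //; exact: rhomP.
Qed.
Fact cofree_lift_colinear (f : rhom Y M) : colinear (Rhom (cofree_lift_rlinear f)).
Proof.
have fP := rhomP f; have lP := cofree_lift_rlinear f.
have [dL dR] := dB.
move=> y; rewrite /= /cofree_coact tmap_comp //.
have -> : tmap (idfun \o f) (cdelta \o idfun) (coact y)
  = tmap f (@idfun (tens_b C C)) (tmap (@idfun Y) (cdelta : C -> tens_b C C) (coact y)).
  by rewrite tmap_comp.
rewrite -coact_coassoc.
have -> : tmap (fun y : Y => tmap f (@idfun C) (coact y) : cofree M) (@idfun C) (coact y)
  = tmap (tmap f (@idfun C) : tens_r Y C -> tens_r M C) (@idfun C)
      (tmap coact (@idfun C) (coact y)).
  rewrite tmap_comp //; first exact: (coact_rlinear Y).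
  exact: tmap_rlinear.
have fP' : @rlinear A (tens_r Y C) (tens_r M C) (tmap f (@idfun C)).
  exact: tmap_rlinear.
move: (tmap coact idfun (coact y)) => {y}.
apply: tens3_ext => [x y|x y|n c d].
- by rewrite tassocD tmapD // tassocVD.
- by rewrite tmapD.
by rewrite tassocE tmapE // tassocVE3 (tmapE _ _ fP') // tmapE.
Qed.
Definition cofree_lift (f : rhom Y M) : chom Y (cofree M) := Chom (cofree_lift_colinear f).

Lemma cofree_liftE (f : rhom Y M) y : cofree_lift f y = tmap f idfun (coact y).
Proof. by []. Qed.

Definition cofree_counit_comp (g : chom Y (cofree M)) : rhom Y M :=
  Rhom (rlinear_comp (counit_at_rlinear M) (rhomP g)).

Lemma cofree_liftK : cancel cofree_lift cofree_counit_comp.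
Proof.
move=> f; apply: rhom_ext => y /=.
rewrite (counit_at_natural _ (rhomP f)); congr (f _); exact: coact_counit.
Qed.
Lemma cofree_counit_compK : cancel cofree_counit_comp cofree_lift.
Proof.
move=> g; apply: chom_ext => y; rewrite cofree_liftE /=.
rewrite -[RHS](counit_cofree (g y)) (chom_colinear g) tmap_comp //; first exact: rhomP.
exact: counit_at_rlinear.
Qed.
End Adjunction.

Section Map.
Variables (M N : rmod A) (f : rhom M N).
Fact cofree_map_rlinear : @rlinear A (cofree M) (cofree N) (tmap f (@idfun C)).
Proof. by apply: tmap_rlinear => //; exact: rhomP. Qed.
Fact cofree_map_colinear : colinear (Rhom cofree_map_rlinear).
Proof.
have fP := rhomP f; have cP := cofree_map_rlinear.
apply: (@tens_ext A M C) => [x y|x y|m c].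
- by rewrite (rhomP _).1 (coact_rlinear (cofree N)).1.
- by rewrite (coact_rlinear (cofree M)).1 tmapD.
rewrite /= tmapE // !cofree_coactE tmap_comp //; last exact: tpure_rlinear_bimod.
by apply: tlift_eq => d e /=; rewrite tmapE.
Qed.
Definition cofree_map : chom (cofree M) (cofree N) := Chom cofree_map_colinear.
End Map.

Lemma coact_inj (Y : comodule C) : injective (@coact A C Y).
Proof. by move=> x y /(congr1 (@counit_at Y)); rewrite /counit_at !coact_counit. Qed.
End Cofree.

(** * Right adjoints of the Hom functor *)

Section TensorDual.
Variables (A : pzRingType) (R : rng) (X : bimod R A) (M : rmod A).
Notation XM := (rhom_rmod X M).

Definition rhom_scale (m : M) (phi : dual X) : XM := rhom_comp (ract_rhom m) phi.
Fact rhom_scale_rlinear m : @rlinear R (dual X) XM (rhom_scale m).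
Proof. exact: (@rhom_comp_rlinear R A X (reg A) M (ract_rhom m)). Qed.
Let sP := rhom_scale_rlinear.

(** Firm analogue of the map from M (x)_A X^dual to Hom_A(X, M) that is bijective for finitely
    generated projective X. It is inverted twice: from a right adjoint of the Hom functor, and from
    dual bases. *)
Definition tens_dual (x : tens M (firm_dual X)) : tens XM (reg R) :=
  tlift (fun (m : M) (y : firm_dual X) => tmap (rhom_scale m) (@idfun (reg R)) y) x.
Fact tens_dual_balanced :
  balanced (fun (m : M) (y : firm_dual X) => tmap (rhom_scale m) (@idfun (reg R)) y).
Proof.
split=> [m m' y|m y y'|m a y].
- apply: tlift_add => phi r; rewrite -tpureDl; congr (_ ⊗ _).
  by apply: rhom_ext => u /=; rewrite ractDl.
- by rewrite tmapD.
- move: y; apply: (@tens_ext R (dual X) (reg R)) => [x y|x y|phi r].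
  + by rewrite tmapD.
  + by rewrite lmactDr tmapD.
  + rewrite /= tens_lactE !tmapE //; congr (_ ⊗ _).
    by apply: rhom_ext => u /=; rewrite ractA.
Qed.
Lemma tens_dualD : {morph tens_dual : x y / x + y}.
Proof. exact: tliftD tens_dual_balanced. Qed.
Lemma tens_dualE (m : M) (phi : dual X) (r : reg R) :
  tens_dual (m ⊗ (phi ⊗ r : firm_dual X)) = rhom_scale m phi ⊗ r.
Proof. by rewrite /tens_dual (tliftE _ _ tens_dual_balanced) tmapE. Qed.
Lemma tens_dual_rlinear :
  @rlinear R (tens_r M (firm_dual X)) (tens_r XM (reg R)) tens_dual.
Proof.
split=> [|x r]; first exact: tens_dualD.
move: x; apply: (@tens3r_ext A R R M (dual X) (reg R) (tens_r XM (reg R))) => [x y|x y|m phi s].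
- by rewrite (@ractDl _ (tens_r M (firm_dual X))) tens_dualD.
- by rewrite tens_dualD ractDl.
have -> : @ract R (tens_r M (firm_dual X)) (m ⊗ (phi ⊗ s : firm_dual X)) r
    = m ⊗ (phi ⊗ (ract s r) : firm_dual X).
  by rewrite /= tens_ractE; congr (_ ⊗ _); exact: tens_ractE.
by rewrite !tens_dualE [RHS]tens_ractE.
Qed.
End TensorDual.

Lemma tens_dual_llinear (A : pzRingType) (R : rng) (X : bimod R A) :
  @llinear R (tens_b X (firm_dual X)) (tens_b (rhom_bimod X X) (reg R))
    (@tens_dual A R X X).
Proof.
split=> [|r x]; first exact: tens_dualD.
move: x; apply: (@tens3r_ext A R R X (dual X) (reg R) (tens_b (rhom_bimod X X) (reg R))) => [x y|x y|u phi s].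
- by rewrite (@lmactDr _ (tens_b X (firm_dual X))) tens_dualD.
- by rewrite tens_dualD (@lmactDr _ (tens_b (rhom_bimod X X) (reg R))).
have -> : @lmact R (tens_b X (firm_dual X)) r (u ⊗ (phi ⊗ s : firm_dual X))
    = lact r u ⊗ (phi ⊗ s : firm_dual X) by exact: tens_lactE.
rewrite !tens_dualE [RHS]tens_lactE; congr (_ ⊗ _).
by apply: rhom_ext => v /=; rewrite -lactC.
Qed.

Section RightAdjointOfHom.
Variables (A : pzRingType) (C : coring A) (R : firm_rng) (X : bicomodule C R).
Variables (H : functor (firm_cat R) (comod_cat C)).
Variable adj : adjunction (hom_functor X) H.

Definition hmap (Y Z : comodule C) (k : chom Y Z) : rhom (hom_firm X Y) (hom_firm X Z) :=
  Rhom (hom_map_rlinear X k).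
Definition htr (Y : comodule C) (N : firm_rmod R) (f : rhom (hom_firm X Y) N) :
  chom Y (H N) := @transpose _ _ (hom_functor X) H adj Y N f.

Lemma htr_bij (Y : comodule C) (N : firm_rmod R) : bijective (@htr Y N).
Proof. exact: (@transpose_bij _ _ (hom_functor X) H adj Y N). Qed.
Lemma htr_natl (Y Z : comodule C) (N : firm_rmod R) (k : chom Y Z)
    (f : rhom (hom_firm X Z) N) :
  htr (rhom_comp f (hmap k)) = chom_comp (htr f) k.
Proof. exact: (@transpose_natl _ _ (hom_functor X) H adj Z Y N k f). Qed.
Lemma htr_natr (Y : comodule C) (N P : firm_rmod R) (k : rhom N P)
    (f : rhom (hom_firm X Y) N) :
  htr (rhom_comp k f) = chom_comp (fmap H k : chom (H N) (H P)) (htr f).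
Proof. exact: (@transpose_natr _ _ (hom_functor X) H adj Y N P k f). Qed.

Lemma hmapD (Y Z : comodule C) (k l : chom Y Z) : hmap (k + l) = hmap k + hmap l.
Proof.
apply: rhom_ext => x; apply: tlift_add => f r; rewrite -tpureDl.
by congr (_ ⊗ _); apply: chom_ext.
Qed.

(** The Hom functor is additive, and every f is the counit [e] composed with the image of [htr f]
    under that functor. *)
Lemma htrD (Y : comodule C) (N : firm_rmod R) (f g : rhom (hom_firm X Y) N) :
  htr (f + g) = htr f + htr g.
Proof.
have [e0 _ Ke] := htr_bij (H N) N; pose e := e0 (chom_id (H N)).
have eE : htr e = chom_id (H N) by exact: Ke.
have eK (k : chom Y (H N)) : htr (rhom_comp e (hmap k)) = k.
  by rewrite htr_natl eE; apply: chom_ext.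
have inj := bij_inj (htr_bij Y N).
have fE (h : rhom (hom_firm X Y) N) : h = rhom_comp e (hmap (htr h)).
  by apply: inj; rewrite eK.
rewrite -[RHS]eK; congr htr; apply: rhom_ext => x.
by rewrite hmapD /= (rhomP e).1 {1}(fE f) {1}(fE g).
Qed.

(* Hom_A(X, P) (x)_R R is the value of hom_functor at the cofree comodule on P. *)
Definition rhom_firm (P : rmod A) : firm_rmod R := FirmRmod (tens_reg_firm (rhom_rmod X P)).

Fact cofree_counit_comp_rlinear (P : rmod A) :
  @rlinear R (chom_rmod X (cofree C P)) (rhom_rmod X P) (@cofree_counit_comp A C X P).
Proof.
split=> [f g|f r]; apply: rhom_ext => u //.
exact: (counit_at_rlinear C P).1.
Qed.
Fact cofree_lift_rhom_rlinear (P : rmod A) :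
  @rlinear R (rhom_rmod X P) (chom_rmod X (cofree C P)) (@cofree_lift A C X P).
Proof.
apply: (@rlinear_can _ _ (rhom_rmod X P) _ _ _ _ (cofree_counit_comp_rlinear P)).
- exact: cofree_counit_compK.
- exact: cofree_liftK.
Qed.

Definition kappa (P : rmod A) : rhom (hom_firm X (cofree C P)) (rhom_firm P) :=
  Rhom (tmap_rlinear (cofree_counit_comp_rlinear P) (conj (llinear_id (reg R)) (rlinear_id (reg R)))).
Definition kappaV (P : rmod A) : rhom (rhom_firm P) (hom_firm X (cofree C P)) :=
  Rhom (tmap_rlinear (cofree_lift_rhom_rlinear P) (conj (llinear_id (reg R)) (rlinear_id (reg R)))).

Lemma kappaK P : cancel (kappa P) (kappaV P).
Proof.
apply: (@tmap_can _ (chom_rmod X (cofree C P)) (rhom_rmod X P)) => //.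
- exact: cofree_counit_comp_rlinear.
- exact: cofree_lift_rhom_rlinear.
- exact: cofree_counit_compK.
Qed.
Lemma kappaVK P : cancel (kappaV P) (kappa P).
Proof.
apply: (@tmap_can _ (rhom_rmod X P) (chom_rmod X (cofree C P))) => //.
- exact: cofree_lift_rhom_rlinear.
- exact: cofree_counit_comp_rlinear.
- exact: cofree_liftK.
Qed.

Definition rhom_firm_map (P Q : rmod A) (h : rhom P Q) : rhom (rhom_firm P) (rhom_firm Q) :=
  Rhom (tmap_rlinear (@rhom_comp_rlinear R A X P Q h) (conj (llinear_id (reg R)) (rlinear_id (reg R)))).

Lemma kappa_natural (P Q : rmod A) (h : rhom P Q) :
  rhom_comp (kappa Q) (hmap (cofree_map C h)) = rhom_comp (rhom_firm_map h) (kappa P).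
Proof.
apply: rhom_ext => x /=.
rewrite !tmap_comp //; try exact: hom_map_rlinear0; try exact: cofree_counit_comp_rlinear;
  try exact: rhom_comp_rlinear.
apply: tlift_eq => f r; congr (_ ⊗ _); apply: rhom_ext => u /=.
exact: counit_at_natural (rhomP h).
Qed.

Section Bijectivity.
Variable M : rmod A.
Notation T := (rhom_firm (reg A)).
Let N : firm_rmod R := FirmRmod (@firm_tens_r A R M (firm_dual X) (fm_firm T)).
Let I : rhom N (rhom_firm M) := Rhom (@tens_dual_rlinear A R X M).
Let pm (m : M) : rhom T N := Rhom (@tpure_rlinear_bimod A R M (firm_dual X) m).
Let q (m : M) : chom (cofree C (reg A)) (H N) := htr (rhom_comp (pm m) (kappa (reg A))).
Let one (c : C) : cofree C (reg A) := @tpure A (reg A) C (1 : A) c.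

Fact tens_dual_pure m : rhom_comp I (pm m) = rhom_firm_map (ract_rhom m).
Proof.
apply: rhom_ext; apply: (@tens_ext R (dual X) (reg R)) => [||phi r].
- exact: (rhomP (rhom_comp I (pm m))).1.
- exact: (rhomP (rhom_firm_map (ract_rhom m))).1.
rewrite /= tens_dualE tmapE //; exact: rhom_comp_rlinear.
Qed.

Fact transpose_pureD m m' : q (m + m') = q m + q m'.
Proof.
rewrite /q -htrD; congr htr; apply: rhom_ext => x /=; exact: tpureDl.
Qed.
(** Since (m a) (x) y = m (x) (a y), the action of a on m becomes left multiplication by a on A;
    naturality of [kappa] moves it to the cofree comodule. *)
Fact transpose_pure_act (m : M) (a : A) : q (ract m a) = chom_comp (q m) (cofree_map C (ract_rhom (a : reg A))).
Proof.
rewrite /q -htr_natl; congr htr; apply: rhom_ext => x.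
transitivity ((pm m) (rhom_comp (kappa (reg A)) (hmap (cofree_map C (ract_rhom (a : reg A)))) x)) => //.
rewrite kappa_natural /=; rewrite tpureM; congr (_ ⊗ _).
rewrite /lmact /=.
move: (tmap _ _ x); apply: (@tens_ext R (dual X) (reg R)) => [y z|y z|phi r].
- exact: (@lmactDr A (firm_dual X)).
- by rewrite tmapD //; exact: rhom_comp_rlinear.
- rewrite tens_lactE tmapE //; last exact: rhom_comp_rlinear.
  by congr (_ ⊗ _); apply: rhom_ext.
Qed.

Fact transpose_pure_balanced : balanced (fun (m : M) (c : C) => q m (one c)).
Proof.
split=> [m m' c|m c c'|m a c].
- by rewrite transpose_pureD.
- by rewrite /one tpureDr (rhomP (q m)).1.
- rewrite transpose_pure_act /= /one tmapE //; last exact: ract_rlinear.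
  congr (q m _); rewrite -tpureM; congr (_ ⊗ _).
  by rewrite /= mul1r mulr1.
Qed.

(** M is presented by the maps A -> M, a |-> m a, and M (x)_A C by the maps that these induce on A
    (x)_A C. The maps [q m] respect the relations between these pieces, hence define one map on M
    (x)_A C: this is the colimit argument made explicit. *)
Let glue (x : cofree C M) : H N := tlift (fun (m : M) (c : C) => q m (one c)) x.
Fact glueE (m : M) (c : C) : glue (m ⊗ c : tens M C) = q m (one c).
Proof. exact: (tliftE _ _ transpose_pure_balanced). Qed.
Fact glueD : {morph glue : x y / x + y}.
Proof. exact: tliftD transpose_pure_balanced. Qed.
Fact glue_rlinear : @rlinear A (cofree C M) (H N) glue.
Proof.
split=> [|x a]; first exact: glueD.
move: x; apply: (@tens_ext A M C (H N)) => [x y|x y|m c].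
- by rewrite (@ractDl _ (cofree C M)) glueD.
- by rewrite glueD ractDl.
- by rewrite /= tens_ractE !glueE -(rhomP (q m)).2 /= tens_ractE.
Qed.
Fact glue_colinear : colinear (Rhom glue_rlinear).
Proof.
have QP := glue_rlinear; have oP := tpure_rlinear_bimod C (1 : reg A).
apply: (@tens_ext A M C) => [x y|x y|m c].
- by rewrite (rhomP _).1 (coact_rlinear (H N)).1.
- by rewrite (coact_rlinear (cofree C M)).1 tmapD.
rewrite /= glueE chom_colinear /one /= !cofree_coactE.
rewrite !tmap_comp //; try exact: tpure_rlinear_bimod; last exact: (rhomP (q m)).
by apply: tlift_eq => d e /=; rewrite glueE.
Qed.
Let Q : chom (cofree C M) (H N) := Chom glue_colinear.

Fact glue_pure m : chom_comp Q (cofree_map C (ract_rhom m)) = q m.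
Proof.
apply: chom_ext; apply: (@tens_ext A (reg A) C (H N)) => [||a c].
- exact: (rhomP (chom_comp Q (cofree_map C (ract_rhom m)))).1.
- exact: (rhomP (q m)).1.
rewrite /= tmapE //; last exact: ract_rlinear.
rewrite glueE transpose_pure_act /= /one tmapE //; last exact: ract_rlinear.
by congr (q m (_ ⊗ _)); exact: mulr1.
Qed.

(* The inverse is the transpose of the morphism Q : M (x)_A C -> H(M (x)_A X^dag)
   glued from the transposes of the maps y |-> m (x) y. *)
Lemma tens_dual_bij : bijective (@tens_dual A R X M).
Proof.
have [tr _ trK] := htr_bij (cofree C M) N.
pose J := tr Q; have JE : htr J = Q by exact: trK.
(* On the piece indexed by m, J is y |-> m (x) y. *)
have J_pure m : rhom_comp J (hmap (cofree_map C (ract_rhom m)))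
              = rhom_comp (pm m) (kappa (reg A)).
  by apply: (bij_inj (htr_bij (cofree C (reg A)) N)); rewrite htr_natl JE; exact: glue_pure.
(* The transposes of both sides are compared on m (x) c, where each reduces to the piece indexed by
   m. *)
have IJ : rhom_comp I J = kappa M.
  apply: (bij_inj (htr_bij (cofree C M) (rhom_firm M))).
  rewrite htr_natr JE; apply: chom_ext.
  apply: (@tens_ext A M C (H (rhom_firm M))) => [||m c].
  - exact: (rhomP (chom_comp (fmap H I : chom (H N) (H (rhom_firm M))) Q)).1.
  - exact: (rhomP (htr (kappa M))).1.
  rewrite /= glueE -[LHS]/(chom_comp (fmap H I : chom (H N) (H (rhom_firm M))) (q m) (one c)).
  rewrite /q -htr_natr.
  have -> : rhom_comp I (rhom_comp (pm m) (kappa (reg A)))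
          = rhom_comp (kappa M) (hmap (cofree_map C (ract_rhom m))).
    rewrite kappa_natural -tens_dual_pure; exact: rhom_ext.
  rewrite htr_natl /= /one tmapE //; last exact: ract_rlinear.
  by rewrite /= tpureM [lmact _ c](coring_unital_l (coringP C)).
exists (J \o kappaV M) => x /=.
- suff : rhom_comp J (rhom_comp (kappaV M) I) =1 @idfun N by exact.
  apply: (@tens_ext A M (firm_dual X)) => [||m y] //.
    exact: (rhomP (rhom_comp J (rhom_comp (kappaV M) I))).1.
  transitivity (J (kappaV M (rhom_comp I (pm m) y))) => //.
  rewrite tens_dual_pure -{1}(kappaVK y).
  transitivity (J (kappaV M (rhom_comp (rhom_firm_map (ract_rhom m)) (kappa (reg A)) (kappaV (reg A) y)))) => //.
  rewrite -kappa_natural /=.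
  rewrite -[X in J X]/(kappaV M (kappa M (hmap (cofree_map C (ract_rhom m)) (kappaV (reg A) y)))).
  rewrite kappaK.
  transitivity (rhom_comp J (hmap (cofree_map C (ract_rhom m))) (kappaV (reg A) y)) => //.
  rewrite J_pure; transitivity (pm m (kappa (reg A) (kappaV (reg A) y))) => //.
  by rewrite kappaVK.
- transitivity (rhom_comp I J (kappaV M x)) => //.
  by rewrite IJ kappaVK.
Qed.
End Bijectivity.
End RightAdjointOfHom.

(** * Firm projectivity and the comatrix coring context *)

Section ElementaryRingAction.
Variables (R : rng) (A : pzRingType) (X : bimod R A).

Lemma elt_actE (u : X) (phi : dual X) (v : X) :
  elt_act (u ⊗ phi : tens X (dual X)) v = ract u (ev phi v).
Proof. exact: (tliftE _ _ (elt_act_balanced v)). Qed.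
Lemma elt_actD (v : X) : {morph (fun x : tens X (dual X) => elt_act x v) : x y / x + y}.
Proof. exact: tliftD (elt_act_balanced v). Qed.

(** Left multiplication in this ring depends only on the action on X, which reduces multiplicativity
    of the dual basis map to its left linearity. *)
Lemma elt_mul_pure (x : tens X (dual X)) (v : X) (psi : dual X) :
  elt_mul x (v ⊗ psi) = elt_act x v ⊗ psi.
Proof.
move: x; apply: (@tens_ext A X (dual X)) => [x y|x y|u phi].
- by rewrite elt_mulDl.
- by rewrite elt_actD tpureDl.
- by rewrite elt_mulE elt_actE.
Qed.
End ElementaryRingAction.

Section FirmlyProjective.
Variables (A : pzRingType) (C : coring A) (R : firm_rng) (X : bicomodule C R).
Hypothesis XF : firm_l X.
Hypothesis tens_dualB : bijective (@tens_dual A R X X).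
Notation XX := (rhom_bimod X X).

Let left_mult (r : reg R) : XX := (bc_act r : chom X X).
Fact left_mult_rlinear : @rlinear R (reg R) XX left_mult.
Proof.
split=> [r s|r s]; apply: rhom_ext => u /=; first exact: bc_actD.
by rewrite /left_mult -bc_actM.
Qed.
Fact left_mult_llinear : @llinear R (reg R) XX left_mult.
Proof.
split=> [r s|r s]; apply: rhom_ext => u /=; first exact: bc_actD.
by rewrite /left_mult -bc_actM.
Qed.

Let left_mult_firm : R -> tens_b XX (reg R) := corefl left_mult.
Fact left_mult_firm_llinear : @llinear R (reg R) (tens_b XX (reg R)) left_mult_firm.
Proof.
have RF := fr_firm R.
have cP := corefl_rlinear RF left_mult_rlinear.
split=> [|r s]; first exact: cP.1.
move: s; apply: (firm_ext RF) => [x y|x y|s t].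
- by rewrite (@lmactDr R (reg R)) [left_mult_firm _]cP.1.
- rewrite -(@lmactDr R (tens_b XX (reg R))); congr lmact; exact: cP.1.
have -> : @lmact R (reg R) r (@ract R (reg R) s t) = @ract R (reg R) (rmul r s) t.
  exact: rmulA.
rewrite /left_mult_firm !(corefl_ract _ _ RF left_mult_rlinear) [left_mult _]left_mult_llinear.2.
by symmetry; exact: tens_lactE.
Qed.

Let acc_dual : tens X (firm_dual X) -> tens X (dual X) :=
  tmap idfun (acc_r (dual X) : firm_dual X -> dual X).

Fact acc_dual_llinear :
  @llinear R (tens_b X (firm_dual X)) (tens_b X (dual X)) acc_dual.
Proof.
have aP := (acc_r_bilinear (dual X)).1.
split=> [|r]; first exact: tmapD.
apply: (@tens_ext A X (firm_dual X)) => [x y|x y|u y].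
- by rewrite (@lmactDr _ (tens_b X (firm_dual X)) r x y) /acc_dual tmapD.
- by rewrite /acc_dual tmapD // (@lmactDr _ (tens_b X (dual X))).
- by rewrite /acc_dual /= tens_lactE !tmapE // tens_lactE.
Qed.

Fact elt_act_acc_dual (y : tens X (firm_dual X)) (u : X) :
  elt_act (acc_dual y) u = rhom_fun (acc_r XX (tens_dual y) : rhom X X) u.
Proof.
have aP := (acc_r_bilinear (dual X)).1.
move: y; apply: (@tens3r_ext A R R X (dual X) (reg R) X) => [x y|x y|v phi r].
- by rewrite /acc_dual tmapD // elt_actD.
- by rewrite tens_dualD acc_rD.
by rewrite /acc_dual tmapE // acc_rE elt_actE tens_dualE acc_rE.
Qed.

(** Left multiplication by r, an element of End_A(X), is lifted to End_A(X) (x)_R R, pulled back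
    along [tens_dual] to X (x)_A X^dag, and sent to X (x)_A X^dual by letting R act on the
    functionals. *)
Lemma firmly_projective_of_tens_dual : firmly_projective X.
Proof.
have RF := fr_firm R.
have [g gK Kg] := tens_dualB.
have gP := @llinear_can R (tens_b X (firm_dual X)) (tens_b XX (reg R)) _ _ gK Kg
  (tens_dual_llinear X).
pose io : R -> elt_rng X := acc_dual \o g \o left_mult_firm.
have ioP : @llinear R (reg R) (tens_b X (dual X)) io.
  apply: (@llinear_comp R (reg R) (tens_b XX (reg R)) (tens_b X (dual X))) left_mult_firm_llinear.
  exact: (@llinear_comp R _ (tens_b X (firm_dual X))) acc_dual_llinear gP.
have actE (r : R) (u : X) : elt_act (io r) u = lact r u.
  by rewrite /io /= elt_act_acc_dual Kg (acc_corefl _ RF left_mult_rlinear).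
(* io(r s) = r io(s) by left linearity, and acting by r on the first factor is multiplication by
   io(r). *)
have ioM (r s : R) : io (rmul r s) = elt_mul (io r) (io s).
  rewrite -[LHS]/(io (@lmact R (reg R) r s)) ioP.2.
  move: (io s); apply: (@tens_ext A X (dual X)) => [x y|x y|v psi].
  - exact: (@lmactDr R (tens_b X (dual X))).
  - by rewrite elt_mulDr.
  by rewrite elt_mul_pure actE; exact: tens_lactE.
by exists (@RngHom R (elt_rng X) io ioP.1 ioM); split.
Qed.
End FirmlyProjective.

(** * The comatrix context, and the inverse of [tens_dual] from dual bases *)

Section Context.
Variables (A : pzRingType) (C : coring A) (R : firm_rng) (X : bicomodule C R).
Variable iota : rng_hom R (elt_rng X).
Hypothesis iotaP : firmly_projective_via iota.
Notation T := (firm_dual X).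
Notation eta := (firm_dual_eta iota).
Notation eps := (firm_dual_eps (X := X)).

Let RF := fr_firm R.

Lemma firm_dual_lactE (a : A) (phi : dual X) (r : reg R) :
  @lact A R T a (phi ⊗ r) = @lact A R (dual X) a phi ⊗ r.
Proof. exact: (@tens_lactE A R R (dual X) (reg R) a phi r). Qed.
Lemma firm_dual_ractE (phi : dual X) (r : reg R) (s : R) :
  @ract R T (phi ⊗ r) s = phi ⊗ (rmul r s : reg R).
Proof. exact: (@tens_ractE R R (dual X) (reg R) phi r s). Qed.

(** On a product s t the preimage in R (x)_R R is s (x) t, so eta is explicit there; identities
    about eta are reduced to such products. *)
Lemma firm_dual_etaE (s t : R) :
  eta (rmul s t) = tmap idfun (fun f : dual X => (f ⊗ (t : reg R)) : T) (iota s).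
Proof. exact: (etaE iotaP). Qed.

(** The dual basis identity for functionals follows from e_s f_s(v) = s v by applying phi. *)
Lemma dual_basis (phi : dual X) (s : R) :
  tlift (fun (e : X) (f : dual X) => lact (ev phi e) f) (iota s) = ract phi s.
Proof.
have bal := can_inner_balanced phi.
apply: rhom_ext => v; rewrite -[RHS]/(ev phi (lact s v)) -(iotaP.1 s v).
move: (iota s : tens X (dual X)); apply: (@tens_ext A X (dual X) (reg A)) => [x y|x y|e f].
- by rewrite (tliftD (bal (dual X))).
- by rewrite elt_actD /ev (rhomP (phi : rhom X (reg A))).1.
- by rewrite (tliftE _ _ (bal (dual X))) elt_actE /ev (rhomP (phi : rhom X (reg A))).2.
Qed.

Fact firm_dual_eps_balanced1 (u : X) :
  balanced (fun (phi : dual X) (r : reg R) => ev phi (lact r u) : reg A).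
Proof.
split=> [phi psi r|phi r s|phi r s] //.
- by rewrite lactDl /ev (rhomP (phi : rhom X (reg A))).1.
- by rewrite -lactA.
Qed.
Fact firm_dual_eps_balanced2 :
  balanced (fun (y : T) (u : X) =>
    tlift (fun (phi : dual X) (r : reg R) => ev phi (lact r u)) y : reg A).
Proof.
split=> [x y u|y u v|y r u].
- by rewrite (tliftD (firm_dual_eps_balanced1 u)).
- by apply: tlift_add => phi r; rewrite lactDr /ev (rhomP (phi : rhom X (reg A))).1.
- move: y; apply: (@tens_ext R (dual X) (reg R) (reg A)) => [x y|x y|phi s].
  + by rewrite (@ractDl _ T) (tliftD (firm_dual_eps_balanced1 _)).
  + by rewrite (tliftD (firm_dual_eps_balanced1 _)).
  + by rewrite /= tens_ractE !(tliftE _ _ (firm_dual_eps_balanced1 _)) lactA.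
Qed.
Lemma firm_dual_epsD : {morph eps : x y / x + y}.
Proof. exact: (@tliftD _ _ _ (reg A) _ firm_dual_eps_balanced2). Qed.
Lemma firm_dual_epsE (phi : dual X) (r : reg R) (u : X) :
  eps ((phi ⊗ r : T) ⊗ u) = ev phi (lact r u).
Proof.
rewrite /firm_dual_eps (tliftE _ _ firm_dual_eps_balanced2).
exact: (tliftE _ _ (firm_dual_eps_balanced1 u)).
Qed.

Lemma firm_dual_eps_bilinear : @bilinear A A (tens_b T X) (reg A) eps.
Proof.
split; split; try exact: firm_dual_epsD.
- move=> a; apply: (@tens3_ext R R A (dual X) (reg R) X (reg A)) => [x y|x y|phi r u].
  + by rewrite (@lmactDr _ (tens_b T X) a x y) firm_dual_epsD.
  + by rewrite firm_dual_epsD lmactDr.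
  have -> : @lmact A (tens_b T X) a ((phi ⊗ r : T) ⊗ u) = (lact a phi ⊗ r : T) ⊗ u.
    rewrite [LHS]tens_lactE; congr (_ ⊗ _); exact: firm_dual_lactE.
  by rewrite !firm_dual_epsE.
- move=> x a; move: x; apply: (@tens3_ext R R A (dual X) (reg R) X (reg A)) => [x y|x y|phi r u].
  + by rewrite ractDl firm_dual_epsD.
  + by rewrite firm_dual_epsD ractDl.
  have -> : @ract A (tens_b T X) ((phi ⊗ r : T) ⊗ u) a = (phi ⊗ r : T) ⊗ ract u a.
    exact: tens_ractE.
  by rewrite !firm_dual_epsE /ev -lactC (rhomP (phi : rhom X (reg A))).2.
Qed.

Fact firm_dual_triangle_balanced (u : X) :
  balanced (fun (e : X) (f : T) => ract e (eps (f ⊗ u))).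
Proof.
split=> [x y f|x f g|x a f]; first exact: ractDl.
- by rewrite tpureDl firm_dual_epsD ractDr.
- rewrite ractA; congr ract; rewrite -[LHS](firm_dual_eps_bilinear.1.2 a).
  by congr eps; exact: tens_lactE.
Qed.
Fact firm_dual_triangle (r : R) (u : X) :
  tlift (fun (e : X) (f : T) => ract e (eps (f ⊗ u))) (eta r) = lact r u.
Proof.
have bal := firm_dual_triangle_balanced u; have eD := etaD iotaP.
move: r; apply: (firm_ext RF) => [x y|x y|s t].
- by rewrite eD (tliftD bal).
- by rewrite lactDl.
rewrite -[ract s t]/(rmul s t) firm_dual_etaE -lactA -(iotaP.1 s) (tlift_tmap _ _ _ bal).
by apply: tlift_eq => e f; rewrite firm_dual_epsE.
Qed.

Fact firm_dual_dual_triangle_balanced (y : T) (N : lmod A) :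
  balanced (fun (e : X) (f : N) => lmact (eps (y ⊗ e)) f).
Proof.
split=> [x x' f|x f g|x a f].
- by rewrite tpureDr firm_dual_epsD lmactDl.
- exact: lmactDr.
- rewrite lmactA; congr (lmact _ f); rewrite -[RHS](firm_dual_eps_bilinear.2.2 _ a).
  by congr eps; symmetry; exact: tens_ractE.
Qed.
Fact firm_dual_dual_triangle (r : R) (y : T) :
  tlift (fun (e : X) (f : T) => lact (eps (y ⊗ e)) f) (eta r) = ract y r.
Proof.
have bal := firm_dual_dual_triangle_balanced; have eD := etaD iotaP.
move: r; apply: (firm_ext RF) => [r s|r s|s t].
- by rewrite eD (tliftD (bal _ T)).
- by rewrite ractDr.
rewrite -[ract s t]/(rmul s t) firm_dual_etaE (tlift_tmap _ _ _ (bal _ T)).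
move: y; apply: (@tens_ext R (dual X) (reg R) T) => [x y|x y|psi q].
- by apply: tlift_add => e f; rewrite tpureDl firm_dual_epsD lmactDl.
- by rewrite ractDl.
(* All ring factors except t are moved to the functional: psi q s is what the dual basis identity
   for s expands. *)
rewrite firm_dual_ractE rmulA -[rmul (rmul q s) t]/(lmact (rmul q s) (t : reg R)) -tpureM.
rewrite -(@ractA _ (dual X) psi) -dual_basis.
rewrite (tlift_comp _ _ (g := fun f : dual X => f ⊗ (t : reg R) : T)); last by move=> x y; exact: tpureDl.
apply: tlift_eq => e f; rewrite firm_dual_epsE; exact: firm_dual_lactE.
Qed.

Lemma firm_dual_context : comatrix_context eta eps.
Proof.
have AU : unital_r (reg A) by move=> x; exact: mulr1.
split.
- exact: fr_firm.
- exact: unital_firm_r AU.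
- exact: iotaP.2.
- exact: unital_firm_r (cm_unital X).
- apply: unital_firm_l; apply: unital_tens_l => phi.
  by apply: rhom_ext => u; exact: mul1r.
- exact: tens_reg_firm.
- exact: eta_bilinear.
- exact: firm_dual_eps_bilinear.
- exact: firm_dual_triangle.
- exact: firm_dual_dual_triangle.
Qed.

Section DualTensor.
Variable M : rmod A.
Notation XM := (rhom_rmod X M).

(** Inverse of [tens_dual]: f is expanded along the dual basis contained in eta(r). *)
Definition dual_tens (x : tens XM (reg R)) : tens M T :=
  tlift (fun (f : XM) (r : reg R) => tmap (f : rhom X M) (@idfun T) (eta r)) x.
Fact dual_tens_balanced :
  balanced (fun (f : XM) (r : reg R) => tmap (f : rhom X M) (@idfun T) (eta r)).
Proof.
split=> [f g r|f r s|f s r].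
- exact: tmapDf.
- by rewrite (etaD iotaP) tmapD //; exact: (rhomP (f : rhom X M)).
- rewrite (eta_bilinear iotaP).1.2; move: (eta r).
  have fP := rhomP (f : rhom X M); have fsP := rhomP (ract f s : rhom X M).
  apply: (@tens_ext A X T) => [x y|x y|e y].
  + by rewrite tmapD.
  + by rewrite (@lmactDr _ (tens_b X T)) tmapD.
  + have -> : @lmact R (tens_b X T) s (e ⊗ y) = lact s e ⊗ y by exact: tens_lactE.
    by rewrite !tmapE.
Qed.
Lemma dual_tensD : {morph dual_tens : x y / x + y}.
Proof. exact: tliftD dual_tens_balanced. Qed.
Lemma dual_tensE (f : rhom X M) (r : R) :
  dual_tens ((f : XM) ⊗ (r : reg R)) = tmap f idfun (eta r).
Proof. exact: (tliftE _ _ dual_tens_balanced). Qed.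

Lemma dual_tensK : cancel dual_tens (@tens_dual A R X M).
Proof.
apply: (@tens_ext R XM (reg R) (tens XM (reg R))) => [x y|//|f r].
  by rewrite dual_tensD tens_dualD.
move: r; apply: (firm_ext RF) => [r s|r s|s t].
- rewrite (@tpureDr R XM (reg R) f r s) dual_tensD tens_dualD //.
- exact: tpureDr.
rewrite -[ract s t]/(rmul s t) dual_tensE firm_dual_etaE.
have sP (m : M) := rhom_scale_rlinear X m.
transitivity (tens_dual (tmap f (fun h : dual X => h ⊗ (t : reg R) : T) (iota s))).
  congr tens_dual; rewrite tmap_comp //; first exact: rhomP.
  exact: tpure_llinear_bimod.
transitivity ((tlift (fun (e : X) (h : dual X) => rhom_scale (f e) h) (iota s) : XM) ⊗ (t : reg R)).
  rewrite [RHS](tlift_comp _ _ (g := fun h : XM => h ⊗ (t : reg R))); last by move=> x y; exact: tpureDl.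
  rewrite /tmap (tlift_comp _ _ (@tens_dualD A R X M)).
  by apply: tlift_eq => e h; rewrite tens_dualE.
have -> : tlift (fun (e : X) (h : dual X) => rhom_scale (f e) h : XM) (iota s) = ract (f : XM) s.
  have sB : balanced (fun (e : X) (h : dual X) => rhom_scale (f e) h : XM).
    have [fD fZ] := rhomP f; split=> [x y h|x h k|x a h]; apply: rhom_ext => v /=.
    - by rewrite fD ractDl.
    - by rewrite ractDr.
    - by rewrite fZ ractA.
  apply: rhom_ext => u; rewrite -[RHS]/(f (lact s u)) -(iotaP.1 s u).
  move: (iota s : tens X (dual X)); apply: (@tens_ext A X (dual X) M) => [x y|x y|e h].
  - by rewrite (tliftD sB).
  - by rewrite elt_actD (rhomP f).1.
  - by rewrite (tliftE _ _ sB) elt_actE (rhomP f).2.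
exact: tpureM.
Qed.

Lemma tens_dualK : cancel (@tens_dual A R X M) dual_tens.
Proof.
apply: (@tens3r_ext A R R M (dual X) (reg R) (tens M T)) => [x y|//|m phi r].
  by rewrite tens_dualD dual_tensD.
rewrite tens_dualE dual_tensE.
transitivity (m ⊗ tlift (fun (e : X) (y : T) => lact (ev phi e) y) (eta r)).
  rewrite (tlift_comp _ _ (g := fun y : T => m ⊗ y)); last by move=> x y; exact: tpureDr.
  by apply: tlift_eq => e y; exact: tpureM.
congr (_ ⊗ _); move: r; apply: (firm_ext RF) => [r s|r s|s t].
- by rewrite (etaD iotaP) (tliftD (can_inner_balanced phi T)).
- exact: (@tpureDr R (dual X) (reg R)).
rewrite -[ract s t]/(rmul s t) firm_dual_etaE (tlift_tmap _ _ _ (can_inner_balanced phi T)).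
rewrite -[rmul s t]/(lmact s (t : reg R)) -tpureM -dual_basis.
rewrite (tlift_comp _ _ (g := fun f : dual X => f ⊗ (t : reg R) : T)); last by move=> x y; exact: tpureDl.
apply: tlift_eq => e f; exact: firm_dual_lactE.
Qed.
End DualTensor.
End Context.

(** * Hom functor and cotensor product *)

Lemma tassoc_natural (R S T : rng) (M M' : rmod R) (N : bimod R S) (P : bimod S T)
    (f : M -> M') (x : tens (tens_r M N) P) : rlinear f ->
  tassoc (tmap (tmap f (@idfun N) : tens_r M N -> tens_r M' N) (@idfun P) x)
  = tmap f (@idfun (tens_b N P)) (tassoc x).
Proof.
move=> fP.
have fP' : @rlinear S (tens_r M N) (tens_r M' N) (tmap f (@idfun N)).
  by apply: tmap_rlinear.
move: x; apply: tens3_ext => [x y|x y|m n p].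
- by rewrite (tmapD fP') // tassocD.
- by rewrite tassocD tmapD.
- by rewrite (tmapE _ _ fP') // tmapE // !tassocE tmapE.
Qed.

(* Hom^C(X, N) is the kernel of f |-> (f (x) C) rho_X - rho_N f on Hom_A(X, N). *)
Section ColinearKernel.
Variables (A : pzRingType) (C : coring A) (R : rng) (X : bicomodule C R) (N : comodule C).
Notation XN := (rhom_rmod X N).
Notation XNC := (rhom_rmod X (tens_r N C)).

Fact chom_incl_rlinear :
  @rlinear R (chom_rmod X N) XN (fun f : chom X N => chom_rhom f).
Proof. by split=> [f g|f r]; apply: rhom_ext. Qed.
Definition chom_incl : rhom (chom_rmod X N) XN := Rhom chom_incl_rlinear.

Fact lift_rhom_rlinear :
  @rlinear R XN XNC (fun f : rhom X N => chom_rhom (@cofree_lift A C X N f)).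
Proof.
split=> [f g|f r]; apply: rhom_ext => u /=; first exact: tmapDf.
rewrite [in RHS](bicomod_coactE r u) tmap_comp //; first exact: (rhomP (bc_act r)).
exact: rhomP.
Qed.
Definition lift_rhom : rhom XN XNC := Rhom lift_rhom_rlinear.

Definition post_coact : rhom XN XNC :=
  Rhom (@rhom_comp_rlinear R A X N (tens_r N C) (Rhom (coact_rlinear N))).

Lemma chom_incl_inj : injective chom_incl.
Proof.
move=> f g fg; apply: chom_ext => u; exact: (congr1 (fun h : rhom X N => h u) fg).
Qed.

Lemma chom_incl_exact : exact_at chom_incl (lift_rhom - post_coact).
Proof.
move=> f; split=> [/eqP|[g <-]].
- rewrite subr_eq0 => /eqP fE.
  have fC : colinear (f : rhom X N).
    by move=> u; apply: esym; exact: (congr1 (fun h : rhom X (tens_r N C) => h u) fE).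
  by exists (Chom fC); apply: rhom_ext.
- apply/eqP; rewrite subr_eq0; apply/eqP; apply: rhom_ext => u /=.
  by rewrite chom_colinear.
Qed.

Section Flat.
Variable L : lmod R.
Hypothesis LF : flat_l L.

Lemma tmap_chom_incl_inj : injective (tmap chom_incl (@idfun L)).
Proof. apply: (flat_l_inj LF) => //; exact: chom_incl_inj. Qed.

Lemma tmap_chom_incl_exact (x : tens XN L) :
  tmap lift_rhom (@idfun L) x = tmap post_coact (@idfun L) x <->
  exists y, tmap chom_incl (@idfun L) y = x.
Proof.
have E : tmap (lift_rhom - post_coact) (@idfun L) x
    = tmap lift_rhom (@idfun L) x - tmap post_coact (@idfun L) x.
  apply/eqP; rewrite eq_sym subr_eq -tmapDf; apply/eqP; apply: tlift_eq => f l.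
  by rewrite subrK.
have ex := LF I I I chom_incl_exact x; rewrite -ex; split=> [xE|].
- by rewrite E xE subrr.
- by rewrite E => /eqP; rewrite subr_eq0 => /eqP.
Qed.
End Flat.
End ColinearKernel.

Section CotensorProduct.
Variables (A : pzRingType) (C : coring A) (R : firm_rng) (X : bicomodule C R).
Variable iota : rng_hom R (elt_rng X).
Hypothesis iotaP : firmly_projective_via iota.
Notation T := (firm_dual X).
Notation eta := (firm_dual_eta iota).
Notation rhoT := (firm_dual_coact iota).

Let RF := fr_firm R.
Let rhoP := firm_dual_coact_bilinear iotaP.

(** In other words, eta takes values in the cotensor product of X and X^dag. For r = s t and eta(t)
    = e' (x) y, both sides equal e_s (x) can(f_s (x) e') (x) y, because e_s f_s(v) = s v for the
    first legs v of the coaction of e'. *)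
Lemma eta_coact (r : R) :
  tmap (@idfun X) (rhoT : T -> tens_b C T) (eta r)
  = tassoc (tmap (coact : X -> tens_r X C) (@idfun T) (eta r)).
Proof.
have cP : @rlinear A X (tens_r X C) coact := coact_rlinear X.
move: r; apply: (firm_ext RF) => [r s|r s|s t].
- by rewrite (etaD iotaP) (tmapD (rlinear_id X) rhoP.1).
- by rewrite (etaD iotaP) (tmapD cP) // tassocD.
(* On the left eta(s t) is expanded through iota(s); on the right it is written s eta(t). *)
rewrite -[ract s t]/(rmul s t) {1}(firm_dual_etaE iotaP).
rewrite -[rmul s t]/(@lmact R (reg R) s t) (eta_bilinear iotaP).1.2.
have tP := @tpure_llinear_bimod A R R (dual X) (reg R) t.
rewrite (tmap_comp _ (rlinear_id X) (rlinear_id X) tP rhoP.1).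
have B1 := @firm_dual_coact_balanced1 A C R X.
have rE (h : dual X) : rhoT (h ⊗ (t : reg R) : T)
    = tlift (fun (e : X) (y : T) => can (h ⊗ e : tens_b (dual X) X) ⊗ y) (eta t).
  exact: (tliftE _ _ (firm_dual_coact_balanced2 iotaP)).
transitivity (tlift (fun (e : X) (h : dual X) => e ⊗ (tlift (fun (e' : X) (y : T) =>
    can (h ⊗ e' : tens_b (dual X) X) ⊗ y) (eta t) : tens_b C T)) (iota s)).
  by apply: tlift_eq => e h /=; rewrite rE.
move: (eta t); apply: (@tens_ext A X T (tens X (tens_b C T))) => [x y|x y|e' y].
- by apply: tlift_add => e h; rewrite (tliftD (B1 h)) tpureDr.
- by rewrite (@lmactDr _ (tens_b X T)) (tmapD cP) // tassocD.
have -> : @lmact R (tens_b X T) s (e' ⊗ y) = lact s e' ⊗ y by exact: tens_lactE.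
rewrite tmapE // [coact _](bicomod_coactE s e').
transitivity (tlift (fun (e : X) (h : dual X) =>
   e ⊗ (tlift (fun (v : X) (c : C) => lact (ev h v) c) (coact e') ⊗ y : tens_b C T)) (iota s)).
  by apply: tlift_eq => e h; rewrite (tliftE _ _ (B1 h)) canE.
have sP : rlinear (lact s : X -> X) := rhomP (bc_act s).
move: (coact e'); apply: (@tens_ext A X C (tens X (tens_b C T))) => [x z|x z|v c].
- by apply: tlift_add => e h; rewrite (tliftD (can_inner_balanced h C)) (@tpureDl A C T) tpureDr.
- rewrite tmapD //.
  have -> : forall a b : tens_r X C, (a + b : tens_r X C) ⊗ idfun y = a ⊗ y + b ⊗ y.
    by move=> a b; exact: tpureDl.
  exact: tassocD.
rewrite tmapE // tassocE -(iotaP.1 s v) /elt_act.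
rewrite (tlift_comp _ _ (g := fun e : X => e ⊗ (c ⊗ y : tens_b C T))); last by move=> a b; exact: tpureDl.
apply: tlift_eq => e h; rewrite (tliftE _ _ (can_inner_balanced h C)) tpureM.
by congr (_ ⊗ _); symmetry; exact: tens_lactE.
Qed.

Section Object.
Variable N : comodule C.
Notation XN := (rhom_rmod X N).
Notation XNC := (rhom_rmod X (tens_r N C)).
Notation j := (dual_tens iota).

(** [dual_tens] carries the two maps with equalizer Hom^C(X, N) to the two maps that define the
    cotensor product; [dual_tens_coact] treats the other one. *)
Lemma dual_tens_lift (x : tens XN (reg R)) :
  tassoc (j (tmap (lift_rhom X N) (@idfun (reg R)) x))
  = tmap (@idfun N) (rhoT : T -> tens_b C T) (j x).
Proof.
have lP := rhomP (lift_rhom X N).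
move: x; apply: (@tens_ext R XN (reg R) (tens N (tens_b C T))) => [x y|x y|f r].
- by rewrite (tmapD lP) // (dual_tensD iotaP) tassocD.
- by rewrite (dual_tensD iotaP) (tmapD (rlinear_id N) rhoP.1).
have fP := rhomP (f : rhom X N).
rewrite (tmapE _ _ lP) // !(dual_tensE iotaP).
transitivity (tassoc (tmap (tmap (f : rhom X N) (@idfun C) : tens_r X C -> tens_r N C) (@idfun T)
   (tmap (coact : X -> tens_r X C) (@idfun T) (eta r)))).
  congr tassoc; rewrite tmap_comp //; first exact: (coact_rlinear X).
  exact: tmap_rlinear.
rewrite (tassoc_natural _ fP) -eta_coact !tmap_comp //; exact: rhoP.1.
Qed.

Lemma dual_tens_coact (x : tens XN (reg R)) :
  j (tmap (post_coact X N) (@idfun (reg R)) x)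
  = tmap (coact : N -> tens_r N C) (@idfun T) (j x).
Proof.
have pP := rhomP (post_coact X N).
have cP : @rlinear A N (tens_r N C) coact := coact_rlinear N.
move: x; apply: (@tens_ext R XN (reg R) (tens (tens_r N C) T)) => [x y|x y|f r].
- by rewrite (tmapD pP) // (dual_tensD iotaP).
- by rewrite (dual_tensD iotaP) (tmapD cP).
rewrite (tmapE _ _ pP) // !(dual_tensE iotaP) tmap_comp //; exact: rhomP.
Qed.

Notation LC := (firm_dual_left_coaction iotaP).

Lemma cotensP (x : tens N LC) :
  (Rhom (cotens_left_rlinear LC N) - Rhom (cotens_right_rlinear LC N)) x == 0 <->
  tassoc (tmap (coact : N -> tens_r N C) (@idfun T) x)
  = tmap (@idfun N) (rhoT : T -> tens_b C T) x.
Proof. by rewrite subr_eq0; split=> /eqP. Qed.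

Hypothesis RFl : flat_l (reg R).

Lemma cotens_of_hom_subproof (x : tens (chom_rmod X N) (reg R)) :
  (Rhom (cotens_left_rlinear LC N) - Rhom (cotens_right_rlinear LC N))
    (j (tmap (chom_incl X N) (@idfun (reg R)) x)) == 0.
Proof.
apply/cotensP; rewrite -dual_tens_coact -dual_tens_lift; congr (tassoc (j _)).
by apply: esym; apply/(tmap_chom_incl_exact RFl); exists x.
Qed.
Definition cotens_of_hom (x : hom_firm X N) : cotens LC N := Rker (cotens_of_hom_subproof x).

Lemma dual_tens_rlinear : @rlinear R (tens_r XN (reg R)) (tens_r N T) (dual_tens iota (M := N)).
Proof.
exact: (@rlinear_can R (tens_r N T) (tens_r XN (reg R)) _ _
  (tens_dualK iotaP (M := N)) (dual_tensK iotaP (M := N)) (@tens_dual_rlinear A R X N)).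
Qed.

Lemma cotens_of_hom_rlinear : @rlinear R (hom_firm X N) (cotens LC N) cotens_of_hom.
Proof.
have iP : @rlinear R (hom_firm X N) (tens_r XN (reg R)) (tmap (chom_incl X N) (@idfun (reg R))).
  by apply: tmap_rlinear => //; exact: rhomP.
have jiP := rlinear_comp dual_tens_rlinear iP.
by split=> [x y|x r]; apply: val_inj; [exact: jiP.1|exact: jiP.2].
Qed.

Lemma cotens_of_hom_bij : bijective cotens_of_hom.
Proof.
have jK := dual_tensK iotaP (M := N).
apply: inj_surj_bij => [x y /(congr1 val)/= /(can_inj jK)|y].
  exact: (tmap_chom_incl_inj RFl).
have /(cotensP (val y)) yE : (Rhom (cotens_left_rlinear LC N)
  - Rhom (cotens_right_rlinear LC N)) (val y) == 0 by exact: (rker_valP y).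
pose z : tens XN (reg R) := @tens_dual A R X N (val y).
have jz : j z = val y by exact: (tens_dualK iotaP (M := N)).
have /(tmap_chom_incl_exact RFl)[x xE] : tmap (lift_rhom X N) (@idfun (reg R)) z
    = tmap (post_coact X N) (@idfun (reg R)) z.
  apply: (can_inj (dual_tensK iotaP (M := tens_r N C))).
  apply: (can_inj (@tassocK A A R N C T)).
  by rewrite dual_tens_lift dual_tens_coact jz yE.
by exists x; apply: val_inj; rewrite /= xE.
Qed.
End Object.

Lemma hom_functor_cotens : flat_l (reg R) ->
  nat_iso (comp_functor (firm_incl R) (hom_functor X))
          (cotens_functor (firm_dual_left_coaction iotaP)).
Proof.
move=> RFl.
exists (fun N => Rhom (cotens_of_hom_rlinear N RFl) : @hom (rmod_cat R) _ _).
split=> [N P k|N]; last by apply: rmod_is_iso; exact: cotens_of_hom_bij.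
apply: rhom_ext => x; apply: val_inj => /=.
have hP := hom_map_rlinear0 X k.
have iP := rhomP (chom_incl X P); have iP' := rhomP (chom_incl X N).
have kP := rhomP k.
move: x; apply: (@tens_ext R (chom_rmod X N) (reg R) (tens P T)) => [x y|x y|f r].
- by rewrite (tmapD hP) // (tmapD iP) // (dual_tensD iotaP).
- by rewrite (tmapD iP') // (dual_tensD iotaP) tmapD.
rewrite (tmapE _ _ hP) // (tmapE _ _ iP) // (tmapE _ _ iP') //.
by rewrite !(dual_tensE iotaP) tmap_comp //; exact: rhomP.
Qed.
End CotensorProduct.

(** * Evaluation of colinear maps *)

Section ChomEvaluation.
Variables (A : pzRingType) (C : coring A) (R : firm_rng) (X : bicomodule C R).
Hypothesis XF : firm_l X.

Definition chom_eval (Y : comodule C) : chom (tens_comod X (chom_rmod X Y)) Y :=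
  tens_chom_lift (rhom_id (chom_rmod X Y)).
Lemma chom_evalE (Y : comodule C) (f : chom X Y) (u : X) :
  chom_eval Y ((f : chom_rmod X Y) ⊗ u) = f u.
Proof. exact: tens_chom_liftE. Qed.

(** The counit of the adjunction, defined on Hom^C(X, Y) made firm; [chom_eval] is the same
    evaluation before that, and is easier to compute with. *)
Definition hom_counit (Y : comodule C) : chom (tens_comod X (hom_firm X Y)) Y :=
  tens_chom_lift (Rhom (acc_r_rlinear (chom_rmod X Y))).
Lemma hom_counitE (Y : comodule C) (f : chom X Y) (r : R) (u : X) :
  hom_counit Y (((f : chom_rmod X Y) ⊗ (r : reg R) : hom_firm X Y) ⊗ u) = f (lact r u).
Proof. by rewrite /hom_counit tens_chom_liftE /= acc_rE. Qed.

Lemma hom_counit_transpose (Y : comodule C) :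
  transpose (tens_hom_adj X) (hom_counit Y : @hom (comod_cat C) (tens_functor X (hom_functor X Y)) Y)
  = idm (hom_functor X Y).
Proof.
apply: rhom_ext => x /=.
rewrite -[RHS](@corefl_acc R (hom_firm X Y) (chom_rmod X Y) idfun x (fm_firm _)) //.
apply: tlift_eq => y r; congr (_ ⊗ _); apply: chom_ext => u.
exact: tens_chom_liftE.
Qed.

(** The map M (x)_R R -> M need not be bijective, but by associativity its tensor product with X is
    M tensored with the isomorphism R (x)_R X ~ X. *)
Lemma tmap_acc_bij (M : rmod R) :
  bijective (tmap (acc_r M : tens_r M (reg R) -> M) (@idfun X)).
Proof.
have [aL _] := acc_l_bilinear X.
have E : tmap (acc_r M : tens_r M (reg R) -> M) (@idfun X)
   =1 tmap (@idfun M) (acc_l X : tens_b (reg R) X -> X) \o @tassoc R R A M (reg R) X.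
  apply: tens3_ext => [x y|x y|m r u] /=.
  - by rewrite tmapD //; exact: acc_r_rlinear.
  - by rewrite tassocD tmapD.
  rewrite tmapE //; last exact: acc_r_rlinear.
  by rewrite tassocE tmapE // acc_rE acc_lE tpureM.
apply: (eq_bij (f := tmap (@idfun M) (acc_l X : tens_b (reg R) X -> X) \o
   @tassoc R R A M (reg R) X)) => [|x]; last by rewrite E.
apply: bij_comp; last by exists (@tassocV R R A M (reg R) X); [exact: tassocK|exact: tassocVK].
by apply: tmap_bij => //; exact: inv_bij.
Qed.

Lemma hom_counit_eval (Y : comodule C) (x : tens (hom_firm X Y) X) :
  hom_counit Y x
  = chom_eval Y (tmap (acc_r (chom_rmod X Y) : hom_firm X Y -> chom_rmod X Y) idfun x).
Proof.
have aP := acc_r_rlinear (chom_rmod X Y).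
move: x; apply: tens3_ext => [x y|x y|f r u].
- exact: (rhomP (hom_counit Y)).1.
- by rewrite tmapD // (rhomP (chom_eval Y)).1.
by rewrite hom_counitE tmapE // acc_rE chom_evalE.
Qed.

Lemma chom_eval_bij (Y : comodule C) :
  bijective (hom_counit Y) -> bijective (chom_eval Y).
Proof.
have [a' aK Ka] := tmap_acc_bij (chom_rmod X Y).
move=> hB; apply: (eq_bij (f := hom_counit Y \o a')) => [|x].
  by apply: bij_comp => //; exists (tmap (acc_r (chom_rmod X Y) : hom_firm X Y -> chom_rmod X Y) idfun).
by rewrite -[LHS]/(hom_counit Y (a' x)) hom_counit_eval Ka.
Qed.

Lemma hom_counit_bij (Y : comodule C) :
  bijective (chom_eval Y) -> bijective (hom_counit Y).
Proof.
move=> eB; apply: (eq_bij (f := chom_eval Y \o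
    tmap (acc_r (chom_rmod X Y) : hom_firm X Y -> chom_rmod X Y) idfun)) => [|x].
  by apply: bij_comp => //; exact: tmap_acc_bij.
exact: esym (hom_counit_eval x).
Qed.

Lemma can_at_eval (M : rmod A) (x : tens (rhom_rmod X M) X) :
  @can_at A C R X M x
  = chom_eval (cofree C M)
      (tmap (@cofree_lift A C X M : rhom_rmod X M -> chom_rmod X (cofree C M)) idfun x).
Proof.
have lP := @cofree_lift_rhom_rlinear A C R X M.
rewrite /can_at /tmap [RHS](tlift_comp _ _ (rhomP (chom_eval (cofree C M))).1).
by apply: tlift_eq => f u; rewrite chom_evalE.
Qed.

(** Colinear maps X -> M (x)_A C are the same as A-linear maps X -> M, and this identification turns
    evaluation at the cofree comodule into the canonical map. *)
Lemma can_at_bij (M : rmod A) :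
  bijective (chom_eval (cofree C M)) <-> bijective (@can_at A C R X M).
Proof.
pose l := tmap (@cofree_lift A C X M : rhom_rmod X M -> chom_rmod X (cofree C M)) (@idfun X).
have lB : bijective l.
  apply: tmap_bij => //; first exact: cofree_lift_rhom_rlinear.
    by exists (@cofree_counit_comp A C X M); [exact: cofree_liftK|exact: cofree_counit_compK].
  exact: inv_bij.
have E : @can_at A C R X M =1 chom_eval (cofree C M) \o l by exact: can_at_eval.
split=> B; first by apply: (eq_bij (bij_comp B lB)) => x; rewrite E.
have [l' lK Kl] := lB.
apply: (eq_bij (f := @can_at A C R X M \o l')) => [|x /=]; last by rewrite E /= Kl.
by apply: bij_comp => //; exists l.
Qed.

Lemma can_acc (x : tens (rhom_rmod X (reg A)) X) :
  @can A C R X x = acc_l C (@can_at A C R X (reg A) x).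
Proof.
rewrite /can /can_at [RHS](tlift_comp _ _ (@acc_lD _ C)).
apply: tlift_eq => f u; rewrite /acc_l (tlift_tmap _ _ _ (acc_l_balanced C)).
by apply: tlift_eq => v c.
Qed.

Lemma can_bij : comonadic_galois X -> bijective (@can A C R X).
Proof.
move=> [_ canB]; have AU : unital_r (reg A) by move=> x; exact: mulr1.
apply: (eq_bij (f := acc_l C \o @can_at A C R X (reg A))) => [|x]; last by rewrite can_acc.
apply: bij_comp; last exact: canB.
apply: unital_firm_l; exact: (coring_unital_l (coringP C)).
Qed.
End ChomEvaluation.

Section Equivalence.
Variables (A : pzRingType) (C : coring A) (R : firm_rng) (X : bicomodule C R).
Hypothesis XF : firm_l X.
Hypothesis eqv : inverse_equivalences (tens_functor X) (hom_functor X).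

Lemma equivalence_eval_bij (Y : comodule C) : bijective (chom_eval X Y).
Proof.
apply: chom_eval_bij => //; apply: (@comod_iso_bij A C (tens_functor X (hom_functor X Y)) Y).
exact: (@counit_iso _ _ (tens_functor X) (hom_functor X) (tens_hom_adj X) eqv Y _
  (hom_counit_transpose X Y)).
Qed.

Lemma equivalence_comonadic : comonadic_galois X.
Proof. by split=> // M _; apply/can_at_bij; exact: equivalence_eval_bij. Qed.

(** Evaluation is onto, so every element of Y is a sum of values of colinear maps X -> Y. *)
Lemma equivalence_generator : generator (bc_comod X : comod_cat C).
Proof.
move=> Y Z f g fg; have [e _ Ke] := equivalence_eval_bij Y.
apply: chom_ext => y; rewrite -(Ke y).
move: (e y); apply: (@tens_ext R (chom_rmod X Y) X Z) => [||h u].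
- exact: (rlinear_comp (rhomP f) (rhomP (chom_eval X Y))).1.
- exact: (rlinear_comp (rhomP g) (rhomP (chom_eval X Y))).1.
rewrite /rhom_comp -[LHS]/(f (chom_eval X Y (h ⊗ u))) -[RHS]/(g (chom_eval X Y (h ⊗ u))).
rewrite chom_evalE.
exact: (congr1 (fun k : chom X Z => k u) (fg h)).
Qed.

(** In an equivalence the Hom functor has a right adjoint, which makes [tens_dual] bijective. *)
Lemma equivalence_firmly_projective : firmly_projective X.
Proof.
have [H [adj]] := inverse_equivalences_adjoint eqv.
apply: firmly_projective_of_tens_dual => //; exact: tens_dual_bij adj X.
Qed.
End Equivalence.

(** * Comatrix corings *)

Section LeftUnaction.
Variables (R : rng) (N : lmod R).
Hypothesis NF : firm_l N.

Lemma firm_unacc_lK : cancel (acc_l N) (unacc_l N).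
Proof.
have [g gK Kg] := NF => x; apply: (can_inj gK).
by apply: (@xgetPex _ 0 [set y | acc_l N y = acc_l N x]); exists x.
Qed.
Lemma firm_acc_lK : cancel (unacc_l N) (acc_l N).
Proof. by have [g _ Kg] := NF; move=> x; rewrite -[x]Kg firm_unacc_lK. Qed.
Lemma unacc_lD : {morph unacc_l N : x y / x + y}.
Proof. exact: morphD_can firm_unacc_lK firm_acc_lK (@acc_lD _ N). Qed.
Lemma unacc_lmact (r : R) (n : N) : unacc_l N (lmact r n) = (r : reg R) ⊗ n.
Proof. by rewrite -acc_lE firm_unacc_lK. Qed.
End LeftUnaction.

Section ComatrixDelta.
Variables (R S : rng) (X : bimod R S) (Y : bimod S R) (eta : R -> tens_b X Y).
Hypothesis XF : firm_l X.
Hypothesis etaP : @bilinear R R (reg R) (tens_b X Y) eta.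
Notation YX := (tens_b Y X).

Fact comatrix_delta_balanced1 (phi : Y) (v : X) :
  balanced (fun (e : X) (f : Y) => (phi ⊗ e : YX) ⊗ (f ⊗ v : YX)).
Proof.
split=> [x x' y|x y y'|x s y].
- by rewrite (@tpureDr R Y X) (@tpureDl S YX YX).
- by rewrite (@tpureDl R Y X) (@tpureDr S YX YX).
- have -> : (phi ⊗ ract x s : YX) = @ract S YX (phi ⊗ x) s by symmetry; exact: tens_ractE.
  by rewrite tpureM; congr (_ ⊗ _); exact: tens_lactE.
Qed.
Let B1 := comatrix_delta_balanced1.

Fact comatrix_delta_balanced2 (phi : Y) :
  balanced (fun (r : reg R) (v : X) =>
    tlift (fun (e : X) (f : Y) => (phi ⊗ e : YX) ⊗ (f ⊗ v : YX)) (eta r)).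
Proof.
split=> [r s v|r v w|r s v].
- by rewrite etaP.1.1 (tliftD (B1 phi v)).
- by apply: tlift_add => e f; rewrite (@tpureDr R Y X) (@tpureDr S YX YX).
rewrite etaP.2.2; move: (eta r).
apply: (@tens_ext S X Y (tens YX YX)) => [x y|x y|e f].
- by rewrite ractDl (tliftD (B1 _ _)).
- by rewrite (tliftD (B1 _ _)).
have -> : @ract R (tens_b X Y) (e ⊗ f) s = e ⊗ ract f s by exact: tens_ractE.
by rewrite !(tliftE _ _ (B1 _ _)); congr (_ ⊗ _); exact: tpureM.
Qed.
Let B2 := comatrix_delta_balanced2.

Fact comatrix_delta_balanced3 :
  balanced (fun (phi : Y) (u : X) =>
    tlift (fun (r : reg R) (v : X) =>
      tlift (fun (e : X) (f : Y) => (phi ⊗ e : YX) ⊗ (f ⊗ v : YX)) (eta r))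
      (unacc_l X u)).
Proof.
split=> [phi psi u|phi u v|phi s u].
- apply: tlift_add => r v; apply: tlift_add => e f.
  by rewrite (@tpureDl R Y X) (@tpureDl S YX YX).
- by rewrite unacc_lD // (tliftD (B2 phi)).
(* Once u is written as r v, the element s u is represented by (s r) (x) v, and left linearity of
   eta moves s onto e. *)
rewrite -{1}(firm_acc_lK XF u) -{2}(firm_acc_lK XF u); move: (unacc_l X u).
apply: (@tens_ext R (reg R) X (tens YX YX)) => [x y|x y|r v].
- by rewrite acc_lD unacc_lD // (tliftD (B2 _)).
- by rewrite acc_lD lmactDr unacc_lD // (tliftD (B2 _)).
rewrite acc_lE lmactA !unacc_lmact // !(tliftE _ _ (B2 _)).
rewrite -[rmul s r]/(@lmact R (reg R) s r) etaP.1.2; move: (eta r).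
apply: (@tens_ext S X Y (tens YX YX)) => [x y|x y|e f].
- by rewrite (tliftD (B1 _ _)).
- by rewrite (@lmactDr _ (tens_b X Y)) (tliftD (B1 _ _)).
have -> : @lmact R (tens_b X Y) s (e ⊗ f) = lact s e ⊗ f by exact: tens_lactE.
by rewrite !(tliftE _ _ (B1 _ _)) tpureM.
Qed.

Lemma comatrix_deltaD : {morph comatrix_delta eta : x y / x + y}.
Proof. exact: tliftD comatrix_delta_balanced3. Qed.
(** X is spanned by the elements r v, on which [unacc_l] is explicit. *)
Lemma comatrix_deltaE (phi : Y) (r : R) (v : X) :
  comatrix_delta eta (phi ⊗ lact r v) =
  tlift (fun (e : X) (f : Y) => (phi ⊗ e : YX) ⊗ (f ⊗ v : YX)) (eta r).
Proof.
rewrite /comatrix_delta (tliftE _ _ comatrix_delta_balanced3).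
by rewrite [unacc_l X _]unacc_lmact // (tliftE _ _ (B2 _)).
Qed.
End ComatrixDelta.

Lemma coring_iso_comp (A : pzRingType) (B C D : coring_data A) (f : C -> D) (g : B -> C) :
  coring_iso f -> coring_iso g -> coring_iso (f \o g).
Proof.
move=> [fB [fL fR] fd fe] [gB [gL gR] gd ge]; split=> [||c|c] /=.
- exact: bij_comp.
- by split; [exact: llinear_comp|exact: rlinear_comp].
- by rewrite fd gd tmap_comp.
- by rewrite fe ge.
Qed.

Lemma dual_eps_balanced (R : rng) (A : pzRingType) (X : bimod R A) :
  balanced (fun (f : dual X) (u : X) => ev f u : reg A).
Proof. by split=> // f u v; exact: (rhomP (f : rhom X (reg A))).1. Qed.

(** * The canonical map as an isomorphism of corings *)

Section GaloisCorings.
Variables (A : pzRingType) (C : coring A) (R : firm_rng) (X : bicomodule C R).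
Variable iota : rng_hom R (elt_rng X).
Hypothesis iotaP : firmly_projective_via iota.
Notation T := (firm_dual X).
Notation eta := (firm_dual_eta iota).
Let XF := iotaP.2.
Let CP := coringP C.

Lemma iota_bilinear : @bilinear R R (reg R) (tens_b X (dual X)) iota.
Proof.
split; split; try exact: (@rng_homD _ _ iota).
- move=> r s. exact: (iota_left iotaP r s).
- exact: (iota_right iotaP).
Qed.

Lemma eta_iota (r : R) :
  tmap (@idfun X) (acc_r (dual X) : T -> dual X) (eta r) = iota r.
Proof.
have aP := (acc_r_bilinear (dual X)).1.
move: r; apply: (firm_ext (fr_firm R)) => [r s|r s|s t].
- by rewrite (etaD iotaP) tmapD.
- exact: (@rng_homD _ _ iota).
rewrite -[ract s t]/(rmul s t) (firm_dual_etaE iotaP).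
rewrite tmap_comp //; last exact: tpure_llinear_bimod.
rewrite (iota_right iotaP); move: (iota s : tens X (dual X)).
have B := @tmap_balanced A X X (dual X) (dual X) _ _ (rlinear_id X)
  (llinear_comp aP (@tpure_llinear_bimod A R R (dual X) (reg R) t)).
apply: (@tens_ext A X (dual X)) => [x y|x y|e f].
- exact: (tliftD B).
- exact: (@ractDl _ (tens_b X (dual X))).
by rewrite [LHS](tliftE _ _ B) /= acc_rE; symmetry; exact: tens_ractE.
Qed.

Let P (phi : dual X) (v : X) (c : C) : tens_b C C := can (phi ⊗ v : tens_b (dual X) X) ⊗ c.
Fact can_tens_balanced phi : balanced (P phi).
Proof.
rewrite /P; split=> [x x' y|x y y'|x a y].
- by rewrite (@tpureDr R (dual X) X) canD tpureDl.
- exact: tpureDr.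
- rewrite -tpureM -(can_bilinear X).2.2; congr (can _ ⊗ _).
  by symmetry; exact: tens_ractE.
Qed.

(** By coassociativity, splitting the second leg of the coaction of u amounts to coacting once more
    on the first leg, and phi contracts the result to a value of [can]. *)
Fact delta_can (phi : dual X) (u : X) :
  cdelta (can (phi ⊗ u : tens_b (dual X) X)) = tlift (P phi) (coact u).
Proof.
have [[dD dL] dR] := cdelta_bilinear CP.
have bal N := can_inner_balanced phi N.
rewrite canE (tlift_comp _ _ dD).
transitivity (tlift (fun (v : X) (y : tens_b C C) => lmact (ev phi v) y)
    (tmap (@idfun X) (cdelta : C -> tens_b C C) (coact u))).
  rewrite (tlift_tmap _ _ _ (bal (tens_b C C))).
  by apply: tlift_eq => v c; exact: dL.
rewrite -coact_coassoc.
have bal' : balanced (fun (y : tens_r X C) (d : C) =>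
    tlift (fun (v : X) (c : C) => lact (ev phi v) c) y ⊗ d : tens_b C C).
  have lR : rlinear (fun y : tens_r X C => tlift (fun (v : X) (c : C) => lact (ev phi v) c) y).
    split; first exact: (tliftD (bal C)).
    move=> y a; move: y; apply: (@tens_ext A X C C) => [y z|y z|v c].
    - by rewrite (@ractDl _ (tens_r X C)) (tliftD (bal C)).
    - by rewrite (tliftD (bal C)) ractDl.
    - by rewrite /= tens_ractE !(tliftE _ _ (bal C)) lactC.
  exact: tmap_balanced lR (llinear_id C).
transitivity (tlift (fun (y : tens_r X C) (d : C) =>
    tlift (fun (v : X) (c : C) => lact (ev phi v) c) y ⊗ d : tens_b C C)
    (tmap (coact : X -> tens_r X C) (@idfun C) (coact u))).
  move: (tmap _ _ (coact u)) => {u}.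
  apply: tens3_ext => [x y|x y|v c d].
  - by rewrite tassocD (tliftD (bal (tens_b C C))).
  - by rewrite (tliftD bal').
  rewrite tassocE (tliftE _ _ (bal (tens_b C C))) (tliftE _ _ bal') (tliftE _ _ (bal C)).
  exact: tens_lactE.
rewrite (tlift_tmap _ _ _ bal'); apply: tlift_eq => v d.
by rewrite /P canE.
Qed.

(** Contracting e_r (x) f_r with a first leg w of the coaction of v gives r w, and the coaction is
    R-linear. Together with [delta_can] this is the compatibility of [can] with the
    comultiplications. *)
Fact coact_can (phi : dual X) (r : R) (v : X) :
  tlift (fun (e : X) (f : dual X) =>
      can (phi ⊗ e : tens_b (dual X) X) ⊗ can (f ⊗ v : tens_b (dual X) X) : tens_b C C) (iota r)
  = tlift (P phi) (coact (lact r v : X)).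
Proof.
have rP : rlinear (lact r : X -> X) := rhomP (bc_act r).
have PB := can_tens_balanced phi.
have bal (h : dual X) := can_inner_balanced h C.
rewrite [coact _](bicomod_coactE r v).
transitivity (tlift (fun (e : X) (f : dual X) => P phi e
   (tlift (fun (w : X) (c : C) => lact (ev f w) c) (coact v))) (iota r)).
  by apply: tlift_eq => e f; rewrite -canE.
move: (coact v); apply: (@tens_ext A X C (tens_b C C)) => [x y|x y|w c].
- by apply: tlift_add => e f; rewrite (tliftD (bal f)) (balDr PB).
- by rewrite tmapD // (tliftD PB).
rewrite tmapE // (tliftE _ _ PB) -(iotaP.1 r w) /elt_act.
rewrite (tlift_comp _ _ (g := fun x : X => P phi x (idfun c))); last by move=> x y; exact: (balDl PB).
by apply: tlift_eq => e f; rewrite (tliftE _ _ (bal f)) (balM PB).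
Qed.

Fact eps_can (phi : dual X) (u : X) :
  ceps (can (phi ⊗ u : tens_b (dual X) X)) = ev phi u.
Proof.
have [[eD eL] _] := ceps_bilinear CP.
rewrite canE (tlift_comp _ _ eD) -[in RHS](coact_counit u).
rewrite /ev (tlift_comp _ _ (rhomP (phi : rhom X (reg A))).1).
by apply: tlift_eq => v c; rewrite eL (rhomP (phi : rhom X (reg A))).2.
Qed.

Lemma can_coring_iso :
  bijective (@can A C R X) -> @coring_iso A (dual_comatrix iota) C (@can A C R X).
Proof.
have cP := can_bilinear X.
move=> canB; split=> //.
- have [[dD _] _] := cdelta_bilinear CP.
  have DD := comatrix_deltaD XF iota_bilinear.
  apply: (@tens_ext R (dual X) X (tens_b C C)) => [x y|x y|phi u].
  + by rewrite canD dD.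
  + by rewrite [cdelta _]DD (tmapD cP.2 cP.1).
  rewrite delta_can /=; move: u; apply: (firm_lmact_ext XF) => [u v|u v|r v].
  + by rewrite (coact_rlinear X).1 (tliftD (can_tens_balanced phi)).
  + by rewrite (@tpureDr R (dual X) X) DD (tmapD cP.2 cP.1).
  rewrite -coact_can (comatrix_deltaE XF iota_bilinear).
  rewrite [RHS](tlift_comp _ _ (tmapD cP.2 cP.1)).
  by apply: tlift_eq => e f; rewrite (tmapE _ _ cP.2 cP.1).
- have [[eD eL] eR] := ceps_bilinear CP.
  apply: (@tens_ext R (dual X) X (reg A)) => [x y|x y|phi u].
  + by rewrite canD eD.
  + exact: (tliftD (dual_eps_balanced X)).
  by rewrite eps_can; exact: esym (tliftE _ _ (dual_eps_balanced X)).
Qed.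

Let p : tens_b T X -> tens_b (dual X) X := tmap (acc_r (dual X) : T -> dual X) idfun.
Let accP := acc_r_bilinear (dual X).
Let pE phi t u : p ((phi ⊗ t : T) ⊗ u) = ract phi t ⊗ u.
Proof. by rewrite /p (tmapE _ _ accP.2) // acc_rE. Qed.
Let pD : {morph p : x y / x + y}.
Proof. exact: tmapD accP.2 (llinear_id X). Qed.
Fact acc_tens_bilinear : @bilinear A A (tens_b T X) (tens_b (dual X) X) p.
Proof.
split; last exact: (tmap_rlinear accP.2).
split=> // a; apply: (@tens_ext R T X) => [x y|x y|y u].
- by rewrite (@lmactDr _ (tens_b T X) a x y) pD.
- by rewrite pD (@lmactDr _ (tens_b (dual X) X)).
have -> : @lmact A (tens_b T X) a (y ⊗ u) = lact a y ⊗ u by exact: tens_lactE.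
rewrite /p !(tmapE _ _ accP.2) //.
have -> : acc_r (dual X) (lact a y) = lact a (acc_r (dual X) y) by exact: accP.1.2.
by symmetry; exact: tens_lactE.
Qed.

(** Bijectivity comes from firmness of X; the comultiplications agree because the action map X^dag
    -> X^dual carries eta to iota. *)
Lemma acc_coring_iso : @coring_iso A (firm_dual_comatrix iota) (dual_comatrix iota) p.
Proof.
have eB := eta_bilinear iotaP.
have [pL pR] := acc_tens_bilinear.
split=> [||x|x].
- exact: tmap_acc_bij.
- exact: acc_tens_bilinear.
- have DD := comatrix_deltaD XF iota_bilinear.
  have DD' := comatrix_deltaD XF eB.
  move: x; apply: (@tens_ext R T X (tens_b (tens_b (dual X) X) (tens_b (dual X) X))) => [x y|x y|y u].
  + by rewrite pD [LHS]DD.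
  + by rewrite [cdelta _]DD' (tmapD pR pL).
  move: u; apply: (firm_lmact_ext XF) => [u v|u v|r v].
  + by rewrite (@tpureDr R T X) pD [LHS]DD.
  + by rewrite (@tpureDr R T X) [cdelta _]DD' (tmapD pR pL).
  rewrite /= (comatrix_deltaE XF eB) [p _](tmapE _ _ accP.2) // (comatrix_deltaE XF iota_bilinear).
  rewrite [RHS](tlift_comp _ _ (tmapD pR pL)) /dual_eta -eta_iota.
  rewrite (tlift_tmap _ _ _ (comatrix_delta_balanced1 _ _)).
  apply: tlift_eq => e f; rewrite (tmapE _ _ pR pL); congr (_ ⊗ _).
  + by rewrite /p (tmapE _ _ accP.2).
  + by rewrite /p (tmapE _ _ accP.2).
- have evB := dual_eps_balanced X.
  move: x; apply: (@tens3_ext R R A (dual X) (reg R) X (reg A)) => [x y|x y|phi r u].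
  + by rewrite pD; exact: (tliftD evB).
  + exact: (@firm_dual_epsD A C R X).
  rewrite pE [LHS](tliftE _ _ evB); symmetry; exact: (@firm_dual_epsE A C R X).
Qed.
End GaloisCorings.

(** * Dual rings *)

Lemma ring_isomorphicI (S T : pzRingType) (f : S -> T) :
  {morph f : x y / x + y} -> f 1 = 1 -> {morph f : x y / x * y} -> bijective f ->
  ring_isomorphic S T.
Proof.
move=> fD f1 fM fB.
have fS : zmod_morphism f by move=> x y; rewrite fD (morphDN fD).
have fMM : monoid_morphism f by split.
pose aM := GRing.isZmodMorphism.Build S T f fS.
pose mM := GRing.isMonoidMorphism.Build S T f fMM.
pose F : {rmorphism S -> T} := HB.pack f aM mM.
by exists F.
Qed.

Section DualRingIsomorphisms.
Variables (A : pzRingType) (C : coring A) (R : firm_rng) (X : bicomodule C R).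
Variable iota : rng_hom R (elt_rng X).
Hypothesis iotaP : firmly_projective_via iota.
Hypothesis canB : bijective (@can A C R X).
Notation T := (firm_dual X).
Let XF := iotaP.2.
Let CP := coringP C.

Section LeftDual.
Definition ldual_act (f : lhom C (reg A)) (u : X) : X :=
  tlift (fun (v : X) (c : C) => ract v (f c)) (coact u).
Fact ldual_act_llinear f : @llinear R X X (ldual_act f).
Proof.
have bal := ldual_bal f X.
split=> [u v|r u]; first by rewrite /ldual_act (coact_rlinear X).1 (tliftD bal).
have rP : rlinear (lact r : X -> X) := rhomP (bc_act r).
rewrite /ldual_act [coact _](bicomod_coactE r u) (tlift_tmap _ _ _ bal).
rewrite [RHS](tlift_comp _ _ (@lactDr _ _ X r)).
by apply: tlift_eq => v c; rewrite lactC.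
Qed.
Definition ldual_to_lend (f : ldual_ring C) : lend_ring X := Lhom (ldual_act_llinear f).

(** Acting by f and then by g gives u_0 g(u_1 f(u_2)) by coassociativity, which is the action of f *
    g; this order of composition is the product of endomorphisms written on the right. *)
Lemma ldual_to_lendM : {morph ldual_to_lend : f g / f * g}.
Proof.
move=> f g; apply: lhom_ext => u.
have balf := ldual_bal f; have balg := ldual_bal g.
transitivity (ldual_act g (ldual_act f u)) => //=.
rewrite /ldual_act.
have cP := coact_rlinear X.
rewrite [in RHS](tlift_comp _ _ cP.1).
transitivity (tlift (fun (v : X) (c : C) => ract v (g c))
  (tlift (fun (y : tens_r X C) (c : C) => ract y (f c)) 
     (tmap (coact : X -> tens_r X C) (@idfun C) (coact u)))); last first.
  congr tlift; rewrite (tlift_tmap _ _ _ (balf (tens_r X C))).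
  by apply: tlift_eq => v c; rewrite cP.2.
pose W (y : tens_b C C) : C := tlift (fun c1 c2 : C => ract c1 (f c2)) y.
have WP : llinear W.
  split=> [x y|a x]; first exact: (tliftD (balf C)).
  move: x; apply: (@tens_ext A C C C) => [y z|y z|c d].
  - by rewrite lmactDr /W (tliftD (balf C)).
  - by rewrite /W (tliftD (balf C)) lmactDr.
  - by rewrite /W /= tens_lactE !(tliftE _ _ (balf C)) lactC.
have balgW := @lhom_balanced A (tens_b C C) _ X (llinear_comp (lhomP g) WP).
transitivity (tlift (fun (v : X) (y : tens_b C C) => ract v (g (W y)))
    (tmap (@idfun X) (cdelta : C -> tens_b C C) (coact u))).
  by rewrite (tlift_tmap _ _ _ balgW).
rewrite -coact_coassoc; move: (tmap _ _ (coact u)) => {u}.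
apply: tens3_ext => [x y|x y|v c d].
- by rewrite tassocD (tliftD balgW).
- by rewrite (tliftD (balf (tens_r X C))) (tliftD (balg X)).
rewrite tassocE (tliftE _ _ balgW) -[LHS]/(ract v (g (W _))) /W (tliftE _ _ (balf C)) (tliftE _ _ (balf (tens_r X C))).
by rewrite /= tens_ractE (tliftE _ _ (balg X)).
Qed.

Lemma ldual_act_iota (f : lhom C (reg A)) (r : R) (v : X) :
  ldual_act f (lact r v)
  = tlift (fun (e : X) (phi : dual X) => ract e (f (can (phi ⊗ v : tens_b (dual X) X)))) (iota r).
Proof.
have bal := ldual_bal f X; have [fD fZ] := lhomP f.
have B (phi : dual X) := can_inner_balanced phi C.
rewrite /ldual_act [coact _](bicomod_coactE r v) (tlift_tmap _ _ _ bal).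
transitivity (tlift (fun (e : X) (phi : dual X) => ract e (f (tlift (fun (w : X) (c : C) =>
   lact (ev phi w) c) (coact v)))) (iota r)); last by apply: tlift_eq => e phi; rewrite canE.
have rP : rlinear (lact r : X -> X) := rhomP (bc_act r).
have bal' : balanced (fun (w : X) (c : C) => ract (lact r w) (f (idfun c))).
  split=> [w w' c|w c c'|w a c].
  - by rewrite rP.1 ractDl.
  - by rewrite fD ractDr.
  - by rewrite rP.2 fZ ractA.
move: (coact v); apply: (@tens_ext A X C X) => [x y|x y|w c].
- by rewrite (tliftD bal').
- by apply: tlift_add => e phi; rewrite (tliftD (B phi)) fD ractDr.
rewrite (tliftE _ _ bal') -(iotaP.1 r w) /elt_act.
rewrite (tlift_comp _ _ (g := fun x : X => ract x (f c))); last by move=> x y; exact: ractDl.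
by apply: tlift_eq => e phi; rewrite (tliftE _ _ (B phi)) fZ ractA.
Qed.

(** Through [can], left linear maps C -> A are left linear maps on X^dual (x)_R X. The endomorphism
    h corresponds to phi (x) u |-> phi(h u), and dual bases recover h from these values. *)
Lemma ldual_lend_isomorphic : ring_isomorphic (ldual_ring C) (lend_ring X).
Proof.
have [can' canK Kcan] := canB.
have cB := can_bilinear X.
have can'L := @llinear_can A (tens_b (dual X) X) C _ _ canK Kcan cB.1.
have epsB := dual_eps_balanced X.
have epsL : @llinear A (tens_b (dual X) X) (reg A) (@dual_eps R A X).
  split=> [|a]; first exact: (@tliftD _ _ _ (reg A) _ epsB).
  apply: (@tens_ext R (dual X) X (reg A)) => [x y|x y|phi u].
  - by rewrite (@lmactDr _ (tens_b (dual X) X) a x y) [LHS](@tliftD _ _ _ (reg A) _ epsB).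
  - by rewrite [dual_eps _](@tliftD _ _ _ (reg A) _ epsB) lmactDr.
  have -> : @lmact A (tens_b (dual X) X) a (phi ⊗ u) = lact a phi ⊗ u by exact: tens_lactE.
  by rewrite /dual_eps !(tliftE _ _ epsB).
have idB : bilinear (@idfun (dual X)) by [].
have backP (h : lhom X X) := llinear_comp (llinear_comp epsL (tmap_llinear idB (lhomP h))) can'L.
pose back (h : lend_ring X) : ldual_ring C := Lhom (backP h).
have backE (h : lhom X X) phi u : lhom_fun (back h) (can (phi ⊗ u : tens_b (dual X) X)) = ev phi (h u).
  rewrite /= canK tmapE //; last exact: lhomP.
  by rewrite /dual_eps (tliftE _ _ epsB).
apply: (@ring_isomorphicI (ldual_ring C) (lend_ring X) ldual_to_lend).
- move=> f g; apply: lhom_ext => u; apply: tlift_add => v c; exact: ractDr.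
- apply: lhom_ext => u; exact: coact_counit.
- exact: ldual_to_lendM.
exists back => [f|h]; apply: lhom_ext.
- move=> c; rewrite -(Kcan c); move: (can' c).
  apply: (@tens_ext R (dual X) X (reg A)) => [x y|x y|phi u].
  + by rewrite canD (lhomP (back _)).1.
  + by rewrite canD (lhomP f).1.
  rewrite backE canE /ev (tlift_comp _ _ (rhomP (phi : rhom X (reg A))).1).
  rewrite (tlift_comp _ _ (lhomP f).1); apply: tlift_eq => v d.
  by rewrite (rhomP (phi : rhom X (reg A))).2 (lhomP f).2.
apply: (firm_lmact_ext XF) => [||r v].
- exact: (ldual_act_llinear (back h)).1.
- exact: (lhomP h).1.
rewrite (lhomP h).2 -[LHS]/(ldual_act (back h) (lact r v)) ldual_act_iota -[RHS](iotaP.1 r).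
by apply: tlift_eq => e phi; rewrite backE.
Qed.
End LeftDual.

Section RightDual.
Definition rdual_act (g : rhom C (reg A)) (phi : dual X) : dual X.
Proof.
exists (fun u : X => g (can (phi ⊗ u : tens_b (dual X) X)) : reg A).
have [_ [cD cZ]] := can_bilinear X; have [gD gZ] := rhomP g.
split=> [u v|u a]; first by rewrite (@tpureDr R (dual X) X) cD gD.
rewrite -gZ -cZ; congr (g (can _)); symmetry; exact: tens_ractE.
Defined.
Fact rdual_act_rlinear (g : rhom C (reg A)) : @rlinear R (dual X) (dual X) (rdual_act g).
Proof.
split=> [phi psi|phi r]; apply: rhom_ext => u /=.
- by rewrite (@tpureDl R (dual X) X) canD (rhomP g).1.
- by congr (g (can _)); exact: tpureM.
Qed.
Let idB : @bilinear R R (reg R) (reg R) idfun. Proof. by []. Qed.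
Definition rdual_to_rend (g : rdual_ring C) : rend_ring T :=
  Rhom (tmap_rlinear (rdual_act_rlinear g) idB).

Lemma rdual_to_rendM : {morph rdual_to_rend : f g / f * g}.
Proof.
move=> f g; apply: rhom_ext => y.
have aP := rdual_act_rlinear.
rewrite -[RHS]/(tmap (rdual_act f) (@idfun (reg R)) (tmap (rdual_act g) (@idfun (reg R)) y)).
rewrite tmap_comp //; apply: tlift_eq => phi r; congr (_ ⊗ _); apply: rhom_ext => u.
rewrite -[LHS]/(f (rdual_hit g (can (phi ⊗ u : tens_b (dual X) X)))).
rewrite -[RHS]/(f (can (rdual_act g phi ⊗ u : tens_b (dual X) X))).
congr (rhom_fun f _); rewrite /rdual_hit delta_can canE.
rewrite (tlift_comp _ _ (tliftD (rdual_bal g C))).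
by apply: tlift_eq => v c; rewrite (tliftE _ _ (rdual_bal g C)).
Qed.

(** The inverse sends h to y (x) u |-> eps(h y (x) u) on X^dag (x)_R X, transported to C along the
    canonical isomorphism [q]. *)
Lemma rdual_rend_isomorphic : ring_isomorphic (rdual_ring C) (rend_ring T).
Proof.
pose q : tens_b T X -> C := @can A C R X \o tmap (acc_r (dual X) : T -> dual X) idfun.
have qI : @coring_iso A (firm_dual_comatrix iota) C q.
  exact: coring_iso_comp (can_coring_iso iotaP canB) (acc_coring_iso iotaP).
have [_ qR] := coring_iso_bilinear qI; have [q' qK Kq] := coring_iso_bij qI.
have accP := acc_r_bilinear (dual X).
have qE (phi : dual X) (r : reg R) (u : X) :
    q ((phi ⊗ r : T) ⊗ u) = can (phi ⊗ lact r u : tens_b (dual X) X).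
  rewrite /q /= (tmapE _ _ accP.2) // acc_rE; congr can; exact: tpureM.
have epsP := @firm_dual_eps_bilinear A C R X.
have q'R := @rlinear_can A (tens_b T X) C _ _ qK Kq qR.
have idX : @bilinear R A X X idfun by [].
have backP (h : rhom T T) :=
  rlinear_comp (rlinear_comp epsP.2 (tmap_rlinear (rhomP h) idX)) q'R.
pose back (h : rend_ring T) : rdual_ring C := Rhom (backP h).
have backE (h : rhom T T) (y : T) (u : X) :
    rhom_fun (back h) (q (y ⊗ u)) = firm_dual_eps (h y ⊗ u).
  rewrite /= qK tmapE //; exact: rhomP.
have actE (g : rdual_ring C) (y : T) (u : X) :
    firm_dual_eps (rhom_fun (rdual_to_rend g) y ⊗ u) = rhom_fun g (q (y ⊗ u)).
  have aP := rdual_act_rlinear g.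
  move: y; apply: (@tens_ext R (dual X) (reg R) (reg A)) => [x y|x y|phi r].
  - by rewrite /= tmapD // (@tpureDl R T X) epsP.1.1.
  - by rewrite (@tpureDl R T X) qR.1 (rhomP g).1.
  by rewrite qE /= tmapE // (@firm_dual_epsE A C R X).
apply: (@ring_isomorphicI (rdual_ring C) (rend_ring T) rdual_to_rend).
- move=> f g; apply: rhom_ext => y; apply: tlift_add => phi r.
  by rewrite -tpureDl; congr (_ ⊗ _); apply: rhom_ext.
- apply: rhom_ext => y /=; rewrite -[RHS](tmap_id (M := dual X) (N := reg R)).
  by apply: tlift_eq => phi r; congr (_ ⊗ _); apply: rhom_ext => u; exact: eps_can.
- exact: rdual_to_rendM.
exists back => [g|h]; apply: rhom_ext.
- move=> c; rewrite -(Kq c); move: (q' c).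
  apply: (@tens_ext R T X (reg A)) => [x y|x y|y u].
  + by rewrite qR.1 (rhomP (back _)).1.
  + by rewrite qR.1 (rhomP g).1.
  by rewrite backE actE.
have TF : firm_r T by exact: tens_reg_firm.
apply: (firm_ext TF) => [||y r].
- exact: (rhomP (rdual_to_rend (back h))).1.
- exact: (rhomP h).1.
rewrite (rhomP (rdual_to_rend (back h))).2 (rhomP h).2.
(* By the dual triangle identity, z r is determined by the values eps(z (x) u), and these agree for
   both endomorphisms. *)
rewrite -[LHS](firm_dual_dual_triangle iotaP) -[RHS](firm_dual_dual_triangle iotaP).
by apply: tlift_eq => e f; rewrite actE backE.
Qed.
End RightDual.
End DualRingIsomorphisms.

(** * Kernels of colinear maps and flatness *)

Section KernelComodule.
Variables (A : pzRingType) (C : coring A) (CF : unital_flat_l C).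
Variables (Y Z : comodule C) (k : chom Y Z).
Notation K := (rker_rmod k).

Fact rker_incl_rlinear : @rlinear A K Y (fun x : K => rker_val x).
Proof. by []. Qed.
Definition rker_incl : rhom K Y := Rhom rker_incl_rlinear.
Let i := rker_incl.

Lemma rker_unital : unital_r K.
Proof. by move=> x; apply: val_inj; exact: cm_unital. Qed.

Let iC_inj : injective (tmap i (@idfun C)).
Proof.
apply: (flat_l_inj CF) => [||x y]; [exact: rker_unital|exact: cm_unital|exact: val_inj].
Qed.

(** Flatness of C makes K (x)_A C the kernel of k (x)_A C, and colinearity of k places the coaction
    of an element of K in that kernel. *)
Fact rker_coact_ex (x : K) : exists y : tens K C, tmap i idfun y = coact (i x).
Proof.
have ex : exact_at i k.
  move=> y; split=> [yk|[z <-]]; last exact: (eqP (rker_valP z)).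
  have yk' : k y == 0 by rewrite yk.
  by exists (Rker yk').
apply/(CF rker_unital (@cm_unital A C Y) (@cm_unital A C Z) ex).
rewrite -[tmap _ _ _](chom_colinear k) [_ (i x)](eqP (rker_valP x)).
exact: (morphD0 (coact_rlinear Z).1).
Qed.
Definition rker_coact (x : K) : tens_r K C := sval (cid (rker_coact_ex x)).
Lemma rker_coactE x : tmap i (@idfun C) (rker_coact x) = coact (i x).
Proof. exact: svalP (cid (rker_coact_ex x)). Qed.

Let iP : rlinear i. Proof. exact: rhomP. Qed.

Fact rker_coact_rlinear : @rlinear A K (tens_r K C) rker_coact.
Proof.
have [tD tZ] : @rlinear A (tens_r K C) (tens_r Y C) (tmap i (@idfun C)) by exact: tmap_rlinear.
have [cD cZ] := coact_rlinear Y.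
split=> [x y|x a]; apply: iC_inj.
- by rewrite tD !rker_coactE -cD.
- by rewrite tZ !rker_coactE -cZ.
Qed.

Fact rker_coact_coassoc x :
  tassoc (tmap rker_coact idfun (rker_coact x)) = tmap idfun cdelta (rker_coact x).
Proof.
have iCP : @rlinear A (tens_r K C) (tens_r Y C) (tmap i (@idfun C)) by exact: tmap_rlinear.
(* Coassociativity is tested in Y (x)_A C (x)_A C; that K (x)_A C (x)_A C embeds there uses flatness
   of C twice. *)
have iCC_inj : injective (tmap i (@idfun (tens_b C C))).
  move=> y z yz; rewrite -[y]tassocVK -[z]tassocVK; congr tassoc.
  have CU := coring_unital_r (coringP C).
  apply: (@flat_l_inj _ _ _ _ _ (Rhom iCP) CF).
  - exact: unital_tens_r.
  - exact: unital_tens_r.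
  - exact: iC_inj.
  - by apply: (can_inj (@tassocK _ _ _ Y C C)); rewrite /= !tassoc_natural // !tassocVK.
have cP := rker_coact_rlinear; have cY := coact_rlinear Y.
have dL := (cdelta_bilinear (coringP C)).1.
apply: iCC_inj; rewrite -tassoc_natural // tmap_comp //.
transitivity (tassoc (tmap (coact : Y -> tens_r Y C) (@idfun C) (tmap i (@idfun C) (rker_coact x)))).
  congr tassoc; rewrite tmap_comp //; apply: tlift_eq => y c /=.
  by rewrite rker_coactE.
by rewrite rker_coactE coact_coassoc -rker_coactE !tmap_comp.
Qed.

Fact rker_coact_counit x :
  tlift (fun (y : K) (c : C) => ract y (ceps c)) (rker_coact x) = x.
Proof.
apply: val_inj; rewrite -[LHS]/(i (counit_at (rker_coact x))).
rewrite -(counit_at_natural _ iP) rker_coactE; exact: coact_counit.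
Qed.

Definition rker_comod : comodule C :=
  Comodule rker_unital rker_coact_rlinear rker_coact_coassoc rker_coact_counit.
Fact rker_incl_colinear : @colinear A C rker_comod Y i.
Proof. by move=> x; rewrite rker_coactE. Qed.
Definition rker_chom : chom rker_comod Y := Chom rker_incl_colinear.
End KernelComodule.

Section FaithfullyFlat.
Variables (A : pzRingType) (C : coring A) (R : firm_rng) (X : bicomodule C R).
Hypothesis CF : unital_flat_l C.
Hypothesis XF : firm_l X.
Hypothesis eqv : inverse_equivalences (tens_functor X) (hom_functor X).

Lemma equivalence_tens_faithful (M N : firm_rmod R) (f g : rhom M N) :
  tmap f (@idfun X) =1 tmap g (@idfun X) -> f = g.
Proof.
move=> fg; apply: (@equivalence_faithful _ _ (tens_functor X) (hom_functor X) eqv.1 M N f g).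
exact: chom_ext.
Qed.

Fact bc_act_rlinear : @rlinear R (reg R) (chom_rmod X X) (fun r => bc_act r).
Proof.
by split=> [r s|r s]; apply: chom_ext => u /=; [exact: bc_actD|rewrite bc_actM].
Qed.
Let act : chom (tens_comod X (reg R)) X := tens_chom_lift (Rhom bc_act_rlinear).

(* By fullness h is induced by a map R -> M (x)_R R, hence by a map R -> M. *)
Lemma equivalence_hom_to_tens (M : rmod R) (h : chom X (tens_comod X M)) :
  exists2 t : R -> M, rlinear (t : reg R -> M) & forall (r : R) (u : X), h (lact r u) = t r ⊗ u.
Proof.
pose MR : firm_rmod R := FirmRmod (tens_reg_firm M).
have aP := acc_r_rlinear M.
pose a : chom (tens_comod X MR) (tens_comod X M) := tens_chom X (Rhom aP).
have [b [ba ab]] : is_iso (a : @hom (comod_cat C) _ _).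
  by apply: comod_is_iso; exact: tmap_acc_bij.
pose H : chom (tens_comod X (reg_firm R)) (tens_comod X MR) :=
  chom_comp (b : chom _ _) (chom_comp h act).
have [t' tE] := @equivalence_full _ _ (tens_functor X) (hom_functor X) eqv (reg_firm R) MR H.
exists (acc_r M \o (t' : rhom (reg_firm R) MR)).
  exact: rlinear_comp aP (rhomP (t' : rhom (reg_firm R) MR)).
move=> r u.
have E : h (lact r u) = a (H ((r : reg R) ⊗ u)).
  transitivity (chom_comp a (b : chom _ _) (h (act ((r : reg R) ⊗ u)))) => //.
  rewrite /act tens_chom_liftE.
  by rewrite -[LHS](congr1 (fun k : chom (tens_comod X M) (tens_comod X M) => k (h (lact r u))) ab).
rewrite E -tE /= (tmapE _ _ (rhomP (t' : rhom (reg_firm R) MR))) // tmapE //.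
Qed.

Lemma equivalence_faithfully_flat : faithfully_flat_l X.
Proof.
split; last first.
  move=> M M' f g MF MF' fg.
  exact: (@equivalence_tens_faithful (FirmRmod MF) (FirmRmod MF') f g).
move=> M' M M'' f g _ _ _ ex v.
have fP := rhomP f; have gP := rhomP g.
have fXD := tmapD fP (llinear_id X).
split=> [gv|[u <-]]; last first.
  rewrite tmap_comp //; elim/tens_ind: u => [|x y Ex Ey|m u].
  - by rewrite morphD0 //; apply: tmapD => //; exact: rlinear_comp.
  - by rewrite tmapD ?Ex ?Ey ?addr0 //; exact: rlinear_comp.
  rewrite tmapE //=; last exact: rlinear_comp.
  have -> : g (f m) = 0 by apply/ex; exists m.
  by apply: (@morphD0 M'' _ (fun x => x ⊗ u)) => x y; exact: tpureDl.
pose k : chom (tens_comod X M) (tens_comod X M'') := tens_chom X g.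
have kv : k v == 0 by apply/eqP.
pose K := rker_comod CF k; pose i : chom K (tens_comod X M) := rker_chom CF k.
pose p : K := Rker kv.
(* By surjectivity of evaluation, v is a sum of values h(w) of colinear maps h : X -> K. *)
have [e _ Ke] := equivalence_eval_bij XF eqv K.
have -> : v = i p by [].
rewrite -(Ke p); elim/tens_ind: (e p) => [|x y [x' Ex] [y' Ey]|h w].
- exists 0; rewrite (morphD0 fXD); symmetry.
  exact: (morphD0 (rlinear_comp (rhomP i) (rhomP (chom_eval X K))).1).
- exists (x' + y'); rewrite fXD Ex Ey; symmetry.
  exact: (rlinear_comp (rhomP i) (rhomP (chom_eval X K))).1.
rewrite chom_evalE.
have [t tP tE] := equivalence_hom_to_tens (chom_comp i h).
(* g t vanishes after tensoring with X. As M'' need not be firm, faithfulness is applied to the lift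
   R -> M'' (x)_R R of g t. *)
have gt : g \o t =1 (fun=> 0).
  have gtP := rlinear_comp gP tP.
  have RF := fr_firm R.
  pose MR : firm_rmod R := FirmRmod (tens_reg_firm M'').
  have c0 : (Rhom (corefl_rlinear RF gtP) : rhom (reg_firm R) MR) = 0.
    apply: equivalence_tens_faithful => x.
    apply: (bij_inj (tmap_acc_bij XF M'')).
    have aP := acc_r_rlinear M''.
    have zP := rhomP (0 : rhom (reg_firm R) MR).
    rewrite !tmap_comp //; last exact: corefl_rlinear.
    move: x; apply: tens_ext => [x y|x y|r u].
    - by rewrite tmapD //; apply: rlinear_comp => //; exact: corefl_rlinear.
    - by rewrite tmapD //; exact: rlinear_comp.
    rewrite !tmapE //; try exact: rlinear_comp; last by apply: rlinear_comp => //; exact: corefl_rlinear.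
    rewrite /= (acc_corefl _ RF gtP) (morphD0 aP.1) /=.
    transitivity (tmap g (@idfun X) (t r ⊗ u)); first by rewrite tmapE.
    rewrite -tE.
    rewrite [LHS](eqP (rker_valP (h (lact r u)))).
    by symmetry; apply: (@morphD0 M'' _ (fun x => x ⊗ u)) => x y; exact: tpureDl.
  move=> r; rewrite -(@acc_corefl R (reg R) M'' _ r RF gtP).
  transitivity (acc_r M'' (rhom_fun (Rhom (corefl_rlinear RF gtP) : rhom (reg_firm R) MR) r)) => //.
  rewrite c0; exact: (morphD0 (@acc_rD _ M'')).
(* w is a sum of elements r u, on which i h takes the value t r (x) u; exactness then gives a
   preimage of t r under f. *)
move: w; have [g' g'K Kg'] := XF => w; rewrite -(Kg' w).
elim/tens_ind: (g' w) => [|x y [x' Ex] [y' Ey]|r u].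
- exists 0; rewrite (morphD0 fXD) (morphD0 (@acc_lD _ X)); symmetry.
  exact: (morphD0 (rlinear_comp (rhomP i) (rhomP h)).1).
- exists (x' + y'); rewrite fXD Ex Ey acc_lD; symmetry.
  exact: (rlinear_comp (rhomP i) (rhomP h)).1.
rewrite acc_lE -[_ (_ (lmact r u))]/(chom_comp i h (lact r u)) tE.
have [m' <-] : exists m', f m' = t r by apply/ex; exact: gt.
by exists (m' ⊗ u); rewrite tmapE.
Qed.
End FaithfullyFlat.

(** * Faithful flatness and the converse *)

Section Cokernel.
Local Open Scope quotient_scope.
Variables (R : rng) (M N : rmod R) (f : rhom M N).

Definition rimage : {pred N} := fun n => `[< exists m, f m = n >].
Fact rimage_zmod_closed : zmod_closed rimage.
Proof.
have fD := (rhomP f).1; split=> [|x y]; first by apply/asboolP; exists 0; exact: morphD0.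
move=> /asboolP[m <-] /asboolP[m' <-]; apply/asboolP; exists (m - m').
by rewrite fD (morphDN fD).
Qed.
HB.instance Definition _ := GRing.isZmodClosed.Build N rimage rimage_zmod_closed.

Definition coker := Quotient.quot rimage.
HB.instance Definition _ := GRing.Zmodule.on coker.
Definition coker_pi (n : N) : coker := \pi n.

Fact coker_piD : {morph coker_pi : x y / x + y}.
Proof. exact: raddfD. Qed.
Fact coker_pi_eq (x y : N) : coker_pi x = coker_pi y <-> exists m, f m = x - y.
Proof.
split=> [/eqP|xy]; first by rewrite -Quotient.idealrBE => /asboolP.
by apply/eqP; rewrite -Quotient.idealrBE; apply/asboolP.
Qed.
Definition coker_ract (x : coker) (r : R) : coker := coker_pi (ract (repr x) r).
Fact coker_ractE (n : N) (r : R) : coker_ract (coker_pi n) r = coker_pi (ract n r).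
Proof.
have /coker_pi_eq[m mE] : coker_pi (repr (coker_pi n)) = coker_pi n by exact: reprK.
by apply/coker_pi_eq; exists (ract m r); rewrite (rhomP f).2 mE ractDl ractN.
Qed.
Fact coker_piP (x : coker) : exists n, coker_pi n = x.
Proof. by exists (repr x); exact: reprK. Qed.
Fact coker_ractDl x y r : coker_ract (x + y) r = coker_ract x r + coker_ract y r.
Proof.
have [n <-] := coker_piP x; have [m <-] := coker_piP y.
by rewrite -coker_piD !coker_ractE ractDl coker_piD.
Qed.
Fact coker_ractDr x r s : coker_ract x (r + s) = coker_ract x r + coker_ract x s.
Proof. by have [n <-] := coker_piP x; rewrite !coker_ractE ractDr coker_piD. Qed.
Fact coker_ractA x r s : coker_ract (coker_ract x r) s = coker_ract x (rmul r s).
Proof. by have [n <-] := coker_piP x; rewrite !coker_ractE ractA. Qed.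
Definition coker_rmod : rmod R := Rmod coker_ractDl coker_ractDr coker_ractA.
Fact coker_pi_rlinear : @rlinear R N coker_rmod coker_pi.
Proof. by split=> [|x r]; [exact: coker_piD|rewrite -coker_ractE]. Qed.
End Cokernel.

Section FaithfulReflectsBijections.
Variables (R : firm_rng) (S : rng) (X : bimod R S).
Hypothesis XF : firm_l X.
Hypothesis faithful : forall (M M' : rmod R) (f g : rhom M M'), firm_r M -> firm_r M' ->
    tmap f (@idfun X) =1 tmap g (@idfun X) -> f = g.
Variables (M N : rmod R) (f : rhom M N).
Hypotheses (MF : firm_r M) (NF : firm_r N).
Hypothesis fB : bijective (tmap f (@idfun X)).
Let fP := rhomP f.

(** The projection onto the cokernel Q is lifted to a map N -> Q (x)_R R between firm modules. The
    lift vanishes on the image of f, hence after tensoring with X because f (x)_R X is onto; so the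
    lift and the projection are zero. *)
Lemma faithful_surj n : exists m, f m = n.
Proof.
pose Q := coker_rmod f; have piP := coker_pi_rlinear f.
have qP := corefl_rlinear NF piP.
have q0 : (Rhom qP) = 0 :> rhom N (tens_r Q (reg R)).
  apply: faithful => //; first exact: tens_reg_firm.
  have [g _ Kg] := fB => x; rewrite -(Kg x) !tmap_comp //; last exact: rhomP.
  move: (g x); apply: tens_ext => [y z|y z|m u].
  - by rewrite tmapD //; apply: rlinear_comp.
  - by rewrite tmapD //; apply: rlinear_comp => //; exact: rhomP.
  rewrite !tmapE //; try by [apply: rlinear_comp|apply: rlinear_comp => //; exact: rhomP].
  congr (_ ⊗ _); rewrite /=; move: m; apply: (firm_ext MF) => [y z|y z|m r].
  - by rewrite fP.1 qP.1.
  - by rewrite addr0.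
  rewrite fP.2 (corefl_ract _ _ NF piP).
  have -> : coker_pi f (f m) = 0.
    rewrite -[RHS](morphD0 piP.1); apply/coker_pi_eq.
    by exists m; rewrite subr0.
  by apply: (@morphD0 Q _ (fun x => x ⊗ (r : reg R))) => y z; exact: tpureDl.
have : coker_pi f n = coker_pi f 0.
  rewrite [RHS](morphD0 piP.1) -(acc_corefl n NF piP).
  rewrite -[corefl _ n]/(rhom_fun (Rhom qP) n) q0; exact: (morphD0 (@acc_rD _ Q)).
by move=> /coker_pi_eq; rewrite subr0.
Qed.

(** The kernel of f need not be firm, and faithfulness only gives (ker f) R = 0. As R is spanned by
    products, m (x) t in M (x)_R R then depends only on f(m) and t. This yields a left inverse of f
    (x)_R R, and firmness of M concludes. *)
Lemma faithful_inj : injective f.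
Proof.
pose K := rker_rmod f.
have iP : @rlinear R K M (fun k => rker_val k) by [].
have aP := rlinear_comp iP (acc_r_rlinear K).
have a0 : Rhom aP = 0 :> rhom (tens_r K (reg R)) M.
  apply: faithful => //; first exact: tens_reg_firm.
  apply: tens3_ext => [x y|x y|k r u].
  - by rewrite tmapD.
  - by rewrite tmapD //; exact: (rhomP (0 : rhom (tens_r K (reg R)) M)).
  rewrite !tmapE //; last exact: (rhomP (0 : rhom (tens_r K (reg R)) M)).
  apply: (bij_inj fB); rewrite !tmapE //= acc_rE fP.2 (eqP (rker_valP k)).
  by rewrite (morphD0 fP.1) ract0.
have kr (k : K) (r : R) : ract (rker_val k) r = 0.
  have := congr1 (fun h : rhom (tens_r K (reg R)) M => h (k ⊗ (r : reg R))) a0.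
  by rewrite /= acc_rE.
(* A set-theoretic section of f suffices: n (x) t |-> s n (x) t is balanced because a tensor m (x) t
   depends on m only through f(m). *)
pose s n := sval (cid (faithful_surj n)).
have sE n : f (s n) = n by exact: svalP (cid (faithful_surj n)).
have f0 m t : f m = 0 -> m ⊗ t = 0 :> tens M (reg R).
  move=> fm; move: t; apply: (firm_ext (fr_firm R)) => [x y|x y|r t].
  - exact: tpureDr.
  - by rewrite addr0.
  have fm0 : f m == 0 by rewrite fm.
  rewrite -[ract r t]/(lmact (r : R) (t : reg R)) -tpureM (kr (Rker fm0)).
  by apply: (@morphD0 M _ (fun x => x ⊗ (t : reg R))) => y z; exact: tpureDl.
have f_eq m m' t : f m = f m' -> m ⊗ t = m' ⊗ t :> tens M (reg R).
  move=> mm'; have -> : m = (m - m') + m' by rewrite subrK.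
  rewrite tpureDl f0 ?add0r //.
  by rewrite fP.1 (morphDN fP.1) mm' subrr.
have sB : balanced (fun (n : N) (t : reg R) => s n ⊗ t : tens M (reg R)).
  split=> [n n' t|n t t'|n r t].
  - by rewrite -tpureDl; apply: f_eq; rewrite fP.1 !sE.
  - exact: tpureDr.
  - by rewrite -tpureM; apply: f_eq; rewrite fP.2 !sE.
apply: (morph_inj fP.1) => m fm.
rewrite -(firm_accK MF m).
suff -> : unacc_r M m = 0 by exact: (morphD0 (@acc_rD _ M)).
have E : unacc_r M m = tlift (fun (n : N) (t : reg R) => s n ⊗ t : tens M (reg R)) (unacc_r N (f m)).
  have uN := unacc_rlinear NF; have uM := unacc_rlinear MF.
  move: {fm} m; apply: (firm_ext MF) => [x y|x y|m r].
  - exact: uM.1.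
  - by rewrite fP.1 uN.1 (tliftD sB).
  by rewrite fP.2 !unacc_ract // (tliftE _ _ sB); apply: f_eq; rewrite sE.
rewrite E fm (morphD0 (unacc_rlinear NF).1); exact: (morphD0 (tliftD sB)).
Qed.

Lemma faithful_bij : bijective f.
Proof. exact: inj_surj_bij faithful_inj faithful_surj. Qed.
End FaithfulReflectsBijections.

Section Converse.
Variables (A : pzRingType) (C : coring A) (R : firm_rng) (X : bicomodule C R).
Hypothesis XC : comonadic_galois X.
Hypothesis XFF : faithfully_flat_l X.
Let XF := XC.1.

Lemma can_atE (M : rmod A) (f : rhom X M) (u : X) :
  @can_at A C R X M ((f : rhom_rmod X M) ⊗ u) = tmap f (@idfun C) (coact u).
Proof.
by rewrite can_at_eval tmapE ?chom_evalE //; exact: cofree_lift_rhom_rlinear.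
Qed.
Lemma can_atD (M : rmod A) : {morph @can_at A C R X M : x y / x + y}.
Proof.
move=> x y; rewrite !can_at_eval tmapD //; last exact: cofree_lift_rhom_rlinear.
exact: (rhomP (chom_eval X (cofree C M))).1.
Qed.

Section Evaluation.
Variable Y : comodule C.
Notation XY := (rhom_rmod X Y).

Lemma can_at_incl (x : tens (chom_rmod X Y) X) :
  @can_at A C R X Y (tmap (chom_incl X Y) (@idfun X) x) = coact (chom_eval X Y x).
Proof.
have iP := rhomP (chom_incl X Y).
move: x; apply: (@tens_ext R (chom_rmod X Y) X (tens_r Y C)) => [x y|x y|f u].
- by rewrite tmapD // can_atD.
- by rewrite (rhomP (chom_eval X Y)).1 (coact_rlinear Y).1.
by rewrite tmapE // can_atE chom_evalE chom_colinear.
Qed.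

Lemma can_at_lift (x : tens XY X) :
  @can_at A C R X (tens_r Y C) (tmap (lift_rhom X Y) (@idfun X) x)
  = cofree_coact (@can_at A C R X Y x).
Proof.
have lP := rhomP (lift_rhom X Y).
move: x; apply: (@tens_ext R XY X (tens_r (tens_r Y C) C)) => [x y|x y|f u].
- by rewrite (tmapD lP) // can_atD.
- by rewrite can_atD (cofree_coact_rlinear C Y).1.
rewrite (tmapE _ _ lP) // !can_atE.
exact: esym (chom_colinear (@cofree_lift A C X Y f) u).
Qed.

Lemma can_at_post (x : tens XY X) :
  @can_at A C R X (tens_r Y C) (tmap (post_coact X Y) (@idfun X) x)
  = tmap (coact : Y -> tens_r Y C) (@idfun C) (@can_at A C R X Y x).
Proof.
have pP := rhomP (post_coact X Y).
have cP : @rlinear A Y (tens_r Y C) coact := coact_rlinear Y.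
move: x; apply: (@tens_ext R XY X (tens_r (tens_r Y C) C)) => [x y|x y|f u].
- by rewrite (tmapD pP) // can_atD.
- by rewrite can_atD (tmapD cP).
rewrite (tmapE _ _ pP) // !can_atE tmap_comp //; exact: rhomP.
Qed.

(** The canonical maps at Y and at Y (x)_A C translate the equalizer defining Hom^C(X, Y), tensored
    with the flat module X, into the coaction Y -> Y (x)_A C followed by the two maps to Y (x)_A C
    (x)_A C. The coaction is injective and equalizes these two maps, which gives injectivity and
    surjectivity of evaluation. *)
Lemma comonadic_eval_bij : bijective (chom_eval X Y).
Proof.
have canB := XC.2 Y (@cm_unital A C Y).
have [can' canK Kcan] := canB.
have YCU : unital_r (tens_r Y C) by exact: cofree_unital.
apply: inj_surj_bij => [x y xy|y].
  apply: (tmap_chom_incl_inj XFF.1); apply: (can_inj canK).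
  by rewrite !can_at_incl xy.
have /(tmap_chom_incl_exact XFF.1)[x xE] : tmap (lift_rhom X Y) (@idfun X) (can' (coact y))
    = tmap (post_coact X Y) (@idfun X) (can' (coact y)).
  apply: (bij_inj (XC.2 _ YCU)); rewrite can_at_lift can_at_post Kcan.
  by rewrite /cofree_coact -coact_coassoc tassocK.
by exists x; apply: coact_inj; rewrite -can_at_incl xE Kcan.
Qed.
End Evaluation.

Lemma hom_counit_natural (Y Z : comodule C) (k : chom Y Z) x :
  hom_counit X Z (tmap (tmap (fun g : chom_rmod X Y => chom_comp k g : chom_rmod X Z) idfun : hom_firm X Y -> hom_firm X Z) (@idfun X) x)
  = k (hom_counit X Y x).
Proof.
have hP := hom_map_rlinear X k.
move: x; apply: tens3_ext => [x y|x y|f r u].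
- by rewrite (tmapD hP) // (rhomP (hom_counit X Z)).1.
- by rewrite (rhomP (hom_counit X Y)).1 (rhomP k).1.
rewrite (tmapE _ _ hP) // tmapE //; last exact: hom_map_rlinear0.
by rewrite !hom_counitE.
Qed.

Definition tens_unit (M : firm_rmod R) : rhom M (hom_firm X (tens_comod X M)) :=
  tens_hom_transpose (chom_id (tens_comod X M)).

(** A triangle identity of the adjunction. Once the counit is bijective, it makes the unit bijective
    after tensoring with X, which faithfulness reflects to the unit itself. *)
Lemma hom_counit_unit (M : firm_rmod R) (x : tens M X) :
  hom_counit X (tens_comod X M) (tmap (tens_unit M) (@idfun X) x) = x.
Proof.
have uP := rhomP (tens_unit M); have MF := fm_firm M.
move: x; apply: (@tens_ext R M X) => [x y|//|m u].
- by rewrite tmapD // (rhomP (hom_counit X (tens_comod X M))).1.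
rewrite tmapE //; move: m; apply: (firm_ext MF) => [m m'|m m'|m r].
- by rewrite uP.1 tpureDl (rhomP (hom_counit X (tens_comod X M))).1.
- exact: tpureDl.
have -> : tens_unit M (ract m r) = (tpure_chom X m : chom_rmod X (tens_comod X M)) ⊗ (r : reg R).
  rewrite /= (corefl_ract _ _ MF (rhomP (tens_chom_cur _))); congr (_ ⊗ _).
  exact: chom_ext.
by rewrite hom_counitE /= tpureM.
Qed.

Lemma comonadic_equivalence : inverse_equivalences (tens_functor X) (hom_functor X).
Proof.
have cB Y : bijective (hom_counit X Y).
  by apply: hom_counit_bij => //; exact: comonadic_eval_bij.
have uB (M : firm_rmod R) : bijective (tens_unit M).
  apply: (faithful_bij XFF.2 (fm_firm M) (fm_firm (hom_firm X (tens_comod X M)))).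
  have [c cK Kc] := cB (tens_comod X M).
  apply: (eq_bij (f := c)) => [|x]; first by exists (hom_counit X (tens_comod X M)).
  by apply: (can_inj cK); rewrite Kc hom_counit_unit.
split.
- apply: nat_iso_sym.
  exists (fun M => tens_unit M : @hom (firm_cat R) M _); split=> [M N f|M]; last by apply: firm_is_iso; exact: uB.
  have tl := @transpose_natl _ _ (tens_functor X) (hom_functor X) (tens_hom_adj X) N M
     (tens_comod X N) f (chom_id (tens_comod X N)).
  have tr := @transpose_natr _ _ (tens_functor X) (hom_functor X) (tens_hom_adj X) M
     (tens_comod X M) (tens_comod X N) (tens_chom X f) (chom_id (tens_comod X M)).
  pose tr_ M' := @transpose _ _ (tens_functor X) (hom_functor X) (tens_hom_adj X) M'
     (tens_comod X N).
  transitivity (tr_ M (tens_chom X f)).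
  + by rewrite -[LHS]tl; apply: (congr1 (@tr_ M)); exact: chom_ext.
  + by rewrite -[RHS]tr; apply: (congr1 (@tr_ M)); exact: chom_ext.
- exists (fun Y => hom_counit X Y : @hom (comod_cat C) _ Y); split=> [Y Z k|Y]; last by apply: comod_is_iso; exact: cB.
  by apply: chom_ext => x; exact: hom_counit_natural.
Qed.
End Converse.

Theorem theorem3p4 (R : firm_rng) (A : pzRingType) (C : coring A) :
  (forall (F : functor (firm_cat R) (comod_cat C))
          (G : functor (comod_cat C) (firm_cat R)) (adj : adjunction F G),
    let Sigma : bicomodule C R := FR adj in
    let SigmaC : comod_cat C := bc_comod Sigma in
    (* (a) *)
    (has_right_adjoint G ->
      [/\ (* (i) *)
          exists (sigma : R -> tens_b Sigma (firm_dual Sigma))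
                 (tau : tens_b (firm_dual Sigma) Sigma -> rng_of_ring A),
            comatrix_context sigma tau,
          (* (ii) *)
          firmly_projective Sigma
        & (* (iii) *)
          flat_l (reg R) ->
          forall (iota : rng_hom R (elt_rng Sigma)) (iotaP : firmly_projective_via iota),
            nat_iso (comp_functor (firm_incl R) G)
                    (cotens_functor (firm_dual_left_coaction iotaP))])
    /\
    (* (b) *)
    (inverse_equivalences F G ->
      [/\ (* (i) *)
          [/\ galois_comodule Sigma,
              exists iota : rng_hom R (elt_rng Sigma),
                [/\ firmly_projective_via iota,
                    comatrix_context (firm_dual_eta iota) (firm_dual_eps (X := Sigma))
                  & coring_isomorphic (firm_dual_comatrix iota) C]
            & ring_isomorphic (ldual_ring C) (lend_ring Sigma)],
          (* (ii) *)
          [/\ comonadic_galois Sigma,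
              exists iota : rng_hom R (elt_rng Sigma),
                firmly_projective_via iota /\ coring_isomorphic (dual_comatrix iota) C
            & ring_isomorphic (rdual_ring C) (rend_ring (firm_dual Sigma))],
          (* (iii) *)
          generator SigmaC,
          (* (iv) *)
          projective (reg_firm R : firm_cat R) ->
            projective SigmaC /\ generator SigmaC
        & (* (v) *)
          unital_flat_l C -> faithfully_flat_l Sigma]))
  /\
  (* Conversely *)
  (forall Sigma : bicomodule C R,
    firm_l Sigma ->
    unital_flat_l C ->
    comonadic_galois Sigma ->
    faithfully_flat_l Sigma ->
    inverse_equivalences (tens_functor Sigma) (hom_functor Sigma)).
Proof.
split; last by move=> X XF _ XC XFF; exact: comonadic_equivalence.
move=> F G adj X XC; have XF : firm_l X := FR_firm adj.
have isoG := right_adjoint_iso_hom adj; have isoF := left_adjoint_iso_tens adj.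
split=> [Gadj|eqv].
  (* The right adjoint of G is also one of the Hom functor of X, to which G is isomorphic. *)
  have [H [adjH]] := has_right_adjoint_iso (nat_iso_sym isoG) Gadj.
  have XP : firmly_projective X.
    by apply: firmly_projective_of_tens_dual => //; exact: tens_dual_bij adjH X.
  split=> //.
  - have [iota iotaP] := XP; exists (firm_dual_eta iota), (firm_dual_eps (X := X)).
    exact: firm_dual_context.
  - move=> RF iota iotaP; apply: nat_iso_trans (hom_functor_cotens iotaP RF).
    apply: nat_iso_comp; first exact: nat_iso_sym.
    exists (fun M => idm (firm_incl R M)); split=> [M N f|M]; first by rewrite compm1 comp1m.
    by exists (idm (firm_incl R M)); rewrite comp1m.
have eqv' := inverse_equivalences_iso (nat_iso_sym isoF) (nat_iso_sym isoG) eqv.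
have XCG := equivalence_comonadic XF eqv'; have canB := can_bij XCG.
have [iota iotaP] := equivalence_firmly_projective XF eqv'.
have XG := equivalence_generator XF eqv'.
have canI := can_coring_iso iotaP canB.
split=> //.
- split.
  + by exists iota.
  + exists iota; split=> //; first exact: firm_dual_context.
    eexists; exact: coring_iso_comp canI (acc_coring_iso iotaP).
  + exact: ldual_lend_isomorphic iotaP canB.
- split=> //; first by exists iota; split=> //; eexists; exact: canI.
  exact: rdual_rend_isomorphic iotaP canB.
(* X is F(R), and F preserves projective objects because the equivalence G preserves
   epimorphisms. *)
- move=> RP; split=> //; apply: (left_adjoint_projective adj) RP.
  exact: equivalence_epi eqv.
- by move=> CF; exact: equivalence_faithfully_flat CF XF eqv'.
Qed.
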